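(* Fix $d\ge 2$ and consider either of the two random models below (Model 1 or Model 2). Let $T_n$ be the minimal spanning tree of the resulting $n$-vertex network, and for $\delta>0$ let \[ \varepsilon_n(\delta):=\min\Big\{\frac{\mathrm{len}(T_n')-\mathrm{len}(T_n)}{n}\;:\; T_n' \text{ a spanning tree with } |T_n'\setminus T_n|\ge \delta n\Big\}. \] Then \[ \text{(a)}\quad \limsup_{\delta\downarrow 0}\,\delta^{-2}\,\limsup_{n\to\infty}\mathbb{E}\,\varepsilon_n(\delta)<\infty, \qquad \text{(b)}\quad \liminf_{\delta\downarrow 0}\,\delta^{-2}\,\liminf_{n\to\infty}\mathbb{E}\,\varepsilon_n(\delta)>0 . \]
   Context: A network is a graph whose edges $e$ have positive lengths $\mathrm{len}(e)$; a spanning tree $T$ is identified with its edge set and $\mathrm{len}(T)=\sum_{e\in T}\mathrm{len}(e)$; the minimal spanning tree (MST) is a spanning tree of minimal length (a.s. unique in both models since edge lengths are a.s. distinct). $T_n'\setminus T_n$ denotes the set of edges of $T_n'$ not in $T_n$. Model 1 (disordered lattice): the vertex set is $\{1,\dots,m\}^d$ with edges between pairs of vertices at Euclidean distance $1$, so $n=m^d$; edge lengths are i.i.d. random variables whose common distribution has finite mean and a bounded continuous density. Model 2 (random Euclidean): $n$ independent points uniformly distributed in the cube $[0,n^{1/d}]^d$, forming the complete graph on these points with Euclidean distances as edge lengths. *)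

(* Defs.v *)
From HB Require Import structures.
From mathcomp Require Import all_boot all_order all_algebra.
From mathcomp Require Import all_classical all_reals all_analysis.
Set Implicit Arguments. Unset Strict Implicit. Unset Printing Implicit Defensive.
Import Order.TTheory GRing.Theory Num.Theory.
Import numFieldNormedType.Exports.
Local Open Scope ring_scope.

(* ---------- Networks on a finite vertex type V ----------
   An edge is a 2-element subset of V; a graph is given by its edge set
   E : {set {set V}}; edge lengths are a function l : {set V} -> R
   (only its values on edges matter). *)
Section Networks.
Context {R : realType} {V : finType}.

Definition adj (T : {set {set V}}) : rel V := fun u v => [set u; v] \in T.

Definition connectedb (T : {set {set V}}) : bool :=
  [forall u, forall v, connect (adj T) u v].

(* (V, T) is acyclic: no edge lies on a cycle, i.e. the endpoints of every
   edge e are not connected in T \ {e}. *)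
Definition acyclicb (T : {set {set V}}) : bool :=
  [forall u, forall v, ([set u; v] \in T) && (u != v) ==>
      ~~ connect (adj (T :\ [set u; v])) u v].

Definition spanning_tree (E T : {set {set V}}) : bool :=
  [&& T \subset E, [forall e in T, #|e| == 2], connectedb T & acyclicb T].

Definition len (l : {set V} -> R) (T : {set {set V}}) : R := \sum_(e in T) l e.

Definition is_mst (E : {set {set V}}) (l : {set V} -> R) (T : {set {set V}}) : bool :=
  spanning_tree E T && [forall T', spanning_tree E T' ==> (len l T <= len l T')].

(* the minimal spanning tree (a.s. unique; on the null event of ties some
   minimizer is picked, and set0 if the graph has no spanning tree) *)
Definition mst (E : {set {set V}}) (l : {set V} -> R) : {set {set V}} :=
  odflt finset.set0 [pick T | is_mst E l T].

(* eps_n(delta) with n = #|V|; the minimum over an empty family is +oo *)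
Definition eps (E : {set {set V}}) (l : {set V} -> R) (delta : R) : \bar R :=
  let n := #|V| in
  let T := mst E l in
  ereal_inf [set ((len l T' - len l T) / n%:R)%:E |
              T' in [set T' | spanning_tree E T' &&
                              (delta * n%:R <= (#|T' :\: T|)%:R)]]%classic.
End Networks.

Definition mutually_independent {d} {Omega : measurableType d} {R : realType}
  (P : probability Omega R) {I : finType} (A : {set I}) (X : I -> Omega -> R) : Prop :=
  forall J : {set I}, J \subset A ->
  forall B : I -> set R, (forall i, measurable (B i)) ->
    P (\bigcap_(i in [set i | i \in J]) (X i @^-1` B i))%classic =
    (\prod_(i in J) P (X i @^-1` B i)%classic)%E.

(* ---------- Model 1: the lattice {1..m}^d (encoded as {0..m-1}^d) ---------- *)
Definition lattice_vertex (d m : nat) := {ffun 'I_d -> 'I_m}.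

Definition lattice_adj {d m : nat} (u v : lattice_vertex d m) : bool :=
  (\sum_(k < d) ((u k : nat)%:Z - (v k : nat)%:Z) ^+ 2 == 1)%R.

Definition lattice_edges (d m : nat) : {set {set lattice_vertex d m}} :=
  [set [set u; v] | u in [set: lattice_vertex d m], v in [set w | lattice_adj u w]].

Definition complete_edges (n : nat) : {set {set 'I_n}} :=
  [set e : {set 'I_n} | #|e| == 2].

Definition eucl_len {R : realType} {n d : nat} (x : 'I_n -> 'I_d -> R)
  (e : {set 'I_n}) : R :=
  \sum_(i in e) \sum_(j in e | (i < j)%N)
     Num.sqrt (\sum_(k < d) (x i k - x j k) ^+ 2).

(* Main.v *)
(* Let T be the minimal tree and l the edge lengths.

   Lower bound. Call an edge uv cheap if u and v are joined by other edges of length at most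
   l(uv), but not by those of length at most l(uv) - x. Shortening the edges of T' outside T that
   are not cheap by x leaves T minimal, so len T' - len T is at least x times their number.
   Resampling one edge (lattice) or moving one point (Euclidean) shows that the expected number
   of cheap edges is O(x n); with x a small multiple of delta, at most delta n / 2 edges are
   cheap with probability at least 1/2, and the excess is at least x delta n / 2. In the Euclidean
   case a cheap pair at distance r leaves a cell of size comparable to r empty around its
   midpoint, which makes the sum over all scales converge.

   Upper bound. A positive density of places carries a vertex c with exactly two light edges ca
   and cb, where a and b are joined by still lighter edges. The tree uses exactly one of ca, cb,
   and they may be exchanged. Sorting the lengths into about 1 / delta bins, Cauchy-Schwarz
   gives 4 delta n places in expectation where ca and cb lie in the same bin; exchanging delta n
   of them costs O(delta) each. By the Efron-Stein inequality there are enough such places up to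
   probability O(1 / n), and then disjoint edges outside T are inserted instead.

   Both arguments run on finitely many labels (bins of lengths, grid positions), so that all
   probabilities are finite sums. *)
Require Import Defs.
From HB Require Import structures.
From mathcomp Require Import all_boot all_order all_algebra.
From mathcomp Require Import all_classical all_reals all_analysis.
From mathcomp Require Import measurable_realfun.
From mathcomp Require Import ring lra zify.
Set Implicit Arguments. Unset Strict Implicit. Unset Printing Implicit Defensive.
Import Order.TTheory GRing.Theory Num.Theory.
Import numFieldNormedType.Exports.
Local Open Scope ring_scope.

(** The square arises as about [delta n] changed edges at a cost of about [delta] each. For the
    lower bound, freeze the rest of the network: an edge is cheap only if its length lies in a
    window of width [x] above the level at which the other edges join its ends. On the lattice the
    bounded density prices this window. Euclidean lengths cannot be resampled one at a time, so
    there the window becomes a thin annulus for one moved point; its volume grows with the radius,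
    and the empty cell compensates for that. For the upper bound, the expected number of near ties
    is not enough: when they are too few, only a crude tree is at hand, whose excess per vertex is
    of order 1 in mean on the lattice, after truncation, and of order [n ^ (1 / d)] for points. A
    failure probability [O(1 / n)] beats both, the latter because [d >= 2]. Trees are compared
    through weak inequalities only, so ties need no separate treatment. [eps] is never shown to be
    measurable: its integral is compared with integrals of measurable bounds. *)

(** * Spanning trees *)

Section Graphs.
Context {V : finType}.
Implicit Types (T D E S : {set {set V}}) (e f : {set V}) (u v a b x y : V).

Lemma adj_sym T u v : adj T u v = adj T v u.
Proof. by rewrite /adj finset.setUC. Qed.

Lemma adj_connect_sym T : connect_sym (adj T).
Proof. by apply: sym_connect_sym => u v; rewrite adj_sym. Qed.

Lemma connect_adj_sub T D : (forall u v, [set u; v] \in T -> connect (adj D) u v) ->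
  forall u v, connect (adj T) u v -> connect (adj D) u v.
Proof. by move=> h; apply: connect_sub => u v; exact: h. Qed.

Lemma connect_adjS T D u v : T \subset D -> connect (adj T) u v -> connect (adj D) u v.
Proof.
move=> /fintype.subsetP TD; apply: connect_adj_sub => x y xy; apply: connect1.
exact: TD.
Qed.

Lemma set2_inj x y a b : [set x; y] = [set a; b] ->
  (x = a /\ y = b) \/ (x = b /\ y = a).
Proof.
move=> E.
have : x \in [set a; b] by rewrite -E !finset.inE eqxx.
have : y \in [set a; b] by rewrite -E !finset.inE eqxx orbT.
have : a \in [set x; y] by rewrite E !finset.inE eqxx.
have : b \in [set x; y] by rewrite E !finset.inE eqxx orbT.
rewrite !finset.inE => /orP[]/eqP E1 /orP[]/eqP E2 /orP[]/eqP E3 /orP[]/eqP E4;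
  by [left; split; congruence | right; split; congruence].
Qed.

Lemma connect_adjU1 T a b x y : connect (adj ([set a; b] |: T)) x y ->
  [\/ connect (adj T) x y,
      connect (adj T) x a /\ connect (adj T) b y |
      connect (adj T) x b /\ connect (adj T) a y].
Proof.
move=> /connectP[p]; elim: p x => [|z p ih] x /=.
  by move=> _ ->; apply: Or31; exact: connect0.
move=> /andP[+ zp] yE; move: (ih _ zp yE) => {ih zp yE} ih.
rewrite {1}/adj !finset.inE => /orP[/eqP xz|xz]; last first.
  have cxz : connect (adj T) x z by exact: connect1.
  case: ih => [h|[h1 h2]|[h1 h2]].
  - by apply: Or31; apply: connect_trans h.
  - by apply: Or32; split => //; apply: connect_trans h1.
  - by apply: Or33; split => //; apply: connect_trans h1.
move: ih; have [[-> ->]|[-> ->]] := set2_inj xz.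
- case => [h|[h1 h2]|[h1 h2]].
  + by apply: Or32; split.
  + by apply: Or32; split.
  + by apply: Or31.
- case => [h|[h1 h2]|[h1 h2]].
  + by apply: Or33; split.
  + by apply: Or31.
  + by apply: Or33; split.
Qed.

Lemma connect_adjU1l T a b : connect (adj ([set a; b] |: T)) a b.
Proof. by apply: connect1; rewrite /adj !finset.inE eqxx. Qed.

Lemma connectedbP T : reflect (forall u v, connect (adj T) u v) (connectedb T).
Proof. by apply: (iffP 'forall_forallP). Qed.

Lemma acyclicbP T : reflect (forall u v, [set u; v] \in T -> u != v ->
  ~~ connect (adj (T :\ [set u; v])) u v) (acyclicb T).
Proof.
apply: (iffP 'forall_forallP) => h u v.
  by move=> uv nuv; move: (h u v); rewrite uv nuv.
by apply/implyP => /andP[uv nuv]; exact: h.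
Qed.

Lemma spanning_treeP E T : reflect
  [/\ T \subset E, forall e, e \in T -> #|e| = 2,
      forall u v, connect (adj T) u v &
      forall u v, [set u; v] \in T -> u != v ->
        ~~ connect (adj (T :\ [set u; v])) u v] (spanning_tree E T).
Proof.
apply: (iffP and4P) => -[h1 h2 h3 h4]; split => //.
- by move=> e eT; move/forall_inP: h2 => /(_ e eT) /eqP.
- exact/connectedbP.
- exact/acyclicbP.
- by apply/forall_inP => e /h2 ->.
- exact/connectedbP.
- exact/acyclicbP.
Qed.

Lemma card2_neq u v : #|[set u; v]| = 2 -> u != v.
Proof. by rewrite cards2; case: (u != v). Qed.

(* Closing a path of [T] into a cycle: some edge of the path avoids any [D] that
   does not already join its ends.  It is found in a minimal superset of [D] joining them. *)
Lemma tree_path_edge T D a b :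
  (forall e, e \in T -> #|e| = 2) ->
  D \subset T -> connect (adj T) a b -> ~~ connect (adj D) a b ->
  exists u v, [/\ [set u; v] \in T, [set u; v] \notin D, u != v,
    connect (adj (T :\ [set u; v])) a u & connect (adj (T :\ [set u; v])) v b].
Proof.
move=> T2 DT Tab nDab.
pose Pr := [pred A : {set {set V}} | (D \subset A) && connect (adj A) a b].
have PrT : Pr T by rewrite /= DT Tab.
have [A /minsetP[/andP[DA Aab] Amin] AT] := minset_exists PrT.
have [f fA fD] : exists2 f, f \in A & f \notin D.
  apply/subsetPn; apply: contraNN nDab => AD.
  by have -> : D = A by apply/eqP; rewrite finset.eqEsubset DA.
have fT : f \in T by exact: (fintype.subsetP AT).
have /cards2P[u [v [nuv fE]]] : #|f| == 2 by rewrite T2.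
subst f.
have sub : A :\ [set u; v] \subset T :\ [set u; v] by exact: finset.setSD.
have nAab : ~~ connect (adj (A :\ [set u; v])) a b.
  apply/negP => h.
  have : A :\ [set u; v] = A.
    apply: Amin; last exact: finset.subD1set.
    rewrite /= h andbT; apply/fintype.subsetP => g gD.
    rewrite !finset.inE (fintype.subsetP DA) // andbT.
    by apply: contraNneq fD => <-.
  by move=> /setP/(_ [set u; v]); rewrite !finset.inE fA eqxx.
move: Aab; rewrite -(finset.setD1K fA) => /connect_adjU1.
rewrite (negbTE nAab); case=> [//|[h1 h2]|[h1 h2]].
- exists u, v; split => //; exact: connect_adjS sub _.
- exists v, u; rewrite (finset.setUC [set v]) eq_sym; split => //; exact: connect_adjS sub _.
Qed.

(** Rejoining [u] and [v] is all there is to check: connectivity follows at once, and acyclicity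
    because the number of edges is unchanged. Instead of counting, a cycle through a kept edge [ce]
    is refuted by comparing the components left after deleting [uv] and [ce]. *)
Lemma spanning_tree_swap E T u v a b :
  spanning_tree E T -> [set u; v] \in T -> [set a; b] \in E -> a != b ->
  connect (adj ([set a; b] |: (T :\ [set u; v]))) u v ->
  spanning_tree E ([set a; b] |: (T :\ [set u; v])).
Proof.
move=> /spanning_treeP[TE T2 Tc Ta] uvT abE nab uv'.
have nuv : u != v by apply: card2_neq; apply: T2.
have nuvT := Ta _ _ uvT nuv.
apply/spanning_treeP; split.
- apply/fintype.subsetP => e; rewrite !finset.inE => /orP[/eqP->//|/andP[_]].
  exact: (fintype.subsetP TE).
- move=> e; rewrite !finset.inE => /orP[/eqP->|/andP[_ /T2 //]].
  by rewrite cards2 nab.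
- move=> x y; apply: connect_adj_sub (Tc x y) => z w zwT.
  have [zw|nzw] := eqVneq [set z; w] [set u; v]; last first.
    by apply: connect1; rewrite /adj !finset.inE nzw zwT orbT.
  have : z \in [set u; v] by rewrite -zw !finset.inE eqxx.
  have : w \in [set u; v] by rewrite -zw !finset.inE eqxx orbT.
  rewrite !finset.inE => /orP[]/eqP-> /orP[]/eqP->; rewrite ?connect0 //.
  by rewrite adj_connect_sym.
move=> c e ceT' nce.
(* [T] without [uv] separates [u] from [v], so the new edge bridges the two sides, in one of two
   orientations. *)
have uvab : connect (adj (T :\ [set u; v])) u a /\ connect (adj (T :\ [set u; v])) b v
  \/ connect (adj (T :\ [set u; v])) u b /\ connect (adj (T :\ [set u; v])) a v.
  case/connect_adjU1: uv' => [h|h|h]; [|by left|by right].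
  by rewrite h in nuvT.
have [ceab|nceab] := eqVneq [set c; e] [set a; b].
  have sub : ([set a; b] |: (T :\ [set u; v])) :\ [set a; b] \subset T :\ [set u; v].
    by apply/fintype.subsetP => g; rewrite !finset.inE => /andP[/negbTE->].
  rewrite ceab; apply/negP => /(connect_adjS sub) h.
  have hab : connect (adj (T :\ [set u; v])) a b.
    have : c \in [set a; b] by rewrite -ceab !finset.inE eqxx.
    have : e \in [set a; b] by rewrite -ceab !finset.inE eqxx orbT.
    rewrite !finset.inE => /orP[]/eqP ? /orP[]/eqP ?; subst; move: nce h => //.
    - by rewrite eqxx.
    - by rewrite adj_connect_sym.
    - by rewrite eqxx.
  move/negP: nuvT; apply; case: uvab => -[h1 h2].
  - by apply: (connect_trans h1); apply: connect_trans h2.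
  - by apply: (connect_trans h1); apply: connect_trans h2; rewrite adj_connect_sym.
move: ceT'; rewrite !finset.inE (negbTE nceab) /= => /andP[nceuv ceT].
have nceT := Ta _ _ ceT nce.
pose B := T :\ [set u; v] :\ [set c; e].
have BT : B \subset T :\ [set c; e].
  by apply/fintype.subsetP => g; rewrite !finset.inE => /and3P[-> _ ->].
have BT' : B \subset T :\ [set u; v] by exact: finset.subD1set.
have T'B : ([set a; b] |: (T :\ [set u; v])) :\ [set c; e] \subset [set a; b] |: B.
  apply/fintype.subsetP => g; rewrite !finset.inE.
  by case: (g == [set a; b]); case: (g == [set c; e]).
have uvT' : connect (adj (T :\ [set c; e])) u v.
  by apply: connect1; rewrite /adj !finset.inE uvT eq_sym nceuv.
apply/negP => /(connect_adjS T'B) /connect_adjU1.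
have nBce : ~~ connect (adj B) c e by apply: contraNN nceT; exact: connect_adjS.
rewrite (negbTE nBce) => ceB.
(* [T] minus [uv] minus [ce] has three components; one edge [ab] cannot join them all *)
have BS := adj_connect_sym B.
have : connect (adj ([set a; b] |: B)) u v.
  have T'B' : [set a; b] |: (T :\ [set u; v]) \subset
      [set c; e] |: ([set a; b] |: B).
    apply/fintype.subsetP => g; rewrite !finset.inE.
    by case: (g == [set a; b]); case: (g == [set c; e]).
  have /connect_adjU1 := connect_adjS T'B' uv'.
  have h : connect (adj ([set a; b] |: B)) c e.
    have sub : B \subset [set a; b] |: B by exact: finset.subsetUr.
    have ab := connect_adjU1l B a b.
    case: ceB => [//|[h1 h2]|[h1 h2]].
    - apply: (connect_trans (connect_adjS sub h1)).
      exact: connect_trans (connect_adjS sub h2).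
    - apply: (connect_trans (connect_adjS sub h1)).
      apply: connect_trans (connect_adjS sub h2); by rewrite adj_connect_sym.
  case=> [//|[h1 h2]|[h1 h2]].
  - by apply: (connect_trans h1); apply: connect_trans h2.
  - by apply: (connect_trans h1); apply: connect_trans h2; rewrite adj_connect_sym.
move/connect_adjU1.
have nBuv : ~~ connect (adj B) u v by apply: contraNN nuvT; exact: connect_adjS.
rewrite (negbTE nBuv) => uvB.
move/negP: nceT; apply.
have S := adj_connect_sym (T :\ [set c; e]).
have W x y : connect (adj B) x y -> connect (adj (T :\ [set c; e])) x y.
  exact: connect_adjS.
have vu : connect (adj (T :\ [set c; e])) v u by rewrite S.
case: uvB => [//|[/W h1 /W h2]|[/W h1 /W h2]]; case: ceB => [//|[/W k1 /W k2]|[/W k1 /W k2]].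
- apply: (connect_trans k1); apply: connect_trans k2; rewrite S in h1.
  by apply: (connect_trans h1); apply: (connect_trans uvT'); rewrite S.
- apply: (connect_trans k1); apply: connect_trans k2.
  by apply: (connect_trans h2); apply: (connect_trans vu).
- apply: (connect_trans k1); apply: connect_trans k2.
  by apply: (connect_trans h2); apply: (connect_trans vu).
- apply: (connect_trans k1); apply: connect_trans k2; rewrite S in h1.
  by apply: (connect_trans h1); apply: (connect_trans uvT'); rewrite S.
Qed.

Lemma spanning_tree_exists E :
  (forall e, e \in E -> #|e| = 2) -> (forall u v, connect (adj E) u v) ->
  exists T, spanning_tree E T.
Proof.
move=> E2 Ec.
have PE : connectedb E by exact/connectedbP.
have [T /minsetP[/connectedbP Tc Tmin] TE] := minset_exists PE.
exists T; apply/spanning_treeP; split => //.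
  by move=> e /(fintype.subsetP TE)/E2.
move=> u v uvT nuv; apply/negP => h.
have : T :\ [set u; v] = T.
  apply: Tmin; last exact: finset.subD1set.
  apply/connectedbP => x y; apply: connect_adj_sub (Tc x y) => z w zwT.
  have [zw|nzw] := eqVneq [set z; w] [set u; v]; last first.
    by apply: connect1; rewrite /adj !finset.inE nzw zwT.
  have : z \in [set u; v] by rewrite -zw !finset.inE eqxx.
  have : w \in [set u; v] by rewrite -zw !finset.inE eqxx orbT.
  rewrite !finset.inE => /orP[]/eqP-> /orP[]/eqP->; rewrite ?connect0 //.
  by rewrite adj_connect_sym.
by move=> /setP/(_ [set u; v]); rewrite !finset.inE uvT eqxx.
Qed.

End Graphs.

(** * The cycle characterization of minimal spanning trees *)

Section MinimalSpanningTrees.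
Context {R : realType} {V : finType}.
Implicit Types (T D E S : {set {set V}}) (e f : {set V}) (u v a b : V) (l : {set V} -> R).

Lemma len_swap l T e f : f \in T -> e \notin T ->
  len l (e |: (T :\ f)) = len l T - l f + l e.
Proof.
move=> fT eT; rewrite /len big_setU1 /=; last first.
  by rewrite !finset.inE (negbTE eT) andbF.
by rewrite (big_setD1 f fT) /=; ring.
Qed.

Lemma spanning_tree_inj E T D : spanning_tree E T -> spanning_tree E D ->
  D \subset T -> D = T.
Proof.
move=> /spanning_treeP[_ T2 _ Ta] /spanning_treeP[_ _ Dc _] DT.
apply/eqP; rewrite finset.eqEsubset DT; apply/fintype.subsetP => f fT.
apply/negPn/negP => fD.
have /cards2P[u [v [nuv fE]]] : #|f| == 2 by rewrite T2.
subst f; move: (Ta _ _ fT nuv); rewrite (connect_adjS _ (Dc u v)) //.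
apply/fintype.subsetP => g gD; rewrite !finset.inE (fintype.subsetP DT) // andbT.
by apply: contraNneq fD => <-.
Qed.

(** Otherwise the tree path from [a] to [b] contains an edge longer than [ab], and swapping it for
    [ab] would shorten the tree. *)
Lemma mst_cycle E l T a b : is_mst E l T -> [set a; b] \in E -> a != b ->
  connect (adj [set f in T | l f <= l [set a; b]]) a b.
Proof.
move=> /andP[ST /forallP Tmin] abE nab; apply/negPn/negP.
set D := (X in adj X) => nD.
have [TE T2 Tc Ta] := spanning_treeP _ _ ST.
have DT : D \subset T by apply/fintype.subsetP => g; rewrite !finset.inE => /andP[].
have abT : [set a; b] \notin T.
  apply: contraNN nD => abT; apply: connect1; by rewrite /adj !finset.inE abT lexx.
have [u [v [uvT uvD nuv au vb]]] := tree_path_edge T2 DT (Tc a b) nD.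
have ST' : spanning_tree E ([set a; b] |: (T :\ [set u; v])).
  apply: spanning_tree_swap => //.
  have sub := finset.subsetUr [set [set a; b]] (T :\ [set u; v]).
  have ua : connect (adj ([set a; b] |: (T :\ [set u; v]))) u a.
    by rewrite adj_connect_sym; exact: connect_adjS au.
  have bv : connect (adj ([set a; b] |: (T :\ [set u; v]))) b v.
    by rewrite adj_connect_sym; exact: connect_adjS vb.
  apply: (connect_trans ua); apply: connect_trans bv; exact: connect_adjU1l.
move: (Tmin ([set a; b] |: (T :\ [set u; v]))); rewrite ST' /= len_swap //.
move: uvD; rewrite !finset.inE uvT /= -ltNge => h1 h2; lra.
Qed.

(** The converse of [mst_cycle], by which minimality is recognized for modified lengths. An edge of
    [T'] outside [T] is exchanged for an edge of [T] that reconnects the two halves and is no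
    longer; the induction is on the number of edges outside [T]. *)
Lemma cycle_min E l T : spanning_tree E T ->
  (forall a b, [set a; b] \in E -> a != b ->
     connect (adj [set f in T | l f <= l [set a; b]]) a b) ->
  forall T', spanning_tree E T' -> len l T <= len l T'.
Proof.
move=> ST cyc T'; have [k] := ubnP #|T' :\: T|; elim: k T' => // k ih T' kT' ST'.
have [sub|/subsetPn[e eT' eT]] := boolP (T' \subset T).
  by rewrite (spanning_tree_inj ST ST' sub).
have [TE T2 Tc Ta] := spanning_treeP _ _ ST.
have [TE' T2' Tc' Ta'] := spanning_treeP _ _ ST'.
have /cards2P[a [b [nab eE]]] : #|e| == 2 by rewrite T2'.
subst e; have nabT' := Ta' _ _ eT' nab.
have [u [v [uvT luv nuv]]] : exists u v, [/\ [set u; v] \in T,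
    l [set u; v] <= l [set a; b] & ~~ connect (adj (T' :\ [set a; b])) u v].
  apply: contrapT => h.
  move/negP: nabT'; apply.
  apply: connect_adj_sub (cyc _ _ (fintype.subsetP TE' _ eT') nab) => u v.
  rewrite !finset.inE => /andP[uvT luv]; apply/negPn/negP => nuv.
  by apply: h; exists u, v; split.
have nuv' : u != v by apply: card2_neq; exact: T2.
have uvT' : [set u; v] \notin T'.
  apply: contraNN nuv => uvT'; apply: connect1; rewrite /adj !finset.inE uvT' andbT.
  by apply: contraNneq eT => <-.
have uvab : connect (adj ([set u; v] |: (T' :\ [set a; b]))) a b.
  have sub := finset.subsetUr [set [set u; v]] (T' :\ [set a; b]).
  have := Tc' u v; rewrite -{1}(finset.setD1K eT') => /connect_adjU1.
  have uv := connect_adjU1l (T' :\ [set a; b]) u v.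
  rewrite (negbTE nuv); case=> [//|[/(connect_adjS sub) h1 /(connect_adjS sub) h2]
    |[/(connect_adjS sub) h1 /(connect_adjS sub) h2]].
  - rewrite adj_connect_sym in h1; apply: (connect_trans h1).
    by apply: (connect_trans uv); rewrite adj_connect_sym.
  - apply: (connect_trans h2); rewrite adj_connect_sym in uv.
    exact: (connect_trans uv).
have ST'' := spanning_tree_swap ST' eT' (fintype.subsetP TE _ uvT) nuv' uvab.
apply: (le_trans (ih _ _ ST'')); last by rewrite len_swap //; lra.
have sub : ([set u; v] |: T' :\ [set a; b]) :\: T \proper T' :\: T.
  apply/properP; split.
    apply/fintype.subsetP => g; rewrite !finset.inE => /andP[gT].
    by case/orP => [/eqP gE|/andP[_ ->]]; [rewrite gE uvT in gT | rewrite gT].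
  exists [set a; b]; rewrite !finset.inE ?eT' ?eT // eqxx /= orbF.
  by apply: contraNneq uvT' => <-.
by apply: leq_trans (proper_card sub) _; rewrite -ltnS.
Qed.

Lemma mst_spanning E l T' : spanning_tree E T' -> is_mst E l (mst E l).
Proof.
move=> ST'; rewrite /mst; case: pickP => //= h.
have [T ST Tmin] := @arg_minP _ _ _ T' (spanning_tree E) (len l) ST'.
by have := h T; rewrite /is_mst ST /=; move/negP; case; apply/forallP => S; apply/implyP; exact: Tmin.
Qed.

(* Lowering by [x] the lengths of the edges of [T' :\: T] in [G] keeps [T] minimal. *)
Lemma mst_gap E l T T' (G : {set {set V}}) (x : R) : 0 <= x ->
  is_mst E l T -> spanning_tree E T' ->
  (forall a b, [set a; b] \in G -> [set a; b] \notin T ->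
     connect (adj [set f in E | l f <= l [set a; b] - x]) a b) ->
  x * #|(T' :\: T) :&: G|%:R <= len l T' - len l T.
Proof.
move=> x0 mT ST' hG.
have ST : spanning_tree E T by case/andP: mT.
pose A := (T' :\: T) :&: G.
pose l' e := l e - (if e \in A then x else 0).
have AT e : e \in T -> e \in A = false.
  by move=> eT; rewrite !finset.inE eT.
have l'T e : e \in T -> l' e = l e by move=> eT; rewrite /l' AT // subr0.
have : len l' T <= len l' T'.
  apply: (cycle_min ST) => // a b abE nab.
  rewrite [l' [set a; b]]/l'; case: ifP => abA; last first.
    rewrite subr0; apply: connect_adjS (mst_cycle mT abE nab).
    apply/fintype.subsetP => g; rewrite !finset.inE => /andP[gT h].
    by rewrite gT /= l'T.
  have [abG abT] : [set a; b] \in G /\ [set a; b] \notin T.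
    by move: abA; rewrite !finset.inE => /andP[/andP[]].
  (* Every edge of the path given by [hG] is replaced by a tree path of edges that are no longer;
     tree edges keep their length under [l']. *)
  apply: connect_adj_sub (hG _ _ abG abT) => u v.
  rewrite !finset.inE => /andP[uvE luv].
  have [->|nuv] := eqVneq u v; first exact: connect0.
  apply: connect_adjS (mst_cycle mT uvE nuv).
  apply/fintype.subsetP => g; rewrite !finset.inE => /andP[gT h].
  by rewrite gT /= l'T // (le_trans h).
have -> : len l' T = len l T by apply: eq_bigr => e /l'T.
have -> : len l' T' = len l T' - x * #|A|%:R.
  rewrite /len /l' sumrB; congr (_ - _).
  rewrite -big_mkcondr /= mulr_natr -sumr_const; apply: eq_bigl => e.
  by rewrite !finset.inE; case: (e \in T'); rewrite ?andbF.
by rewrite -/A => h; lra.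
Qed.

End MinimalSpanningTrees.

(** * Many exchanges in one tree *)

Section Swaps.
Context {R : realType} {V : finType}.
Implicit Types (T D E S : {set {set V}}) (e f : {set V}) (u v w : V) (l : {set V} -> R).

Lemma connect_adj_step T u v : connect (adj T) u v -> u != v ->
  exists w, [set u; w] \in T.
Proof.
move=> /connectP[[|w p]] /=; first by move=> _ ->; rewrite eqxx.
by move=> /andP[uw _] _ _; exists w.
Qed.

(** The edges of [S] enter one at a time. By disjointness no edge inserted earlier touches the ends
    of the new one, so the earlier ones alone cannot join these ends, and the cycle that is closed
    contains another edge to drop. *)
Lemma spanning_tree_insert E T S : (forall e, e \in E -> #|e| = 2) ->
  spanning_tree E T -> S \subset E ->
  {in S, forall e, e \notin T} ->
  {in S &, forall e f, e != f -> [disjoint e & f]} ->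
  exists T', [/\ spanning_tree E T', S \subset T' :\: T & T' \subset T :|: S].
Proof.
move=> E2 ST SE ST0 Sd.
suff [T' [ST' ST1 ST2]] : exists T', [/\ spanning_tree E T', S \subset T' & T' \subset T :|: S].
  exists T'; split => //; apply/fintype.subsetP => e eS.
  by rewrite !finset.inE ST0 // (fintype.subsetP ST1).
have [k] := ubnP #|S|; elim: k S SE ST0 Sd => // k ih S SE ST0 Sd kS.
have [->|[e eS]] := set_0Vmem S.
  by exists T; rewrite finset.sub0set finset.setU0.
pose S1 := S :\ e.
have sub1 : S1 \subset S by exact: finset.subD1set.
have /(_ _ _ _ _)[|||//|T1 [ST1 S1T1 T1S1]] := ih S1.
- exact: fintype.subset_trans sub1 SE.
- by move=> f /(fintype.subsetP sub1); exact: ST0.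
- by move=> f g /(fintype.subsetP sub1) fS /(fintype.subsetP sub1); exact: Sd.
- by rewrite -ltnS; apply: leq_trans kS; rewrite ltnS /S1 (cardsD1 e S) eS.
have [TE2 T2 Tc Ta] := spanning_treeP _ _ ST1.
have eT1 : e \notin T1.
  apply/negP => /(fintype.subsetP T1S1); rewrite finset.in_setU (negbTE (ST0 _ eS)).
  by rewrite !finset.inE eqxx.
have eE := fintype.subsetP SE _ eS.
have /cards2P[a [b [nab eE']]] : #|e| == 2 by rewrite E2.
subst e; pose D := T1 :&: S1.
have nD : ~~ connect (adj D) a b.
  apply/negP => /connect_adj_step/(_ nab)[w].
  rewrite !finset.inE => /and3P[_ naw awS].
  have /pred0P/(_ a) := Sd _ _ awS eS naw.
  by rewrite /= !finset.inE !eqxx.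
have [u [v [uvT uvD nuv au vb]]] := tree_path_edge T2 (finset.subsetIl _ _) (Tc a b) nD.
exists ([set a; b] |: (T1 :\ [set u; v])); split.
- apply: spanning_tree_swap => //.
  have sub := finset.subsetUr [set [set a; b]] (T1 :\ [set u; v]).
  have ua : connect (adj ([set a; b] |: (T1 :\ [set u; v]))) u a.
    by rewrite adj_connect_sym; exact: connect_adjS au.
  have bv : connect (adj ([set a; b] |: (T1 :\ [set u; v]))) b v.
    by rewrite adj_connect_sym; exact: connect_adjS vb.
  apply: (connect_trans ua); apply: connect_trans bv; exact: connect_adjU1l.
- apply/fintype.subsetP => f fS; rewrite !finset.inE.
  have [//|nf /=] := eqVneq f [set a; b].
  have fS1 : f \in S1 by rewrite !finset.inE nf.
  rewrite (fintype.subsetP S1T1) // andbT.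
  by apply: contraNneq uvD => <-; rewrite finset.inE fS1 (fintype.subsetP S1T1).
- apply/fintype.subsetP => f; rewrite !finset.inE => /orP[/eqP->|/andP[_ /(fintype.subsetP T1S1)]].
    by rewrite eS orbT.
  by rewrite !finset.inE => /orP[->//|/andP[_ ->]]; rewrite orbT.
Qed.

(* Each vertex [c] of [C] hangs on its two light edges to [a c] and [b c], which are
   joined below level [q1]; the tree uses exactly one of the two, and they can be exchanged. *)
Lemma mst_swap_near_ties E l T (C : {set V}) (a b : V -> V) (q1 q2 x : R) :
  is_mst E l T ->
  {in C, forall c, [/\ [set c; a c] \in E, [set c; b c] \in E, c != a c & c != b c]} ->
  {in C, forall c, [/\ a c != b c, a c \notin C & b c \notin C]} ->
  {in C, forall c, q1 <= l [set c; a c] < q2 /\ q1 <= l [set c; b c] < q2} ->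
  {in C, forall c, `|l [set c; a c] - l [set c; b c]| <= x} ->
  {in C, forall c, connect (adj [set f in E | l f < q1]) (a c) (b c)} ->
  {in C, forall c w, [set c; w] \in E -> w != a c -> w != b c -> q2 <= l [set c; w]} ->
  exists T', [/\ spanning_tree E T', (#|C| <= #|T' :\: T|)%N &
    len l T' <= len l T + #|C|%:R * x].
Proof.
move=> mT hE hC hq hx hab hw.
have ST : spanning_tree E T by case/andP: mT.
have [TE T2 Tc Ta] := spanning_treeP _ _ ST.
(* The part of the tree below [q1] survives all exchanges, since the edges removed have length at
   least [q1]; it keeps [a c] and [b c] joined throughout. *)
pose T1 := [set f in T | l f < q1].
have hT1 c : c \in C -> connect (adj T1) (a c) (b c).
  move=> cC; apply: connect_adj_sub (hab c cC) => u v.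
  rewrite !finset.inE => /andP[uvE luv].
  have [->|nuv] := eqVneq u v; first exact: connect0.
  apply: connect_adjS (mst_cycle mT uvE nuv).
  apply/fintype.subsetP => g; rewrite !finset.inE => /andP[-> h] /=.
  exact: le_lt_trans luv.
(* The tree path from [c] to [a c] starts with an edge shorter than [q2], which can only lead to
   [a c] or [b c]. *)
have hor c : c \in C -> ([set c; a c] \in T) || ([set c; b c] \in T).
  move=> cC; have [caE cbE nca ncb] := hE _ cC.
  have [w] := connect_adj_step (mst_cycle mT caE nca) nca.
  rewrite finset.inE => /andP[cwT lcw].
  have [wa|nwa] := eqVneq w (a c); first by rewrite -wa cwT.
  have [wb|nwb] := eqVneq w (b c); first by rewrite -wb cwT orbT.
  have := hw c cC w (fintype.subsetP TE _ cwT) nwa nwb.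
  have [/andP[_ h] _] := hq _ cC; by move=> h'; lra.
(* [p c] is the end of an edge that the tree uses at [c], and [r c] the end of the edge replacing
   it. *)
pose p c := if [set c; a c] \in T then a c else b c.
pose r c := if [set c; a c] \in T then b c else a c.
have nT c : c \in C -> [set c; r c] \notin T.
  move=> cC; rewrite /r; case: ifP => [caT|->//].
  have [caE cbE nca ncb] := hE _ cC.
  have [nab _ _] := hC _ cC.
  apply/negP => cbT; have /negP := Ta _ _ caT nca; apply.
  apply: (@connect_trans _ _ (b c)).
    apply: connect1; rewrite /adj !finset.inE cbT andbT.
    apply: contra_neq nab => /set2_inj[[_ ->]//|[ca _]].
    by rewrite -ca eqxx in nca.
  rewrite adj_connect_sym; apply: connect_adjS (hT1 _ cC).
  apply/fintype.subsetP => g; rewrite !finset.inE => /andP[-> lg]; rewrite andbT.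
  apply: contraTneq lg => ->; have [/andP[h _] _] := hq _ cC; by rewrite -leNgt.
have pT c : c \in C -> [set c; p c] \in T.
  by move=> /hor; rewrite /p; case: ifP.
have pC c : c \in C -> p c \notin C.
  by move=> /hC[_ ? ?]; rewrite /p; case: ifP.
have rC c : c \in C -> r c \notin C.
  by move=> /hC[_ ? ?]; rewrite /r; case: ifP.
have lp c : c \in C -> q1 <= l [set c; p c].
  by move=> /hq[/andP[? _] /andP[? _]]; rewrite /p; case: ifP.
have rE c : c \in C -> [set c; r c] \in E /\ c != r c.
  by move=> /hE[? ? ? ?]; rewrite /r; case: ifP.
have lrp c : c \in C -> l [set c; r c] - l [set c; p c] <= x.
  move=> /hx; rewrite ler_norml => /andP[? ?]; rewrite /r /p; case: ifP => _; lra.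
have rp c : c \in C -> connect (adj T1) (r c) (p c).
  move=> /hT1; rewrite /r /p; case: ifP => _ //; by rewrite adj_connect_sym.
(* An exchanged edge has only one end in [C], so it determines its vertex: different exchanges do
   not interfere. *)
have injC (s t : V -> V) c c' : (forall c, c \in C -> t c \notin C) -> c \in C -> c' \in C ->
    [set c; s c] = [set c'; t c'] -> c = c'.
  move=> tC cC c'C /set2_inj[[]//|[cE _]].
  by have := tC _ c'C; rewrite -cE cC.
(* Invariant after exchanging at [C0]: low edges are kept, each [c] outside [C0] still uses [p c],
   and the only new edges are those to [r c] with [c] in [C0]. *)
suff H (C0 : {set V}) : C0 \subset C -> exists T', [/\ spanning_tree E T', T1 \subset T',
    {in C :\: C0, forall c, [set c; p c] \in T'},
    [set [set c; r c] | c in C0] \subset T' /\ T' \subset T :|: [set [set c; r c] | c in C0] &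
    len l T' <= len l T + #|C0|%:R * x].
  have [T' [ST' _ _ [CT' _] lT']] := H C (fintype.subxx _).
  exists T'; split => //.
  have <- : #|[set [set c; r c] | c in C]| = #|C|.
    by apply: card_in_imset => c c' cC c'C; exact: injC.
  apply: subset_leq_card; apply/fintype.subsetP => e eC.
  rewrite finset.inE (fintype.subsetP CT') // andbT.
  by case/imsetP: eC => c cC ->; exact: nT.
have [k] := ubnP #|C0|; elim: k C0 => // k ih C0 kC0 C0C.
have [->|[c cC0]] := set_0Vmem C0.
  exists T; split => //.
  - by apply/fintype.subsetP => g; rewrite !finset.inE => /andP[].
  - by move=> c; rewrite !finset.inE => cC; exact: pT.
  - by rewrite imset0 finset.sub0set finset.setU0.
  - by rewrite cards0 mul0r addr0.
have cC := fintype.subsetP C0C _ cC0.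
have sub1 : C0 :\ c \subset C0 by exact: finset.subD1set.
have [||T' [ST' T1T' pT' [rT' T'T] lT']] := ih (C0 :\ c).
- by rewrite -ltnS; apply: leq_trans kC0; rewrite ltnS (cardsD1 c C0) cC0.
- exact: fintype.subset_trans sub1 C0C.
have rcT' : [set c; r c] \notin T'.
  apply/negP => /(fintype.subsetP T'T); rewrite finset.in_setU (negbTE (nT _ cC)) /=.
  move=> /imsetP[c']; rewrite !finset.inE => /andP[nc c'C0] /injC.
  by move/(_ rC cC (fintype.subsetP C0C _ c'C0)) => cc'; rewrite cc' eqxx in nc.
have pcT' : [set c; p c] \in T' by apply: pT'; rewrite !finset.inE eqxx cC.
have [rcE ncr] := rE _ cC.
have sub : T1 \subset T' :\ [set c; p c].
  apply/fintype.subsetP => g gT1; rewrite !finset.inE (fintype.subsetP T1T') // andbT.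
  move: gT1; rewrite finset.inE => /andP[_]; apply: contraTneq => ->.
  by rewrite -leNgt lp.
exists ([set c; r c] |: (T' :\ [set c; p c])); split.
- apply: spanning_tree_swap => //.
  apply: (connect_trans (connect_adjU1l _ _ _)).
  apply: connect_adjS (rp _ cC).
  by apply: (fintype.subset_trans sub); exact: finset.subsetUr.
- by apply: (fintype.subset_trans sub); exact: finset.subsetUr.
- move=> c'; rewrite finset.inE => /andP[c'C0 c'C].
  rewrite !finset.inE pT' ?andbT; last first.
    by rewrite !finset.inE c'C andbT negb_and c'C0 orbT.
  apply/orP; right; apply: contraNneq c'C0 => /injC -> //.
- split; apply/fintype.subsetP => g.
    move=> /imsetP[c' c'C0 ->]; rewrite !finset.inE.
    have [->|nc] := eqVneq c' c; first by rewrite eqxx.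
    rewrite (fintype.subsetP rT') ?andbT; last first.
      by apply/imsetP; exists c' => //; rewrite !finset.inE nc.
    apply/orP; right; apply: contra_neq nc => /injC; apply => //.
    exact: fintype.subsetP c'C0.
  rewrite finset.in_setU1 => /orP[/eqP->|].
    by rewrite finset.in_setU; apply/orP; right; apply/imsetP; exists c.
  rewrite finset.in_setD1 => /andP[_ /(fintype.subsetP T'T)].
  rewrite !finset.in_setU => /orP[->//|gC]; apply/orP; right.
  exact: (fintype.subsetP (imsetS _ sub1)).
rewrite len_swap // (cardsD1 c C0) cC0 add1n -natr1 mulrDl mul1r.
by have := lrp _ cC; lra.
Qed.

End Swaps.

(** * Functions of independent finite labels *)

Section FiniteProducts.
Context {R : realType} {I A : finType}.
Implicit Types (p : I -> A -> R) (F G : {ffun I -> A} -> R) (v w : {ffun I -> A}).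

(** The expectation of [F] when the coordinates are independent with laws [p i]. *)
Definition Ew p F : R := \sum_(v : {ffun I -> A}) (\prod_i p i (v i)) * F v.

Definition upd v (i : I) (a : A) : {ffun I -> A} :=
  [ffun j => if j == i then a else v j].

(** The conditional expectation of [F] given all coordinates except [i]. *)
Definition avg p i F v : R := \sum_a p i a * F (upd v i a).

Lemma upd_id v i a b : upd (upd v i a) i b = upd v i b.
Proof. by apply/ffunP => j; rewrite !ffunE; case: eqP. Qed.

Lemma upd_same v i : upd v i (v i) = v.
Proof. by apply/ffunP => j; rewrite !ffunE; case: eqP => // ->. Qed.

Lemma updC v i j a b : i != j -> upd (upd v i a) j b = upd (upd v j b) i a.
Proof.
move=> ij; apply/ffunP => k; rewrite !ffunE.
by case: eqP => // ->; rewrite eq_sym (negbTE ij).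
Qed.

Lemma upd_at v i a : upd v i a i = a.
Proof. by rewrite ffunE eqxx. Qed.

Lemma upd_ne v i j a : j != i -> upd v i a j = v j.
Proof. by rewrite ffunE => /negbTE->. Qed.

Variable p : I -> A -> R.
Hypothesis p0 : forall i a, 0 <= p i a.
Hypothesis p1 : forall i, \sum_a p i a = 1.

Lemma eq_Ew F G : F =1 G -> Ew p F = Ew p G.
Proof. by move=> FG; apply: eq_bigr => v _; rewrite FG. Qed.

Lemma Ew_prod (h : I -> A -> R) :
  Ew p (fun v => \prod_i h i (v i)) = \prod_i \sum_a p i a * h i a.
Proof. by rewrite bigA_distr_bigA; apply: eq_bigr => v _; rewrite -big_split. Qed.

Lemma Ew_cst c : Ew p (fun=> c) = c.
Proof.
rewrite /Ew -mulr_suml -[RHS]mul1r; congr (_ * _).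
by rewrite -(bigA_distr_bigA p) big1.
Qed.

Lemma ler_Ew F G : (forall v, F v <= G v) -> Ew p F <= Ew p G.
Proof.
by move=> FG; apply: ler_sum => v _; apply: ler_wpM2l => //; exact: prodr_ge0.
Qed.

Lemma Ew_ge0 F : (forall v, 0 <= F v) -> 0 <= Ew p F.
Proof. by move=> F0; rewrite -[leLHS](Ew_cst 0); exact: ler_Ew. Qed.

Lemma Ew_sum (J : Type) (s : seq J) (P : pred J) (F : J -> {ffun I -> A} -> R) :
  Ew p (fun v => \sum_(j <- s | P j) F j v) = \sum_(j <- s | P j) Ew p (F j).
Proof.
by rewrite /Ew exchange_big /=; apply: eq_bigr => v _; rewrite mulr_sumr.
Qed.

Lemma EwD F G : Ew p (fun v => F v + G v) = Ew p F + Ew p G.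
Proof. by rewrite /Ew -big_split /=; apply: eq_bigr => v _; rewrite mulrDr. Qed.

Lemma EwZ c F : Ew p (fun v => c * F v) = c * Ew p F.
Proof. by rewrite /Ew mulr_sumr; apply: eq_bigr => v _; rewrite mulrCA. Qed.

Lemma Ew_avg i F : Ew p (avg p i F) = Ew p F.
Proof.
rewrite /Ew /avg.
pose W (v : {ffun I -> A}) : R := \prod_i p i (v i).
have Wu v a : W v * p i a = W (upd v i a) * p i (v i).
  rewrite /W (bigD1 i) //= [in RHS](bigD1 i) //= upd_at mulrAC [RHS]mulrAC.
  by congr (_ * _); [exact: mulrC|apply: eq_bigr => j ji; rewrite upd_ne].
transitivity (\sum_(va : {ffun I -> A} * A) W (upd va.1 i va.2) * p i (va.1 i) * F (upd va.1 i va.2)).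
  under eq_bigr do rewrite mulr_sumr.
  rewrite pair_big /=; apply: eq_bigr => -[v a] _ /=; rewrite mulrA -Wu //.
(* Exchanging the old and the fresh value of coordinate [i] is an involution that preserves the
   joint weight; afterwards [F] is evaluated at [v] and the fresh value sums out. *)
pose h (va : {ffun I -> A} * A) := (upd va.1 i va.2, va.1 i).
have hK : cancel h h.
  by move=> [v a]; rewrite /h /= upd_id upd_same upd_at.
rewrite (reindex_inj (can_inj hK)) /=.
under eq_bigr => va _ do rewrite upd_id upd_same upd_at.
rewrite -(pair_big xpredT xpredT (fun v a => W v * p i a * F v)) /=.
apply: eq_bigr => v _; rewrite -[RHS]mulr1 -[X in _ = _ * X](p1 i) mulr_sumr.
by apply: eq_bigr => a _; rewrite mulrAC.
Qed.

Lemma avg_upd i F v a : avg p i F (upd v i a) = avg p i F v.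
Proof. by apply: eq_bigr => b _; rewrite upd_id. Qed.

(** Pythagoras: [F] minus its conditional mean is orthogonal to that mean, and it is bounded by [c],
    being an average of differences in coordinate [i]. *)
Lemma Ew_sqr_avg i F c :
  (forall v a b, `|F (upd v i a) - F (upd v i b)| <= c) ->
  Ew p (fun v => F v ^+ 2) <= Ew p (fun v => avg p i F v ^+ 2) + c ^+ 2.
Proof.
move=> Fc; set G := avg p i F.
have FG v : `|F v - G v| <= c.
  have -> : F v - G v = \sum_a p i a * (F v - F (upd v i a)).
    under eq_bigr do rewrite mulrBr.
    by rewrite sumrB -mulr_suml p1 mul1r.
  apply: le_trans (ler_norm_sum _ _ _) _.
  rewrite -[leRHS]mul1r -(p1 i) mulr_suml; apply: ler_sum => a _.
  rewrite normrM ger0_norm //; apply: ler_wpM2l => //.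
  by rewrite -{1}(upd_same v i).
have EFG : Ew p (fun v => F v * G v) = Ew p (fun v => G v ^+ 2).
  rewrite -(Ew_avg i); apply: eq_Ew => v; rewrite expr2 {2}/G /avg mulr_suml.
  by apply: eq_bigr => a _; rewrite /G avg_upd mulrA.
have : Ew p (fun v => (F v - G v) ^+ 2) <= c ^+ 2.
  rewrite -[leRHS]Ew_cst; apply: ler_Ew => v; rewrite /=.
  by have := FG v; rewrite ler_norml => /andP[h1 h2]; nra.
have -> : Ew p (fun v => (F v - G v) ^+ 2) =
    Ew p (fun v => F v ^+ 2) + (-2) * Ew p (fun v => F v * G v) + Ew p (fun v => G v ^+ 2).
  by rewrite -EwZ -!EwD; apply: eq_Ew => v; ring.
rewrite EFG; lra.
Qed.

(** This lets [Ew_sqr_avg] be iterated: averaging over [j] keeps the bound in direction [i]. *)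
Lemma avg_bounded_diff i j F c :
  (forall v a b, `|F (upd v i a) - F (upd v i b)| <= c) ->
  forall v a b, `|avg p j F (upd v i a) - avg p j F (upd v i b)| <= c.
Proof.
move=> Fc v a b; have c0 : 0 <= c by apply: le_trans (Fc v a b).
have [->|ij] := eqVneq j i; first by rewrite !avg_upd subrr normr0.
rewrite /avg -sumrB; apply: le_trans (ler_norm_sum _ _ _) _.
rewrite -[leRHS]mul1r -(p1 j) mulr_suml; apply: ler_sum => d _.
rewrite -mulrBr normrM ger0_norm //; apply: ler_wpM2l => //.
by rewrite eq_sym in ij; rewrite !(updC _ _ _ ij).
Qed.

(* The Efron-Stein inequality in its bounded-differences form: averaging out one
   coordinate at a time loses at most [c i ^+ 2] of the second moment. *)
Lemma Ew_sqr_bounded_diff F (c : I -> R) :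
  (forall i v a b, `|F (upd v i a) - F (upd v i b)| <= c i) ->
  Ew p (fun v => F v ^+ 2) <= Ew p F ^+ 2 + \sum_i c i ^+ 2.
Proof.
move=> Fc; pose avgs := foldr (avg p) F.
have avgsc s : forall i v a b, `|avgs s (upd v i a) - avgs s (upd v i b)| <= c i.
  by elim: s => //= j s ih i; exact: avg_bounded_diff.
have H s : Ew p (fun v => F v ^+ 2) <=
    Ew p (fun v => avgs s v ^+ 2) + \sum_(i <- s) c i ^+ 2.
  elim: s => [|j s ih]; first by rewrite big_nil addr0.
  rewrite big_cons addrA; apply: le_trans ih _; rewrite lerD2r.
  by apply: Ew_sqr_avg => v a b; exact: avgsc.
have Es s : Ew p (avgs s) = Ew p F by elim: s => //= j s ih; rewrite Ew_avg.
(* Averaging over [s] removes the dependence on those coordinates; over the full list the result is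
   constant, hence equal to the mean. *)
have Cs s v w : (forall i, i \notin s -> v i = w i) -> avgs s v = avgs s w.
  elim: s v w => [|j s ih] v w vw /=.
    by congr F; apply/ffunP => i; exact: vw.
  apply: eq_bigr => a _; congr (_ * _); apply: ih => i nis; rewrite !ffunE.
  by case: eqP => // /eqP ij; apply: vw; rewrite inE negb_or ij.
have := H (enum I); rewrite big_enum.
have Cst v : avgs (enum I) v = Ew p F.
  rewrite -(Es (enum I)) -[LHS]Ew_cst; apply: eq_Ew => w; apply: Cs => i.
  by rewrite mem_enum.
by rewrite (eq_Ew (F := fun v => avgs (enum I) v ^+ 2) (G := fun=> Ew p F ^+ 2)) ?Ew_cst // => v; rewrite /= Cst.
Qed.

Lemma Ew_chebyshev F (c : I -> R) (t : R) :
  (forall i v a b, `|F (upd v i a) - F (upd v i b)| <= c i) -> 0 < t ->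
  Ew p (fun v => (F v <= Ew p F - t)%R%:R) <= (\sum_i c i ^+ 2) / t ^+ 2.
Proof.
move=> Fc t0; rewrite ler_pdivlMr ?exprn_gt0 // mulrC -EwZ.
set m := Ew p F.
have : Ew p (fun v => (F v - m) ^+ 2) <= \sum_i c i ^+ 2.
  have -> : Ew p (fun v => (F v - m) ^+ 2) =
    Ew p (fun v => F v ^+ 2) + (-2 * m) * Ew p F + Ew p (fun=> m ^+ 2).
    by rewrite -EwZ -!EwD; apply: eq_Ew => v; ring.
  rewrite Ew_cst -/m; have := Ew_sqr_bounded_diff Fc; rewrite -/m; nra.
apply: le_trans; apply: ler_Ew => v; case: (leP (F v)) => h; last by rewrite mulr0 sqr_ge0.
rewrite mulr1; nra.
Qed.

Lemma Ew_markov F (t : R) : (forall v, 0 <= F v) -> 0 < t ->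
  Ew p (fun v => (t <= F v)%R%:R) <= Ew p F / t.
Proof.
move=> F0 t0; rewrite ler_pdivlMr // mulrC -EwZ; apply: ler_Ew => v.
by case: (leP t) => h; rewrite ?mulr1 ?mulr0.
Qed.

Lemma Ew_negb (S : pred {ffun I -> A}) :
  Ew p (fun v => (~~ S v)%:R) = 1 - Ew p (fun v => (S v)%:R).
Proof.
apply/eqP; rewrite eq_sym subr_eq; apply/eqP; rewrite -EwD -[LHS](Ew_cst 1).
by apply: eq_Ew => v; case: (S v); rewrite ?add0r ?addr0.
Qed.

End FiniteProducts.

(** * Finite labels of independent random variables *)

Section FiniteLabels.
Context {d : measure_display} {Omega : measurableType d} {R : realType}.
Variable P : probability Omega R.

Lemma finite_range_event (B : finType) (Y : Omega -> B) (S : pred B) :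
  (forall b, measurable [set w | Y w = b]%classic) ->
  measurable [set w | S (Y w)]%classic /\
  P [set w | S (Y w)]%classic = (\sum_(b | S b) P [set w | Y w = b]%classic)%E.
Proof.
move=> mY.
have E : ([set w | S (Y w)] = \bigcup_(b in [set` S]) [set w | Y w = b])%classic.
  by apply/seteqP; split => w /= => [SY|[b /= Sb ->] //]; exists (Y w).
have fS : finite_set ([set` S])%classic by exact: finite_finset.
split; first by rewrite E; exact: fin_bigcup_measurable.
rewrite E measure_fin_bigcup //; last first.
  by move=> b c _ _ [w [/= <- <-]].
by rewrite -(@bigfs _ _ _ _ (index_enum B)) ?index_enum_uniq // => b _; rewrite mem_index_enum.
Qed.

Variables (I A : finType) (E : {set I}) (X : I -> Omega -> R) (lab : R -> A) (a0 : A).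
Hypothesis mX : forall i, i \in E -> measurable_fun setT (X i).
Hypothesis mlab : forall a, measurable [set t | lab t = a]%classic.
Hypothesis indep : mutually_independent P E X.

(** Indices outside [E] get the fixed label [a0], matched by a point mass in [label_law], so that
    the law of the whole family is a product over all of [I]. *)
Definition labels (w : Omega) : {ffun I -> A} :=
  [ffun i => if i \in E then lab (X i w) else a0].

Definition label_law (i : I) (a : A) : R :=
  if i \in E then fine (P [set w | lab (X i w) = a]%classic) else (a == a0)%:R.

Lemma measurable_label_eq i a : i \in E -> measurable [set w | lab (X i w) = a]%classic.
Proof.
move=> iE; have -> : ([set w | lab (X i w) = a] = setT `&` X i @^-1` [set t | lab t = a])%classic.
  by rewrite setTI.
exact: mX.
Qed.

Lemma label_law_ge0 i a : 0 <= label_law i a.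
Proof. by rewrite /label_law; case: ifP => // _; exact: fine_ge0. Qed.

Lemma label_lawE i a : i \in E ->
  (label_law i a)%:E = P [set w | lab (X i w) = a]%classic.
Proof.
by move=> iE; rewrite /label_law iE fineK // fin_num_measure //; exact: measurable_label_eq.
Qed.

Lemma sum_label_law i : \sum_a label_law i a = 1.
Proof.
have [iE|iE] := boolP (i \in E); last first.
  rewrite /label_law (negbTE iE) (bigD1 a0) //= eqxx big1 ?addr0 // => a /negbTE ->.
  by [].
apply: EFin_inj; rewrite -sumEFin.
under eq_bigr do rewrite label_lawE //.
have [_ <-] := @finite_range_event A (fun w => lab (X i w)) predT
  (fun a => measurable_label_eq a iE).
by rewrite -(@probability_setT _ _ _ P); congr (P _); apply/seteqP.
Qed.

Lemma labels_eq v : measurable [set w | labels w = v]%classic /\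
  P [set w | labels w = v]%classic = (\prod_i label_law i (v i))%:E.
Proof.
have [/forallP v0|/forallPn[j]] := boolP [forall i, (i \notin E) ==> (v i == a0)]; last first.
  rewrite negb_imply => /andP[jE vj].
  have -> : ([set w | labels w = v] = set0)%classic.
    apply/seteqP; split => // w /= lv; move: vj; rewrite -lv ffunE (negbTE jE).
    by rewrite eqxx.
  split => //; rewrite measure0; congr EFin; rewrite (bigD1 j) //= /label_law (negbTE jE).
  by rewrite (negbTE vj) mul0r.
pose B i : set R := [set t | lab t = v i]%classic.
have -> : ([set w | labels w = v] = \bigcap_(i in [set i | i \in E]) (X i @^-1` B i))%classic.
  apply/seteqP; split => w /=.
    by move=> lv i /= iE; rewrite /B /= -lv ffunE iE.
  move=> h; apply/ffunP => i; rewrite ffunE; case: ifPn => iE; first exact: h.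
  by have := v0 i; rewrite iE => /eqP.
have iB i : i \in E -> measurable (X i @^-1` B i)%classic by exact: measurable_label_eq.
split.
  apply: fin_bigcap_measurable => //; exact: finite_finset.
have -> := indep (fintype.subxx E) (fun i => mlab (v i)).
rewrite [in RHS](bigID (mem E)) /= [X in _ * X]big1 ?mulr1; last first.
  by move=> i iE; rewrite /label_law (negbTE iE); have := v0 i; rewrite iE /= => ->.
rewrite -prodEFin; apply: eq_bigr => i iE; by rewrite label_lawE.
Qed.

Lemma labels_event (S : pred {ffun I -> A}) :
  measurable [set w | S (labels w)]%classic /\
  P [set w | S (labels w)]%classic = (Ew label_law (fun v => (S v)%:R))%:E.
Proof.
have [mS ->] := @finite_range_event _ labels S (fun v => (labels_eq v).1).
split => //; rewrite /Ew -sumEFin [in RHS](bigID S) /= [X in (_ + X)%E]big1 ?adde0; last first.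
  by move=> v /negbTE ->; rewrite mulr0.
by apply: eq_bigr => v ->; rewrite mulr1 (labels_eq v).2.
Qed.

End FiniteLabels.

(** * Integrals of functions not known to be measurable *)

Section Integrals.
Context {d : measure_display} {Omega : measurableType d} {R : realType}.
Variable P : probability Omega R.
Implicit Types (f h : Omega -> \bar R).
Local Open Scope ereal_scope.

(* Unlike [ge0_le_integral], no measurability is needed. *)
Lemma ge0_integral_mono f h : (forall w, 0 <= f w) -> (forall w, f w <= h w) ->
  \int[P]_w f w <= \int[P]_w h w.
Proof.
move=> f0 fh; rewrite !ge0_integralTE //; last by move=> w; exact: le_trans (f0 w) (fh w).
by apply: le_ereal_sup => _ [g gf <-]; exists g => // w; exact: le_trans (gf w) (fh w).
Qed.

(** Only the upper function [h] is measurable. Adding [+oo] to it on the null set [N] leaves its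
    integral unchanged and makes the inequality hold everywhere. *)
Lemma ge0_integral_ae_mono f h (N : set Omega) : measurable N -> P N = 0 ->
  (forall w, 0 <= f w) -> (forall w, 0 <= h w) -> measurable_fun setT h ->
  (forall w, ~ N w -> f w <= h w) -> \int[P]_w f w <= \int[P]_w h w.
Proof.
move=> mN PN f0 h0 mh fh.
have -> : \int[P]_w h w = \int[P]_w (h w + +oo * (\1_N w)%:E).
  apply: ae_eq_integral => //.
    apply: emeasurable_funD => //; apply: emeasurable_funM => //.
    by apply/measurable_EFinP; exact: measurable_indic.
  exists N; split => // w /= nw; apply: contrapT => Nw; apply: nw => _.
  by rewrite indicE memNset // mule0 adde0.
apply: ge0_integral_mono => // w; have [Nw|Nw] := pselect (N w).
  by rewrite indicE mem_set // mule1 addey ?leey // gt_eqF // (lt_le_trans _ (h0 w)) // ltNy0.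
by rewrite indicE memNset // mule0 adde0; exact: fh.
Qed.

Lemma integral_ge_event f (B : set Omega) (y : R) : measurable B -> (0 <= y)%R ->
  (forall w, 0 <= f w) -> (forall w, B w -> y%:E <= f w) ->
  y%:E * P B <= \int[P]_w f w.
Proof.
move=> mB y0 f0 fB.
have -> : y%:E * P B = \int[P]_w (y%:E * (\1_B w)%:E).
  rewrite ge0_integralZl_EFin //; first by rewrite integral_indic // setIT.
  by apply/measurable_EFinP; exact: measurable_indic.
apply: ge0_integral_mono => w; first by rewrite mule_ge0 // lee_fin.
have [Bw|Bw] := pselect (B w); first by rewrite indicE mem_set // mule1; exact: fB.
by rewrite indicE memNset // mule0.
Qed.

Lemma finite_null_union (I : finType) (A : pred I) (N : I -> set Omega) :
  (forall i, A i -> measurable (N i)) -> (forall i, A i -> P (N i) = 0) ->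
  measurable (\bigcup_(i in [set` A]) N i)%classic /\
  P (\bigcup_(i in [set` A]) N i)%classic = 0.
Proof.
move=> mN PN.
have fA : finite_set [set` A]%classic by exact: finite_finset.
have mU : measurable (\bigcup_(i in [set` A]) N i)%classic by exact: fin_bigcup_measurable.
split => //; apply/eqP; rewrite eq_le measure_ge0 andbT.
apply: le_trans (content_sub_fsum _ fA _ mU _) _; [exact: mN|exact: subset_refl|].
by rewrite fsbig1.
Qed.

End Integrals.

(** * Iterated limits from bounds of order delta squared *)

Section Limits.
Context {R : realType}.
Local Open Scope classical_set_scope.
Local Open Scope ereal_scope.

Lemma limf_esup_le_near (T : choiceType) (X : filteredType T) (F : set_system X) (f : X -> \bar R) (c : \bar R) :
  F [set t | f t <= c]%classic -> limf_esup f F <= c.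
Proof.
move=> Fc; apply: ge_ereal_inf; exists (ereal_sup (f @` [set t | f t <= c]%classic)).
  by exists [set t | f t <= c]%classic.
by apply: ge_ereal_sup => _ [t /= tc <-].
Qed.

Lemma limf_einf_ge_near (T : choiceType) (X : filteredType T) (F : set_system X) (f : X -> \bar R) (c : \bar R) :
  F [set t | c <= f t]%classic -> c <= limf_einf f F.
Proof.
move=> Fc; rewrite /limf_einf leeNr; apply: limf_esup_le_near.
by under eq_set do rewrite leeN2.
Qed.

Lemma scaling_upper (u : R -> nat -> \bar R) (C d0 : R) : (0 < d0)%R ->
  (forall d, (0 < d < d0)%R -> \forall m \near \oo, u d m <= (C * d ^+ 2)%:E) ->
  limf_esup (fun d : R => (d ^- 2)%:E * limn_esup (u d)) (0%R : R)^'+ < +oo.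
Proof.
move=> d00 h; apply: (@le_lt_trans _ _ C%:E); last exact: ltry.
apply: limf_esup_le_near.
near=> d => /=.
have d_gt0 : (0 < d)%R by near: d; exact: nbhs_right_gt.
have dd0 : (d < d0)%R by near: d; exact: nbhs_right_lt.
apply: (@le_trans _ _ ((d ^- 2)%:E * (C * d ^+ 2)%:E)).
  apply: lee_wpmul2l; first by rewrite lee_fin invr_ge0 sqr_ge0.
  by apply: limf_esup_le_near; apply: h; rewrite d_gt0.
rewrite -EFinM lee_fin mulrCA mulVf ?mulr1 //; by rewrite expf_neq0 // gt_eqF.
Unshelve. all: by end_near. Qed.

Lemma scaling_lower (u : R -> nat -> \bar R) (c d0 : R) : (0 < d0)%R -> (0 < c)%R ->
  (forall d, (0 < d < d0)%R -> \forall m \near \oo, (c * d ^+ 2)%:E <= u d m) ->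
  0 < limf_einf (fun d : R => (d ^- 2)%:E * limn_einf (u d)) (0%R : R)^'+.
Proof.
move=> d00 c0 h; apply: (@lt_le_trans _ _ c%:E); first by rewrite lte_fin.
apply: limf_einf_ge_near.
near=> d => /=.
have d_gt0 : (0 < d)%R by near: d; exact: nbhs_right_gt.
have dd0 : (d < d0)%R by near: d; exact: nbhs_right_lt.
apply: (@le_trans _ _ ((d ^- 2)%:E * (c * d ^+ 2)%:E)).
  rewrite -EFinM lee_fin mulrCA mulVf ?mulr1 //; by rewrite expf_neq0 // gt_eqF.
apply: lee_wpmul2l; first by rewrite lee_fin invr_ge0 sqr_ge0.
by apply: limf_einf_ge_near; apply: h; rewrite d_gt0.
Unshelve. all: by end_near. Qed.

End Limits.

Section Bins.
Local Open Scope classical_set_scope.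
Context {R : realType}.
Implicit Types (th x t : R) (N k : nat).

(* The index of the cell [th + k x, th + (k + 1) x) containing [t], clipped to [0, N]. *)
Definition bin th x N t : 'I_N.+1 := inord (minn (Num.truncn ((t - th) / x)) N).

Lemma bin_gt th x N t k : 0 < x -> (k < N)%N ->
  (k < bin th x N t)%N = (th + k.+1%:R * x <= t).
Proof.
move=> x0 kN; rewrite /bin inordK; last by rewrite ltnS geq_minr.
by rewrite leq_min kN andbT Num.Theory.truncn_gt_nat ler_pdivlMr // lerBrDl.
Qed.

Lemma bin_ge th x N t k : 0 < x -> (0 < k)%N -> (k <= N)%N ->
  (k <= bin th x N t)%N = (th + k%:R * x <= t).
Proof. by case: k => // k x0 _ kN; exact: bin_gt. Qed.

Lemma bin_lt_upper th x N t : 0 < x -> (bin th x N t < N)%N ->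
  t < th + (bin th x N t).+1%:R * x.
Proof. by move=> x0 kN; rewrite ltNge -(@bin_gt _ _ N) // ltnn. Qed.

Lemma bin_lower th x N t : 0 < x -> (0 < bin th x N t)%N ->
  th + (bin th x N t)%:R * x <= t.
Proof. by move=> x0 k0; rewrite -(@bin_ge _ _ N) // -ltnS. Qed.

Lemma measurable_bin th x N (a : 'I_N.+1) : 0 < x ->
  measurable [set t | bin th x N t = a]%classic.
Proof.
move=> x0; pose D k : set R := if k is k'.+1 then
  (if (k' < N)%N then `[th + k%:R * x, +oo[ else set0) else setT.
have mD k : measurable (D k).
  rewrite /D; case: k => [|k]; first exact: measurableT.
  by case: ifP => _; [exact: measurable_itv|exact: measurable0].
have DE k t : D k t <-> (k <= bin th x N t)%N.
  case: k => [|k]; rewrite /D; first by split.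
  case: ltnP => kN; first by rewrite bin_gt //= in_itv /= andbT.
  split => // kb; have := ltn_ord (bin th x N t).
  by move: kb kN; clear; lia.
have -> : [set t | bin th x N t = a] = D a `\` D a.+1.
  apply/seteqP; split => t /=.
    move=> ta; split; first by apply/(DE a t); rewrite ta.
    by move=> /(DE a.+1 t); rewrite ta ltnn.
  move=> [/(DE a t) h1 h2]; apply/val_inj/eqP; rewrite eqn_leq h1 andbT leqNgt.
  by apply/negP => h; apply: h2; apply/(DE a.+1 t).
exact: measurableD.
Qed.

End Bins.

(** * Near-minimal trees and cheap edges *)

Section NearMinimal.
Context {R : realType} {V : finType}.
Implicit Types (E T : {set {set V}}) (l : {set V} -> R) (u v : V) (x delta : R).

Lemma eps_ge0 E l delta : (0 <= eps E l delta)%E.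
Proof.
apply: le_ereal_inf_tmp => _ [T' /= /andP[ST' _] <-].
rewrite lee_fin divr_ge0 // subr_ge0.
have /andP[_ /forallP/(_ T')] := mst_spanning l ST'.
by rewrite ST'.
Qed.

Lemma eps_le E l delta T' : spanning_tree E T' ->
  delta * #|V|%:R <= #|T' :\: mst E l|%:R ->
  (eps E l delta <= ((len l T' - len l (mst E l)) / #|V|%:R)%:E)%E.
Proof.
move=> ST' h; apply: ereal_inf_lbound; exists T' => //=.
by rewrite /= ST' h.
Qed.

(* Such an edge [uv] can enter the minimal tree at a cost below [x]. *)
Definition cheap_edge E l x u v : bool :=
  connect (adj [set f in E :\ [set u; v] | l f <= l [set u; v]]) u v &&
  ~~ connect (adj [set f in E :\ [set u; v] | l f <= l [set u; v] - x]) u v.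

(** At least half of the new edges lie outside [B] and so are not cheap. For an edge outside the
    tree the first half of cheapness is automatic by the cycle property, so the second half fails,
    which is what [mst_gap] requires. *)
Lemma eps_ge E l delta x (B : {set {set V}}) : 0 <= x -> (0 < #|V|)%N ->
  (forall u v, [set u; v] \in E -> u != v -> cheap_edge E l x u v -> [set u; v] \in B) ->
  #|B|%:R <= delta * #|V|%:R / 2 ->
  ((x * delta / 2)%:E <= eps E l delta)%E.
Proof.
move=> x0 V0 hB cB.
have V0' : 0 < #|V|%:R :> R by rewrite ltr0n.
apply: le_ereal_inf_tmp => _ [T' /= /andP[ST' hT'] <-].
rewrite lee_fin ler_pdivlMr //.
have mT := mst_spanning l ST'; set T := mst E l in mT hT' *.
apply: (@le_trans _ _ (x * #|(T' :\: T) :&: (E :\: B)|%:R)).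
  have : (#|T' :\: T| <= #|(T' :\: T) :&: (E :\: B)| + #|B|)%N.
    apply: leq_trans (leq_card_setU _ _); apply: subset_leq_card.
    apply/fintype.subsetP => e; rewrite !finset.inE => /andP[-> eT'].
    have [TE' _ _ _] := spanning_treeP _ _ ST'.
    by rewrite eT' (fintype.subsetP TE' _ eT') andbT; case: (e \in B).
  rewrite -(ler_nat R) natrD => h; nra.
apply: (mst_gap x0 mT ST') => a b; rewrite !finset.inE => /andP[abB abE] abT.
have [->|nab] := eqVneq a b; first exact: connect0.
apply/negPn/negP => nc; move/negP: abB; apply; apply: hB => //.
apply/andP; split.
  apply: connect_adjS (mst_cycle mT abE nab).
  have [TE _ _ _] : [/\ T \subset E, True, True & True].
    by case/andP: mT => /spanning_treeP[].
  apply/fintype.subsetP => f; rewrite !finset.inE => /andP[fT ->].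
  by rewrite (fintype.subsetP TE) // andbT /= andbT; apply: contraNneq abT => <-.
apply: contraNN nc; apply: connect_adjS; apply/fintype.subsetP => f.
by rewrite !finset.inE => /andP[/andP[_ ->] ->].
Qed.

End NearMinimal.

(** * The disordered lattice *)

Section Density.
Context {d : measure_display} {Omega : measurableType d} {R : realType}.
Variables (P : probability Omega R) (f : R -> R) (M : R) (Y : Omega -> R).
Hypothesis mf : measurable_fun setT f.
Hypothesis f0 : forall x, 0 <= f x.
Hypothesis fneg : forall x, x <= 0 -> f x = 0.
Hypothesis fM : forall x, f x <= M.
Hypothesis fmean : (\int[@lebesgue_measure R]_x (`|x| * f x)%:E < +oo)%E.
Hypothesis mY : measurable_fun setT Y.
Hypothesis Yf : forall B : set R, measurable B ->
  P (Y @^-1` B)%classic = (\int[@lebesgue_measure R]_(x in B) (f x)%:E)%E.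
Local Open Scope classical_set_scope.
Local Open Scope ereal_scope.
Local Notation mu := (@lebesgue_measure R).

Let mfE : measurable_fun [set: measurableTypeR R] (fun t : R => (f t)%:E).
Proof. by apply/measurable_EFinP; exact: mf. Qed.

Let mxf : measurable_fun [set: measurableTypeR R] (fun t : R => (`|t| * f t)%:E).
Proof.
by apply/measurable_EFinP; apply: measurable_funM => //; exact: measurableT_comp.
Qed.

Lemma lebesgue_measure_itvco (a b : R) : (a <= b)%R -> mu `[a, b[ = (b - a)%:E.
Proof.
move=> ab; rewrite lebesgue_measure_itv /= lte_fin.
by case: ltP => // ba; have -> : a = b by [apply/le_anti; rewrite ab]; rewrite subrr.
Qed.

(** Only the positive points of [B] are constrained, since the density vanishes elsewhere; this
    covers the lowest bin, which contains all negative numbers. *)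
Lemma density_bounded_interval (B : set R) (a b : R) : measurable B -> (a <= b)%R ->
  (forall t, (0 < t)%R -> B t -> (a <= t < b)%R) ->
  P (Y @^-1` B) <= (M * (b - a))%:E.
Proof.
move=> mB ab Bab; rewrite Yf //.
have M0 : (0 <= M)%R := le_trans (f0 0) (fM 0).
have mI : measurable_fun [set: measurableTypeR R] (fun t : R => (\1_(`[a, b[) t : R)%:E).
  by apply/measurable_EFinP; exact: measurable_indic.
have -> : (M * (b - a))%:E = \int[mu]_t (M%:E * (\1_(`[a, b[) t)%:E).
  rewrite ge0_integralZl_EFin // integral_indic // setIT.
  by rewrite EFinM -lebesgue_measure_itvco.
rewrite integral_mkcond; apply: ge0_le_integral => //.
- by move=> t _; apply: erestrict_ge0 => s _; rewrite lee_fin.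
- by apply/(measurable_restrictT _ _).1; [exact: mB|exact: measurable_funTS].
- exact: measurable_funeM.
move=> t _; rewrite patchE; case: ifPn => [|_]; last by rewrite mule_ge0 // lee_fin.
rewrite inE => Bt; have [t0|t0] := ltP 0%R t; last first.
  by rewrite fneg // mule_ge0 // lee_fin.
by rewrite indicE mem_set ?mule1 ?lee_fin //= in_itv /= Bab.
Qed.

Lemma density_tail (eta : R) : (0 < eta)%R -> exists2 K : nat, (0 < K)%N &
  \int[mu]_(t in `[K%:R, +oo[) (`|t| * f t)%:E <= eta%:E.
Proof.
move=> eta0.
pose g (n : nat) : R -> \bar R := (fun t : R => (`|t| * f t)%:E) \_ `[n%:R, +oo[.
have mg n : measurable_fun [set: measurableTypeR R] (g n).
  apply/(measurable_restrictT _ _).1; first exact: measurable_itv.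
  exact: measurable_funTS.
have [|||_ _ cvg] := @dominated_convergence _ _ _ mu setT measurableT g (cst 0)
  (fun t : R => (`|t| * f t)%:E) mg (measurable_cst _).
- apply: aeW => t _; apply: cvg_near_cst; near=> n.
  rewrite /g patchE ifF //; apply/negbTE; rewrite notin_setE /= in_itv /= andbT.
  by apply/negP; rewrite -ltNge; near: n; exact: nbhs_infty_gtr.
- apply/integrableP; split => //.
  by under eq_integral => t _ do rewrite gee0_abs ?lee_fin ?mulr_ge0 //.
- apply: aeW => t n _; rewrite /g patchE; case: ifP => _.
    by rewrite gee0_abs // lee_fin mulr_ge0.
  by rewrite abse0 lee_fin mulr_ge0.
move: cvg; rewrite integral0 => /fine_cvgP[fing /cvgr_lt /(_ _ eta0) ltg].
near \oo => K.
exists K; first by near: K; exact: nbhs_infty_gt.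
rewrite integral_mkcond -[leLHS]fineK; last by near: K.
by rewrite lee_fin ltW //; near: K.
Unshelve. all: by end_near. Qed.

Lemma density_prob_ge (K : nat) : (0 < K)%N ->
  P (Y @^-1` `[K%:R, +oo[) <= \int[mu]_(t in `[K%:R, +oo[) (`|t| * f t)%:E.
Proof.
move=> K0; rewrite Yf; last exact: measurable_itv.
apply: ge0_le_integral.
- exact: measurable_itv.
- by move=> t _; rewrite lee_fin.
- exact: measurable_funTS.
- exact: measurable_funTS.
move=> t; rewrite /= in_itv /= andbT => Kt; rewrite lee_fin ler_peMl //.
apply: le_trans (ler_norm _); apply: le_trans Kt; by rewrite ler1n.
Qed.

(** [Yf] gives the law of [Y] on sets only, so [Y] is rounded up on unit intervals; for [K > 0] this
    costs at most a factor two, as [K + j + 1 <= 2 (K + j)]. *)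
Lemma density_mean_ge (K : nat) : (0 < K)%N ->
  \int[P]_w (Y w * \1_(Y @^-1` `[K%:R, +oo[) w)%:E <=
  2%:E * \int[mu]_(t in `[K%:R, +oo[) (`|t| * f t)%:E.
Proof.
move=> K0.
pose F (j : nat) : set R := `[(K + j)%:R, (K + j).+1%:R[.
have mF j : measurable (F j) by exact: measurable_itv.
have YF j : measurable (Y @^-1` F j).
  by rewrite -[X in measurable X]setTI; exact: mY.
pose h (j : nat) w : \bar R := (K + j).+1%:R%:E * (\1_(Y @^-1` F j) w)%:E.
have h0 j w : 0 <= h j w by rewrite mule_ge0 // lee_fin.
have mh j : measurable_fun setT (h j).
  by apply: measurable_funeM; apply/measurable_EFinP; exact: measurable_indic.
apply: (@le_trans _ _ (\int[P]_w \sum_(j <oo) h j w)).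
  apply: ge0_integral_mono => w; rewrite indicE.
    rewrite lee_fin; case: (boolP (_ \in _)); last by rewrite mulr0.
    by rewrite inE /= in_itv /= andbT mulr1; apply: le_trans.
  case: (boolP (_ \in _)) => [|_]; last by rewrite mulr0; apply: nneseries_ge0.
  rewrite inE /= in_itv /= andbT => KY.
  have Y0 : (0 <= Y w)%R by apply: le_trans KY.
  pose j := (Num.truncn (Y w) - K)%N.
  have KT : (K <= Num.truncn (Y w))%N by rewrite Num.Theory.truncn_ge_nat.
  have Fj : F j (Y w).
    by rewrite /F /= in_itv /= subnKC // Num.Theory.truncn_itv.
  rewrite mulr1 (@nneseriesD1 _ _ j xpredT) //.
  apply: (@le_trans _ _ (h j w)); last by rewrite leeDl //; apply: nneseries_ge0.
  rewrite /h indicE mem_set // mule1 lee_fin subnKC // ltW //.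
  by have /andP[] := Num.Theory.truncn_itv Y0.
rewrite integral_nneseries //.
have -> : `[K%:R, +oo[ = \bigcup_j F j.
  apply/seteqP; split => t /=.
    rewrite in_itv /= andbT => Kt; exists (Num.truncn t - K)%N => //=.
    have t0 : (0 <= t)%R by apply: le_trans Kt.
    by rewrite /F /= in_itv /= subnKC ?Num.Theory.truncn_itv // Num.Theory.truncn_ge_nat.
  move=> [j _]; rewrite /F /= !in_itv /= andbT => /andP[h1 _].
  by apply: le_trans h1; rewrite ler_nat leq_addr.
rewrite ge0_integral_bigcup //; first last.
- apply/trivIsetP => i j _ _ ij; apply/seteqP; split => // t [].
  rewrite /F /= !in_itv /= => /andP[i1 i2] /andP[j1 j2].
  have := le_lt_trans i1 j2; have := le_lt_trans j1 i2; rewrite !ltr_nat !ltnS !leq_add2l.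
  by move=> ji ij'; case/eqP: ij; apply/eqP; rewrite eqn_leq ji ij'.
- by move=> t _; rewrite lee_fin mulr_ge0.
- exact: measurable_funTS.
rewrite -nneseriesZl //; last by move=> j _; apply: integral_ge0 => t _; rewrite lee_fin mulr_ge0.
apply: lee_nneseries => [j _ _|j _]; first exact: integral_ge0.
have -> : \int[P]_w h j w = (K + j).+1%:R%:E * \int[mu]_(t in F j) (f t)%:E.
  rewrite /h ge0_integralZl_EFin //; last by apply/measurable_EFinP; exact: measurable_indic.
  by rewrite integral_indic // setIT; congr (_ * _); exact: Yf.
have h1 := @ge0_integralZl_EFin _ _ _ mu (F j) (mF j) (fun t => (f t)%:E)
  (fun t _ => f0 t) (measurable_funTS mfE) (K + j).+1%:R (ler0n _ _).
have h2 := @ge0_integralZl_EFin _ _ _ mu (F j) (mF j) (fun t => (`|t| * f t)%:E)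
  (fun t _ => mulr_ge0 (normr_ge0 t) (f0 t)) (measurable_funTS mxf) 2%R (ler0n _ _).
rewrite -h1 -h2; apply: ge0_le_integral => //; first exact: mF.
- by move=> t _; apply: mule_ge0; rewrite lee_fin.
- by apply: measurable_funeM; exact: measurable_funTS.
- by apply: measurable_funeM; exact: measurable_funTS.
move=> t; rewrite /F /= in_itv /= => /andP[Kt _]; rewrite lee_fin mulrA ler_wpM2r //.
have t0 : (0 <= t)%R by apply: le_trans Kt.
rewrite ger0_norm // -natr1; have : (1 <= (K + j)%:R :> R)%R by rewrite ler1n addn_gt0 K0.
by lra.
Qed.

Lemma density_quantiles : exists q1 q2 : R, [/\ (0 < q1)%R, (q1 < q2)%R,
  (8^-1)%:E <= P (Y @^-1` `]-oo, q1[), (8^-1)%:E <= P (Y @^-1` `[q1, q2[) &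
  (8^-1)%:E <= P (Y @^-1` `[q2, +oo[)].
Proof.
have M0 : (0 < M)%R.
  rewrite ltNge; apply/negP => M0.
  have : P (Y @^-1` setT) = 0.
    rewrite Yf // integral0_eq // => t _; congr EFin; apply/le_anti.
    by rewrite f0 (le_trans (fM t)).
  by rewrite preimage_setT probability_setT => /eqP; rewrite onee_eq0.
(* Over a step [h] the distribution function grows by at most [1 / 8], so the levels [1 / 8] and
   [3 / 8] are reached without passing [1 / 4] and [1 / 2]. *)
pose h : R := ((8 * M)^-1)%R.
have h0 : (0 < h)%R by rewrite invr_gt0 mulr_gt0.
pose F (k : nat) : R := fine (P (Y @^-1` `]-oo, (k%:R * h)%R[)).
have mYB (B : set R) : measurable B -> measurable (Y @^-1` B).
  by move=> mB; rewrite -[X in measurable X]setTI; exact: mY.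
have FE k : (F k)%:E = P (Y @^-1` `]-oo, (k%:R * h)%R[).
  by rewrite fineK // fin_num_measure //; apply: mYB; exact: measurable_itv.
have split_itv (a b : R) : (a <= b)%R ->
    P (Y @^-1` `]-oo, b[) = P (Y @^-1` `]-oo, a[) + P (Y @^-1` `[a, b[).
  move=> ab; rewrite -measureU; first last.
  - apply/seteqP; split => // w []; rewrite /= !in_itv /= => wa /andP[aw _].
    by have := lt_le_trans wa aw; rewrite ltxx.
  - by apply: mYB; exact: measurable_itv.
  - by apply: mYB; exact: measurable_itv.
  congr (P _); apply/seteqP; split => w /=; rewrite !in_itv /=.
    by move=> wb; case: (ltP (Y w) a) => wa; [left|right; rewrite wb].
  by case=> [wa|/andP[]//]; exact: lt_le_trans ab.
have FS k : (F k.+1 <= F k + 8^-1)%R.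
  rewrite -lee_fin FE EFinD FE (split_itv (k%:R * h)%R); last first.
    by rewrite ler_wpM2r ?ler_nat // ltW.
  rewrite leeD2l //.
  apply: le_trans (density_bounded_interval (a := (k%:R * h)%R) (b := (k.+1%:R * h)%R) _ _ _) _.
  - exact: measurable_itv.
  - by rewrite ler_wpM2r ?ler_nat // ltW.
  - by move=> t _; rewrite /= in_itv.
  by rewrite lee_fin -mulrBl -natrB // subSnn mul1r /h invfM mulrCA mulfV ?mulr1 // gt_eqF.
have F0 : F 0%N = 0%R.
  apply: EFin_inj; rewrite FE mul0r Yf; last exact: measurable_itv.
  apply: integral0_eq => t; rewrite /= in_itv /= => t0; by rewrite fneg // ltW.
have Fmono i j : (i <= j)%N -> (F i <= F j)%R.
  move=> ij; rewrite -lee_fin !FE le_measure // ?inE; first last.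
  - by move=> w; rewrite /= !in_itv /= => /lt_le_trans; apply; rewrite ler_wpM2r ?ler_nat // ltW.
  - by apply: mYB; exact: measurable_itv.
  - by apply: mYB; exact: measurable_itv.
have compl q : P (Y @^-1` `[q, +oo[) = 1 - P (Y @^-1` `]-oo, q[).
  rewrite -probability_setC; last by apply: mYB; exact: measurable_itv.
  by rewrite preimage_setC setCitvl.
have [K FK] : exists K, (7 / 8 <= F K)%R.
  have [K0 K00 tail] := density_tail (eta := (8^-1)%R) ltac:(lra).
  exists (Num.truncn (K0%:R / h)).+1.
  have Kh : (K0%:R <= (Num.truncn (K0%:R / h)).+1%:R * h)%R.
    by rewrite -ler_pdivrMr // ltW // Num.Theory.truncnS_gt.
  have : P (Y @^-1` `[K0%:R, +oo[) <= (8^-1)%:E := le_trans (density_prob_ge K00) tail.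
  rewrite compl leeBlDr ?fin_num_measure //; last by apply: mYB; exact: measurable_itv.
  move=> h1; have : 1 <= (8^-1)%:E + (F (Num.truncn (K0%:R / h)).+1)%:E.
    apply: le_trans h1 _; rewrite leeD2l // FE le_measure // ?inE; first last.
    - by move=> w; rewrite /= !in_itv /= => /lt_le_trans; apply.
    - by apply: mYB; exact: measurable_itv.
    - by apply: mYB; exact: measurable_itv.
  by rewrite -EFinD lee_fin; lra.
have level c : (0 < c)%R -> (c <= 7 / 8)%R -> exists k, [/\ (0 < k)%N, (c <= F k)%R & (F k <= c + 8^-1)%R].
  move=> c0 c7; have exk : exists k, (c <= F k)%R by exists K; exact: le_trans FK.
  case: (ex_minnP exk) => k ck kmin; exists k.
  case: k ck kmin => [|k ck kmin]; first by rewrite F0; lra.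
  split => //; have : (F k < c)%R by rewrite ltNge; apply/negP => /kmin; rewrite ltnn.
  by have := FS k; lra.
have [k1 [k10 k1l k1u]] := level (8^-1)%R ltac:(lra) ltac:(lra).
have [k2 [k20 k2l k2u]] := level (3 / 8)%R ltac:(lra) ltac:(lra).
have k12 : (k1 < k2)%N by rewrite ltnNge; apply/negP => /Fmono; lra.
have k12h : (k1%:R * h < k2%:R * h)%R by rewrite ltr_pM2r // ltr_nat.
exists (k1%:R * h)%R, (k2%:R * h)%R; split => //.
- by rewrite mulr_gt0 // ltr0n.
- by rewrite -FE lee_fin.
- have := split_itv _ _ (ltW k12h).
  have <- : (fine (P (Y @^-1` `[(k1%:R * h)%R, (k2%:R * h)%R[)))%:E = P (Y @^-1` `[(k1%:R * h)%R, (k2%:R * h)%R[).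
    by rewrite fineK // fin_num_measure //; apply: mYB; exact: measurable_itv.
  by rewrite -!FE -EFinD => E; have := EFin_inj E; rewrite lee_fin; lra.
- by rewrite compl -FE -EFinB lee_fin; lra.
Qed.

End Density.

Section BinMono.
Context {R : realType}.
Lemma bin_mono (th x s t : R) N : 0 < x -> s <= t -> (bin th x N s <= bin th x N t)%N.
Proof.
move=> x0 st; case E : (nat_of_ord (bin th x N s)) => [//|k].
have kN : (k < N)%N by rewrite -ltnS -E ltnS -ltnS.
by rewrite bin_gt // (le_trans _ st) // -(@bin_gt _ _ _ N) // E.
Qed.
End BinMono.

(** A monotone [c] switches on once, and only its first two true indices are counted. *)
Lemma sum_monotone_lag2 (c : nat -> bool) n : (forall i j, (i <= j)%N -> c i -> c j) ->
  (\sum_(k < n) (c k && ~~ ((1 < k)%N && c (k - 2)%N)) <= 2)%N.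
Proof.
move=> mono.
suff H : (\sum_(k < n) (c k && ~~ ((1 < k)%N && c (k - 2)%N)) <=
    ((0 < n)%N && c (n - 1)%N) + ((1 < n)%N && c (n - 2)%N))%N.
  by apply: leq_trans H _; do 2!case: (_ && _).
elim: n => [|n ih]; first by rewrite big_ord0.
rewrite big_ord_recr /=; apply: leq_trans (leq_add ih (leqnn _)) _.
case: n {ih} => [|[|n]] //=; first by rewrite subnn !andbT addn0; case: (c 0%N).
  by rewrite !subSS subnn !subn0 /= !andbT addn0 addnC; case: (c 0%N); case: (c 1%N).
rewrite !subSS !subn0.
have h1 := mono n n.+1 (leqnSn _); have h2 := mono n.+1 n.+2 (leqnSn _).
by move: h1 h2; case: (c n); case: (c n.+1); case: (c n.+2) => // h1 h2;
  try (by have := h1 isT); by have := h2 isT.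
Qed.

(** * Cheap edges seen through binned lengths *)

Section EdgeLengths.
Context {V : finType}.
Implicit Types (T D E : {set {set V}}) (e : {set V}).

(** Connection is stated for the edge as a set, so that sums over edges need no choice of
    endpoints. *)
Definition joined T e : bool := [forall a in e, forall b in e, connect (adj T) a b].

Lemma joined_set2 T a b : joined T [set a; b] = connect (adj T) a b.
Proof.
apply/idP/idP => [/forall_inP/(_ a)|ab].
  by rewrite !finset.inE eqxx => /(_ isT)/forall_inP/(_ b); rewrite !finset.inE eqxx orbT; apply.
apply/forall_inP => u; rewrite !finset.inE => uE; apply/forall_inP => v; rewrite !finset.inE => vE.
case/orP: uE => /eqP->; case/orP: vE => /eqP->; rewrite ?connect0 //.
by rewrite adj_connect_sym.
Qed.

Lemma joinedS T D e : T \subset D -> joined T e -> joined D e.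
Proof.
move=> TD /forall_inP h; apply/forall_inP => a ae; apply/forall_inP => b be.
by apply: connect_adjS TD _; have /forall_inP := h _ ae; apply.
Qed.

Variable K : nat.
Implicit Types (v : {ffun {set V} -> 'I_K.+1}).

(** A gap of two labels guarantees that lengths differ by at least [x]; with this gap no edge that
    is cheap at scale [x] is missed. *)
Definition cheap_label E v e : bool :=
  joined [set f in E :\ e | (v f <= v e)%N] e &&
  ~~ joined [set f in E :\ e | ((v f).+2 <= v e)%N] e.

(** With the other labels fixed, being joined without [e] at level [k] is monotone in [k]; cheapness
    leaves at most two labels for [e], each of weight at most [y]. *)
Lemma avg_cheap_label {R : realType} (p : {set V} -> 'I_K.+1 -> R) E v e (y : R) :
  #|e| = 2 -> (forall a, 0 <= p e a <= y) ->
  avg p e (fun v => (cheap_label E v e)%:R) v <= 2 * y.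
Proof.
move=> e2 py; pose c k := joined [set f in E :\ e | (v f <= k)%N] e.
have y0 : 0 <= 2 * y.
  by have /andP[h1 h2] := py ord0; rewrite mulr_ge0 // (le_trans h1).
have cm i j : (i <= j)%N -> c i -> c j.
  move=> ij; apply: joinedS; apply/fintype.subsetP => f; rewrite !finset.inE => /andP[-> /=].
  by move/leq_trans; apply.
apply: (@le_trans _ _ (\sum_(a < K.+1) y * (c a && ~~ ((1 < a)%N && c (a - 2)%N))%:R)).
  apply: ler_sum => a _.
  have -> : cheap_label E (upd v e a) e = c a && ~~ ((1 < a)%N && c (a - 2)%N).
    rewrite /cheap_label upd_at /c; congr (_ && ~~ _).
      congr (joined _ _); apply/setP => f; rewrite !finset.inE.
      by case: (eqVneq f e) => //= fe; rewrite upd_ne.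
    case: ltnP => a1 /=.
      congr (joined _ _); apply/setP => f; rewrite !finset.inE.
      case: (eqVneq f e) => //= fe; rewrite upd_ne //; congr (_ && _).
      by rewrite -[RHS](leq_add2r 2) subnK // addn2.
    (* For labels below two the lower level set is empty, and the empty set does not join the two
       distinct ends of [e]. *)
    have /cards2P[u [w [nuw eE]]] : #|e| == 2 by rewrite e2.
    apply/negbTE/negP; rewrite [X in joined _ X]eE joined_set2 => /connect_adj_step/(_ nuw)[z].
    by rewrite !finset.inE => /andP[_ h]; have := leq_trans h a1.
  have /andP[h0 hy] := py a.
  by rewrite ler_wpM2r.
rewrite -mulr_sumr mulrC ler_wpM2r //; first by move: y0; rewrite pmulr_rge0.
by rewrite -natr_sum ler_nat; exact: sum_monotone_lag2.
Qed.

Lemma cheap_edge_label {R : realType} E (l : {set V} -> R) v (x : R) a b : 0 < x ->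
  (forall f, f \in E -> v f = bin 0 x K (l f)) -> [set a; b] \in E ->
  cheap_edge E l x a b -> cheap_label E v [set a; b].
Proof.
move=> x0 vl abE /andP[h1 h2]; apply/andP; split; rewrite joined_set2.
  apply: connect_adjS h1; apply/fintype.subsetP => f.
  rewrite !finset.inE => /andP[/andP[-> fE] lf]; rewrite fE /= !vl //.
  exact: bin_mono.
apply: contraNN h2; apply: connect_adjS; apply/fintype.subsetP => f.
rewrite !finset.inE => /andP[/andP[-> fE] lf]; rewrite fE /=.
move: lf; rewrite !vl // => lf.
have fK : (bin 0%R x K (l f) < K)%N.
  by have := leq_trans lf (leq_ord _); exact: ltnW.
have := bin_lt_upper x0 fK; have := @bin_lower _ _ _ K (l [set a; b]) x0 (leq_trans _ lf).
move=> /(_ isT); rewrite !add0r => h3 h4.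
have : (bin 0%R x K (l f)).+2%:R * x <= (bin 0%R x K (l [set a; b]))%:R * x.
  by rewrite ler_wpM2r ?ler_nat // ltW.
by move: h3 h4; rewrite -!natr1; lra.
Qed.
End EdgeLengths.

(** * Lower bound for independent edge lengths *)

Section LowerBound.
Context {d : measure_display} {Omega : measurableType d} {R : realType}.
Variables (P : probability Omega R) (V : finType) (E : {set {set V}}).
Variables (L : {set V} -> Omega -> R) (M D delta : R).
Hypothesis E2 : forall e, e \in E -> #|e| = 2.
Hypothesis V0 : (0 < #|V|)%N.
Hypothesis M0 : 0 < M.
Hypothesis D0 : 0 < D.
Hypothesis ED : #|E|%:R <= D * #|V|%:R.
Hypothesis mL : forall e, e \in E -> measurable_fun setT (L e).
Hypothesis indep : mutually_independent P E L.
Hypothesis law : forall x : R, 0 < x -> exists K : nat, forall e, e \in E ->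
  forall a : 'I_K.+1, (P [set w | bin 0 x K (L e w) = a]%classic <= (M * x)%:E)%E.

Lemma expected_eps_ge : 0 < delta ->
  ((delta ^+ 2 / (32 * M * D))%:E <=
   \int[P]_w eps E (fun e => L e w) delta)%E.
Proof.
(* With this [x] the expected number of cheap edges is at most [2 M x D n = delta n / 4], so by
   Markov's inequality it stays below [delta n / 2] with probability at least one half. *)
move=> delta0; pose x := delta / (8 * M * D).
have x0 : 0 < x by rewrite divr_gt0 // !mulr_gt0.
have [K hK] := law x0.
have n0 : 0 < #|V|%:R :> R by rewrite ltr0n.
pose lab := bin 0%R x K.
have mlab a : measurable [set t | lab t = a]%classic by exact: measurable_bin.
pose p := label_law P E L lab ord0.
have p0 e a : 0 <= p e a by exact: label_law_ge0.
have p1 e : \sum_a p e a = 1 by exact: sum_label_law.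
pose F (v : {ffun {set V} -> 'I_K.+1}) : R := \sum_(e in E) (cheap_label E v e)%:R.
have EF : Ew p F <= delta * #|V|%:R / 4.
  rewrite /F Ew_sum; apply: (@le_trans _ _ (\sum_(e in E) 2 * (M * x))).
    apply: ler_sum => e eE; rewrite -(Ew_avg p1 e) -[leRHS](Ew_cst p1).
    apply: ler_Ew => // v; apply: avg_cheap_label; first exact: E2.
    move=> a; rewrite p0 /= -lee_fin /p label_lawE //; exact: hK.
  rewrite sumr_const -[leLHS]mulr_natl; apply: (@le_trans _ _ (D * #|V|%:R * (2 * (M * x)))).
    apply: ler_wpM2r; last exact: ED.
    by apply: mulr_ge0 => //; apply: mulr_ge0; exact: ltW.
  rewrite le_eqVlt; apply/orP; left; apply/eqP; rewrite /x; field.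
  by rewrite !gt_eqF.
pose S := [pred v : {ffun {set V} -> 'I_K.+1} | ~~ (delta * #|V|%:R / 2 <= F v)].
have PS : 1 / 2 <= Ew p (fun v => (S v)%:R).
  rewrite /S /= Ew_negb //.
  have : Ew p (fun v => (delta * #|V|%:R / 2 <= F v)%R%:R) <= 1 / 2.
    apply: le_trans (Ew_markov p0 _ _) _ => //.
    - by move=> v; apply: sumr_ge0.
    - by rewrite divr_gt0 // mulr_gt0.
    by rewrite ler_pdivrMr ?divr_gt0 ?mulr_gt0 //; lra.
  lra.
have [mS PSE] := labels_event ord0 mL mlab indep S.
have main w : S (labels E L lab ord0 w) ->
    ((x * delta / 2)%:E <= eps E (fun e => L e w) delta)%E.
  move=> /= Sw; set v := labels E L lab ord0 w in Sw *.
  apply: (eps_ge (B := [set e in E | cheap_label E v e])) => //.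
  - exact: ltW.
  - move=> a b abE nab h; rewrite finset.inE abE; apply: cheap_edge_label h => // f fE.
    by rewrite /v ffunE fE.
  rewrite leNgt; apply: contraNN Sw => h; apply: ltW; apply: (lt_le_trans h).
  rewrite /F -natr_sum ler_nat -sum1dep_card big_mkcondr /=.
  by apply: leq_sum => e _; case: (cheap_label E v e).
apply: le_trans (integral_ge_event P mS _ _ main).
- rewrite PSE -EFinM lee_fin; apply: (@le_trans _ _ (x * delta / 2 * (1 / 2))).
    rewrite le_eqVlt; apply/orP; left; apply/eqP; rewrite /x; field.
    by rewrite !gt_eqF.
  by rewrite ler_wpM2l // divr_ge0 // mulr_ge0 // ltW.
- by rewrite divr_ge0 // mulr_ge0 // ltW.
- by move=> w; exact: eps_ge0.
Qed.

End LowerBound.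

Lemma card_set_diff_le1 (B : finType) (b0 : B) (S1 S2 : pred B) :
  (forall b, b != b0 -> S1 b = S2 b) -> (#|[set b | S1 b]| <= #|[set b | S2 b]|.+1)%N.
Proof.
move=> h; rewrite (cardsD1 b0 [set b | S1 b]) -add1n; apply: leq_add; first by case: (b0 \in _).
apply: subset_leq_card; apply/fintype.subsetP => b; rewrite !finset.inE => /andP[bb0].
by rewrite h.
Qed.

Lemma subset_of_card (T : finType) (A : {set T}) k : (k <= #|A|)%N ->
  exists2 B : {set T}, B \subset A & #|B| = k.
Proof.
move=> kA; exists [set i in take k (enum A)].
  by apply/fintype.subsetP => i; rewrite finset.inE => /mem_take; rewrite mem_enum.
by rewrite cardsE (card_uniqP _) ?take_uniq ?enum_uniq // size_take -cardE; case: ltngtP kA.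
Qed.

Lemma sum_sqr_ge {R : realFieldType} (I : finType) (A : {pred I}) (x : I -> R) :
  (\sum_(i in A) x i) ^+ 2 <= #|A|%:R * \sum_(i in A) x i ^+ 2.
Proof.
have -> : (\sum_(i in A) x i) ^+ 2 = \sum_(i in A) \sum_(j in A) x i * x j.
  by rewrite expr2 mulr_suml; apply: eq_bigr => i _; rewrite mulr_sumr.
have h : \sum_(i in A) \sum_(j in A) x i * x j <=
    \sum_(i in A) \sum_(j in A) (x i ^+ 2 + x j ^+ 2) / 2.
  by apply: ler_sum => i _; apply: ler_sum => j _; have := sqr_ge0 (x i - x j); nra.
apply: le_trans h _; rewrite le_eqVlt; apply/orP; left; apply/eqP.
have -> : \sum_(i in A) \sum_(j in A) (x i ^+ 2 + x j ^+ 2) / 2 =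
   \sum_(i in A) ((#|A|%:R / 2) * x i ^+ 2 + (\sum_(j in A) x j ^+ 2) / 2).
  apply: eq_bigr => i _; under eq_bigr do rewrite mulrDl.
  rewrite big_split /= sumr_const -mulr_suml; congr (_ + _).
  by rewrite -[LHS]mulr_natl mulrA mulrAC.
rewrite big_split /= -mulr_sumr sumr_const -[X in _ + X]mulr_natl.
by set y := \sum_(i in A) _; field.
Qed.

(** * Disjoint four-cycles in a graph *)

Section Cells.
Context {V B : finType}.
Variables (E : {set {set V}}) (c a b o : B -> V) (blk : V -> option B).
Implicit Types (T : {set {set V}}) (e : {set V}) (i j : B).

(* Disjoint four-cycles [c i - a i - o i - b i]; [blk] names the block containing
   a vertex, and the neighbours of [c i] all lie in block [i]. *)
Record four_cycles : Prop := FourCycles {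
  fc_ca : forall i, [set c i; a i] \in E;
  fc_cb : forall i, [set c i; b i] \in E;
  fc_ao : forall i, [set a i; o i] \in E;
  fc_bo : forall i, [set b i; o i] \in E;
  fc_neq_ab : forall i, a i != b i;
  fc_neq_co : forall i, c i != o i;
  fc_blk_o : forall i, blk (o i) = Some i;
  fc_blk_b : forall i, blk (b i) = Some i;
  fc_blk_c : forall i, blk (c i) = Some i;
  fc_nbr : forall i w, [set c i; w] \in E -> blk w = Some i }.

Hypothesis E2 : forall e, e \in E -> #|e| = 2.
Hypothesis FC : four_cycles.

Lemma fc_blk_a i : blk (a i) = Some i.
Proof. exact: (fc_nbr FC (fc_ca FC i)). Qed.

Lemma fc_neq_ca i : c i != a i.
Proof. by apply: card2_neq; apply: E2; exact: fc_ca. Qed.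

Lemma fc_neq_cb i : c i != b i.
Proof. by apply: card2_neq; apply: E2; exact: fc_cb. Qed.

Lemma four_cycle_missing_edge T i : spanning_tree E T ->
  exists e, [/\ e \in E, e \notin T & {in e, forall w, blk w = Some i}].
Proof.
move=> ST; have [TE T2 Tc Ta] := spanning_treeP _ _ ST.
have in2 (u v : V) : blk u = Some i -> blk v = Some i -> {in [set u; v], forall w, blk w = Some i}.
  by move=> hu hv w; rewrite !finset.inE => /orP[]/eqP->.
have [caT|?] := boolP ([set c i; a i] \in T); last first.
  by exists [set c i; a i]; split; [exact: fc_ca|by []|apply: in2; [exact: fc_blk_c|exact: fc_blk_a]].
have [cbT|?] := boolP ([set c i; b i] \in T); last first.
  by exists [set c i; b i]; split; [exact: fc_cb|by []|apply: in2; [exact: fc_blk_c|exact: fc_blk_b]].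
have [aoT|?] := boolP ([set a i; o i] \in T); last first.
  by exists [set a i; o i]; split; [exact: fc_ao|by []|apply: in2; [exact: fc_blk_a|exact: fc_blk_o]].
have [boT|?] := boolP ([set b i; o i] \in T); last first.
  by exists [set b i; o i]; split; [exact: fc_bo|by []|apply: in2; [exact: fc_blk_b|exact: fc_blk_o]].
exfalso; have /negP := Ta _ _ caT (fc_neq_ca i); apply.
have step u v : [set u; v] \in T -> [set u; v] != [set c i; a i] ->
    connect (adj (T :\ [set c i; a i])) u v.
  by move=> uvT ne; apply: connect1; rewrite /adj !finset.inE ne.
have nb := fc_neq_ab FC i; have no := fc_neq_co FC i; have na := fc_neq_ca i.
have ncb := fc_neq_cb i.
apply: (@connect_trans _ _ (b i)).
  apply: step => //; apply: contraNneq nb => /set2_inj[[_ ->//]|[ca _]].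
  by rewrite ca eqxx in na.
apply: (@connect_trans _ _ (o i)).
  apply: step => //; apply: contraNneq no => /set2_inj[[bc _]|[_ ->//]].
  by rewrite bc eqxx in ncb.
rewrite adj_connect_sym; apply: step => //.
apply: contraNneq no => /set2_inj[[ac _]|[_ ->//]].
by rewrite ac eqxx in na.
Qed.

(** The fallback on the bad event: whatever the lengths, a tree misses an edge of each four-cycle,
    and missing edges from different blocks are disjoint, so all can be inserted. *)
Lemma four_cycles_far_tree T : spanning_tree E T ->
  exists T', spanning_tree E T' /\ (#|B| <= #|T' :\: T|)%N.
Proof.
move=> ST.
have hex i : exists e, [&& e \in E, e \notin T & [forall w in e, blk w == Some i]].
  have [e [eE eT eb]] := four_cycle_missing_edge i ST; exists e; rewrite eE eT /=.
  by apply/forall_inP => w /eb ->.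
pose s i := xchoose (hex i).
have sP i : [/\ s i \in E, s i \notin T & {in s i, forall w, blk w = Some i}].
  have /and3P[-> -> /forall_inP h] := xchooseP (hex i).
  by split => // w /h/eqP.
have s_inj : injective s.
  move=> i j sij; have [si _ hi] := sP i; have [_ _ hj] := sP j.
  have /cards2P[u [v [_ E']]] : #|s i| == 2 by rewrite E2.
  have ui : u \in s i by rewrite E' !finset.inE eqxx.
  have := hi _ ui; rewrite (hj u); first by case.
  by rewrite -sij.
have [||e f /imsetP[i _ ->] /imsetP[j _ ->] ne|T' [ST' ST0 _]] :=
    @spanning_tree_insert _ E T [set s i | i : B] E2 ST.
- by apply/fintype.subsetP => e /imsetP[i _ ->]; have [] := sP i.
- by move=> e /imsetP[i _ ->]; have [] := sP i.
- rewrite -setI_eq0; apply/eqP/setP => w; rewrite !finset.inE.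
  apply/negP => /andP[wi wj]; have [_ _ hi] := sP i; have [_ _ hj] := sP j.
  by have := hi _ wi; rewrite hj // => -[ij]; rewrite ij eqxx in ne.
exists T'; split => //.
by rewrite -(card_imset _ s_inj); apply: subset_leq_card.
Qed.

Section Labels.
Variable K : nat.
Implicit Types (v : {ffun {set V} -> 'I_K.+2}).

(* Label 0 stands for lengths below [q1], label [K.+1] for lengths at least [q2],
   and the labels in between for a partition of [q1, q2) into [K] bins. *)
Definition good_cell v i : bool :=
  [&& v [set a i; o i] == ord0, v [set b i; o i] == ord0,
      v [set c i; a i] == v [set c i; b i], (0 < v [set c i; a i] <= K)%N &
      [forall e in E, (c i \in e) && (e != [set c i; a i]) && (e != [set c i; b i]) ==>
         (v e == ord_max)]].

Definition num_good v : nat := #|[set i | good_cell v i]|.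

(** All edges at [c i] stay in block [i], so one label influences at most one cell; this is the
    source of the bounded differences in [num_good_upd]. *)
Lemma good_cell_local v1 v2 i :
  (forall e, e \in E -> {in e, forall w, blk w = Some i} -> v1 e = v2 e) ->
  good_cell v1 i = good_cell v2 i.
Proof.
move=> h.
have in2 (u w : V) : blk u = Some i -> blk w = Some i -> {in [set u; w], forall z, blk z = Some i}.
  by move=> hu hv z; rewrite !finset.inE => /orP[]/eqP->.
have ba := fc_blk_a i; have bb := fc_blk_b FC i; have bc := fc_blk_c FC i; have bo := fc_blk_o FC i.
rewrite /good_cell (h _ (fc_ao FC i) (in2 _ _ ba bo)) (h _ (fc_bo FC i) (in2 _ _ bb bo)).
rewrite (h _ (fc_ca FC i) (in2 _ _ bc ba)) (h _ (fc_cb FC i) (in2 _ _ bc bb)).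
do 4!congr (_ && _); apply: eq_forallb => e; case eE: (e \in E) => //=.
case ce: (c i \in e) => //=; congr (_ ==> (_ == _)); apply: h => //.
have /cards2P[u [w [nuw eE']]] : #|e| == 2 by rewrite E2.
move: ce eE; rewrite eE' !finset.inE => /orP[]/eqP<- eE; apply: in2 => //.
  exact: fc_nbr eE.
by rewrite finset.setUC in eE; exact: fc_nbr eE.
Qed.

Lemma num_good_upd v e s t : (num_good (upd v e s) <= (num_good (upd v e t)) + (e \in E))%N.
Proof.
have same i : ~~ ((e \in E) && [forall w in e, blk w == Some i]) ->
    good_cell (upd v e s) i = good_cell (upd v e t) i.
  move=> he; apply: good_cell_local => f fE hf.
  suff fe : f != e by rewrite !upd_ne.
  apply: contraNneq he => <-; rewrite fE; apply/forall_inP => w wf.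
  exact/eqP/hf.
have all_same : (forall i, ~~ ((e \in E) && [forall w in e, blk w == Some i])) ->
    num_good (upd v e s) = num_good (upd v e t).
  move=> h; have hg : good_cell (upd v e s) =1 good_cell (upd v e t).
    by move=> i; apply: same; exact: h.
  exact: (congr1 (fun A : {set B} => #|A|) (eq_finset _ hg)).
have [eE|eE] := boolP (e \in E); last first.
  by rewrite addn0 all_same; [exact: leqnn|move=> i; rewrite (negbTE eE)].
rewrite addn1.
have /cards2P[u [w [nuw eE']]] : #|e| == 2 by rewrite E2.
have ue : u \in e by rewrite eE' !finset.inE eqxx.
case bu : (blk u) => [i0|]; last first.
  rewrite all_same; first exact: leqnSn.
  by move=> i; rewrite eE /=; apply/negP => /forall_inP/(_ _ ue); rewrite bu.
have hd i : i != i0 -> good_cell (upd v e s) i = good_cell (upd v e t) i.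
  move=> ii0; apply: same; rewrite eE /=; apply/negP => /forall_inP/(_ _ ue).
  by rewrite bu => /eqP[ii]; rewrite ii eqxx in ii0.
exact: (card_set_diff_le1 hd).
Qed.

End Labels.
End Cells.

(** * Upper bound for independent edge lengths *)

Section UpperBound.
Context {d : measure_display} {Omega : measurableType d} {R : realType}.
Variables (P : probability Omega R) (V B : finType) (E : {set {set V}}).
Variables (c a b o : B -> V) (blk : V -> option B).
Variables (L : {set V} -> Omega -> R) (nu : set R -> \bar R) (q1 q2 D delta eta : R).
Variables (Delta K K0 : nat).
Hypothesis E2 : forall e, e \in E -> #|e| = 2.
Hypothesis Econn : forall u v, connect (adj E) u v.
Hypothesis FC : four_cycles E c a b o blk.
Hypothesis mL : forall e, e \in E -> measurable_fun setT (L e).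
Hypothesis indep : mutually_independent P E L.
Hypothesis law : forall e, e \in E -> forall A : set R, measurable A ->
  P (L e @^-1` A)%classic = nu A.
Hypothesis q12 : q1 < q2.
Hypothesis K_gt0 : (0 < K)%N.
Local Open Scope classical_set_scope.
Hypothesis nu1 : ((8^-1)%:E <= nu `]-oo, q1[)%E.
Hypothesis nu2 : ((8^-1)%:E <= nu `[q1, q2[)%E.
Hypothesis nu3 : ((8^-1)%:E <= nu `[q2, +oo[)%E.
Local Close Scope classical_set_scope.
Hypothesis degree : forall i, (#|[set e in E | c i \in e]| <= Delta)%N.

Let x := (q2 - q1) / K%:R.
(** The origin [q1 - x] gives labels the meaning used in [good_cell]: bin 0 ends at [q1] and the
    last bin starts at [q2]. *)
Let lab := bin (q1 - x) x K.+1.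
Let p := label_law P E L lab ord0.
Let pi (s : 'I_K.+2) := fine (nu [set t | lab t = s]%classic).

Let x0 : 0 < x.
Proof. by rewrite divr_gt0 ?ltr0n // subr_gt0. Qed.

Let q2E : q1 - x + K.+1%:R * x = q2.
Proof. rewrite -natr1 /x; field; by rewrite pnatr_eq0 -lt0n. Qed.

Let mlab s : measurable [set t | lab t = s]%classic.
Proof. exact: measurable_bin. Qed.

Let p0 e s : 0 <= p e s.
Proof. exact: label_law_ge0. Qed.

Let p1 e : \sum_s p e s = 1.
Proof. exact: sum_label_law. Qed.

Let pE e s : e \in E -> p e s = pi s.
Proof. by move=> eE; rewrite /p /label_law eE /pi -(law eE). Qed.

Let piE e s : e \in E -> (pi s)%:E = nu [set t | lab t = s]%classic.
Proof.
by move=> eE; rewrite -(pE _ eE) -(law eE) // /p label_lawE.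
Qed.

Let pi_low e : e \in E -> 8^-1 <= pi ord0.
Proof.
move=> eE; rewrite -lee_fin (piE _ eE); apply: le_trans nu1 _.
rewrite le_eqVlt; apply/orP; left; apply/eqP; congr (nu _).
apply/seteqP; split => t; rewrite /= in_itv /=.
  move=> tq; apply/val_inj/eqP => /=; rewrite -leqn0 leqNgt /lab bin_gt // mul1r subrK.
  by rewrite -ltNge.
move=> t0; have : ~~ (0 < lab t)%N by rewrite t0.
by rewrite /lab bin_gt // mul1r subrK -ltNge.
Qed.

Let pi_high e : e \in E -> 8^-1 <= pi ord_max.
Proof.
move=> eE; rewrite -lee_fin (piE _ eE); apply: le_trans nu3 _.
rewrite le_eqVlt; apply/orP; left; apply/eqP; congr (nu _).
apply/seteqP; split => t; rewrite /= in_itv /= andbT -{1}q2E.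
  move=> tq; apply/val_inj/eqP => /=; rewrite eqn_leq -ltnS ltn_ord /=.
  by rewrite /lab bin_ge.
by move=> t0; rewrite -(@bin_ge _ _ _ K.+1) // -/(lab t) t0 /=.
Qed.

Let pi_mid e : e \in E -> 8^-1 <= \sum_(s : 'I_K.+2 | (0 < s <= K)%N) pi s.
Proof.
move=> eE; rewrite -lee_fin; apply: le_trans nu2 _.
rewrite -(law eE); last exact: measurable_itv.
rewrite -sumEFin; under eq_bigr do rewrite (piE _ eE) -(law eE) //.
have [_ <-] := finite_range_event P (Y := fun w => lab (L e w)) (fun s : 'I_K.+2 => (0 < s <= K)%N)
  (fun s => measurable_label_eq mL mlab s eE).
rewrite le_eqVlt; apply/orP; left; apply/eqP; congr (P _).
apply/seteqP; split => w; rewrite /= in_itv /= -{1}q2E /lab.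
  by move=> /andP[h1 h2]; rewrite bin_gt // mul1r subrK h1 /= leqNgt bin_gt // -ltNge.
rewrite bin_gt // mul1r subrK => /andP[-> h2]; move: h2.
by rewrite leqNgt bin_gt // -ltNge.
Qed.

Let sum_delta (F : 'I_K.+2 -> R) k : \sum_s F s * (s == k)%:R = F k.
Proof.
rewrite (bigD1 k) //= eqxx mulr1 big1 ?addr0 // => s /negbTE ->; by rewrite mulr0.
Qed.

(** [Delta] of the factors [8^-1] pay for the edges at [c i] and two for the edges at [o i]. The
    last two, with [1 / K], come from Cauchy-Schwarz over the [K] middle labels: the squares
    [pi k ^+ 2] sum to at least [8^-1 ^+ 2 / K]. *)
Lemma Ew_good_cell i :
  8^-1 ^+ (Delta + 4) / K%:R <= Ew p (fun v => (good_cell E c a b o v i)%:R).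
Proof.
have caE := fc_ca FC i; have cbE := fc_cb FC i; have aoE := fc_ao FC i; have boE := fc_bo FC i.
set ca := [set c i; a i] in caE; set cb := [set c i; b i] in cbE.
set ao := [set a i; o i] in aoE; set bo := [set b i; o i] in boE.
have nca := fc_neq_ca E2 FC i; have ncb := fc_neq_cb E2 FC i.
have nco := fc_neq_co FC i; have nab := fc_neq_ab FC i.
have c_ca : c i \in ca by rewrite !finset.inE eqxx.
have c_cb : c i \in cb by rewrite !finset.inE eqxx.
have c_ao : c i \notin ao by rewrite !finset.inE negb_or nca.
have c_bo : c i \notin bo by rewrite !finset.inE negb_or ncb.
have ca_ao : ca != ao by apply: contraNneq c_ao => <-.
have ca_bo : ca != bo by apply: contraNneq c_bo => <-.
have cb_ao : cb != ao by apply: contraNneq c_ao => <-.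
have cb_bo : cb != bo by apply: contraNneq c_bo => <-.
have ca_cb : ca != cb.
  apply: contraNneq nab => /set2_inj[[_ ->//]|[cb' _]]; by rewrite -cb' eqxx in ncb.
(* For fixed [k], conditions on single edges whose product forces the cell to be good with common
   label [k]; a product is what [Ew_prod] evaluates. *)
pose h (k : 'I_K.+2) e (s : 'I_K.+2) : R :=
  if (e == ao) || (e == bo) then (s == ord0)%:R
  else if (e == ca) || (e == cb) then (s == k)%:R
  else if (e \in E) && (c i \in e) then (s == ord_max)%:R else 1.
have h01 k e s : 0 <= h k e s <= 1.
  by rewrite /h; do ?[case: ifP => _]; rewrite ?ler0n ?lern1 ?leq_b1 ?ler01 ?lexx.
have hgood (k : 'I_K.+2) (v : {ffun {set V} -> 'I_K.+2}) : (0 < k <= K)%N ->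
    \prod_e h k e (v e) <= (good_cell E c a b o v i && (v ca == k))%:R.
  move=> kK.
  have [/forallP hv|/forallPn[e]] := boolP [forall e, h k e (v e) != 0]; last first.
    by rewrite negbK => /eqP he; rewrite (bigD1 e) //= he mul0r.
  have -> : good_cell E c a b o v i && (v ca == k).
    have vao : v ao == ord0.
      by have := hv ao; rewrite /h eqxx /=; case: (v ao == _) => //=; rewrite eqxx.
    have vbo : v bo == ord0.
      by have := hv bo; rewrite /h eqxx orbT /=; case: (v bo == _) => //=; rewrite eqxx.
    have vca : v ca == k.
      have := hv ca; rewrite /h (negbTE ca_ao) (negbTE ca_bo) eqxx /=.
      by case: (v ca == _) => //=; rewrite eqxx.
    have vcb : v cb == k.
      have := hv cb; rewrite /h (negbTE cb_ao) (negbTE cb_bo) eqxx orbT /=.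
      by case: (v cb == _) => //=; rewrite eqxx.
    rewrite /good_cell vao vbo vca (eqP vca) (eqP vcb) eqxx kK /= andbT.
    apply/forall_inP => e eE; apply/implyP => /andP[/andP[ce eca] ecb].
    have := hv e; rewrite /h (negbTE eca) (negbTE ecb) eE ce /=.
    have [eo|_] := eqVneq e ao; first by rewrite eo (negbTE c_ao) in ce.
    have [eo|_] := eqVneq e bo; first by rewrite eo (negbTE c_bo) in ce.
    by rewrite /=; case: (v e == _) => //=; rewrite eqxx.
  by apply: prodr_ile1 => e _; exact: h01.
apply: (@le_trans _ _ (Ew p (fun v => \sum_(k : 'I_K.+2 | (0 < k <= K)%N) \prod_e h k e (v e)))); last first.
  apply: ler_Ew => // v.
  apply: (@le_trans _ _ (\sum_(k : 'I_K.+2 | (0 < k <= K)%N)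
      (good_cell E c a b o v i && (v ca == k))%:R)).
    by apply: ler_sum => k; exact: hgood.
  case: (good_cell _ _ _ _ _ v i) => /=; last by rewrite big1.
  rewrite -natr_sum ler_nat; apply: (@leq_trans (\sum_(k : 'I_K.+2) (v ca == k))).
    by rewrite [leqRHS](bigID (fun k : 'I_K.+2 => (0 < k <= K)%N)) /= leq_addr.
  by rewrite (bigD1 (v ca)) //= eqxx big1 // => k; rewrite eq_sym => /negbTE ->.
rewrite Ew_sum.
apply: (@le_trans _ _ (\sum_(k : 'I_K.+2 | (0 < k <= K)%N) pi k ^+ 2 * 8^-1 ^+ (Delta + 2))).
  rewrite -mulr_suml ler_pdivrMr ?ltr0n // [leLHS](_ : _ = 8^-1 ^+ 2 * 8^-1 ^+ (Delta + 2)); last first.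
    by rewrite -exprD addnCA.
  rewrite [leRHS]mulrAC ler_pM2r ?exprn_gt0 //.
  have h8 := pi_mid caE.
  have := sum_sqr_ge [pred k : 'I_K.+2 | (0 < k <= K)%N] pi.
  have cK : (#|[pred k : 'I_K.+2 | (0 < k <= K)%N]| <= K)%N.
    have cK : #|~: [set (ord0 : 'I_K.+2); ord_max]| = K.
      by apply/eqP; rewrite -(eqn_add2l 2) -{1}(cards2 (ord0 : 'I_K.+2) ord_max) cardsC card_ord.
    rewrite -[leqRHS]cK; apply: subset_leq_card; apply/fintype.subsetP => k.
    rewrite !finset.inE => /andP[k0 kK].
    rewrite negb_or -!val_eqE /= -lt0n k0 /=; by rewrite neq_ltn ltnS kK.
  rewrite /= => hs; rewrite mulrC; apply: le_trans (le_trans hs _); last first.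
    by apply: ler_wpM2r; [apply: sumr_ge0 => k _; exact: sqr_ge0|rewrite ler_nat].
  by rewrite lerXn2r // ?nnegrE // (le_trans _ h8).
apply: ler_sum => k kK; rewrite Ew_prod.
pose Q e := (e \in E) && (c i \in e) || (e == ao) || (e == bo).
pose r e := if (e == ca) || (e == cb) then pi k else if Q e then 8^-1 else 1.
have pik0 : 0 <= pi k by rewrite -(pE k caE).
apply: (@le_trans _ _ (\prod_e r e)); last first.
  apply: ler_prod => e _; apply/andP; split.
    by rewrite /r; do ?[case: ifP => _].
  rewrite /r /h /Q.
  have [->|nca'] := eqVneq e ca.
    by rewrite (negbTE ca_ao) (negbTE ca_bo) /= sum_delta pE.
  have [->|ncb'] := eqVneq e cb.
    by rewrite (negbTE cb_ao) (negbTE cb_bo) /= sum_delta pE.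
  have [->|nao'] := eqVneq e ao.
    rewrite orbT /= sum_delta pE //; exact: pi_low aoE.
  have [->|nbo'] := eqVneq e bo.
    rewrite orbT /= sum_delta pE //; exact: pi_low boE.
  rewrite /= !orbF; case: ifP => [/andP[eE _]|_].
    rewrite sum_delta pE //; exact: pi_high eE.
  by under eq_bigr do rewrite mulr1; rewrite p1.
rewrite (bigD1 ca) //= (bigD1 cb) //=; last by rewrite eq_sym.
rewrite {1 2}/r !eqxx orbT /= mulrA -expr2; apply: ler_wpM2l; first exact: sqr_ge0.
rewrite (eq_bigr (fun e => if Q e then 8^-1 else 1)); last first.
  by move=> e /andP[h1 h2]; rewrite /r (negbTE h1) (negbTE h2).
rewrite -big_mkcondr /= prodr_const.
apply: ler_wiXn2l => //; first by rewrite invf_le1 ?ler1n.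
apply: (@leq_trans #|[set e in E | c i \in e] :|: [set ao; bo]|).
  apply: subset_leq_card; apply/fintype.subsetP => e; rewrite !finset.inE.
  by rewrite !unfold_in /Q -orbA => /andP[_].
apply: leq_trans (leq_card_setU _ _) _; apply: leq_add; first exact: degree.
by rewrite cards2; case: (_ != _).
Qed.

Hypothesis delta_gt0 : 0 < delta.
Hypothesis D_ge0 : 0 <= D.
Hypothesis eta_ge0 : 0 <= eta.
Hypothesis ED : #|E|%:R <= D * #|V|%:R.
Hypothesis dV : 1 <= delta * #|V|%:R.
Hypothesis dB : 4 * delta * #|V|%:R <= #|B|%:R * (8^-1 ^+ (Delta + 4) / K%:R).
Hypothesis Lneg : forall e, e \in E -> P [set w | L e w < 0]%classic = 0%E.
Hypothesis Ltail : forall e, e \in E ->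
  (\int[P]_w (L e w * \1_(L e @^-1` [set t | K0%:R <= t]) w)%:E <= eta%:E)%E.

Let F (v : {ffun {set V} -> 'I_K.+2}) : R := (num_good E c a b o v)%:R.
Let Fbad := [pred v : {ffun {set V} -> 'I_K.+2} | F v <= Ew p F - 2 * delta * #|V|%:R].

Let V0 : 0 < #|V|%:R :> R.
Proof. by have := lt_le_trans ltr01 dV; rewrite pmulr_rgt0. Qed.

Let EF_ge : 4 * delta * #|V|%:R <= Ew p F.
Proof.
apply: le_trans dB _.
have -> : Ew p F = \sum_i Ew p (fun v => (good_cell E c a b o v i)%:R).
  rewrite -Ew_sum; apply: eq_Ew => v; rewrite /F /num_good -sum1dep_card natr_sum.
  by rewrite big_mkcond /=; apply: eq_bigr => i _; case: good_cell.
rewrite mulr_natl -sumr_const; apply: ler_sum => i _; exact: Ew_good_cell.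
Qed.

(** A label change on an edge of [E] moves the count by at most one, so the squared bounds sum to
    [#|E| <= D n], against a deviation of [2 delta n]. *)
Let prob_bad : Ew p (fun v => (Fbad v)%:R) <= D / (4 * delta ^+ 2 * #|V|%:R).
Proof.
have dn0 : 0 < 2 * delta * #|V|%:R by rewrite !mulr_gt0.
apply: le_trans (Ew_chebyshev p0 p1 (c := fun e => (e \in E)%:R) _ dn0) _.
  move=> e v s t; have h1 := num_good_upd E2 FC v e s t; have h2 := num_good_upd E2 FC v e t s.
  have {}h1 : F (upd v e s) <= F (upd v e t) + (e \in E)%:R.
    rewrite /F -natrD ler_nat; exact: h1.
  have {}h2 : F (upd v e t) <= F (upd v e s) + (e \in E)%:R.
    rewrite /F -natrD ler_nat; exact: h2.
  move: h1 h2; move: (F _) (F _) => F1 F2 h1 h2.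
  by rewrite ler_norml; apply/andP; split; lra.
have -> : \sum_e ((e \in E)%:R : R) ^+ 2 = #|E|%:R.
  rewrite -sum1_card natr_sum [RHS]big_mkcond /=; apply: eq_bigr => e _.
  by case: (e \in E); rewrite ?expr1n ?expr0n.
rewrite ler_pdivrMr ?exprn_gt0 //; apply: le_trans ED _.
rewrite le_eqVlt; apply/orP; left; apply/eqP; field.
by rewrite !gt_eqF.
Qed.

Let eps_good w : ~~ Fbad (labels E L lab ord0 w) ->
  (eps E (fun e => L e w) delta <= (2 * delta * x)%:E)%E.
Proof.
rewrite /= -ltNge; set v := labels E L lab ord0 w => Fv.
have Fv2 : 2 * delta * #|V|%:R < F v by apply: le_lt_trans Fv; have := EF_ge; lra.
(* More than [2 delta n] cells are good, but only [k] of them, between [delta n] and [2 delta n],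
   are exchanged, so that the cost stays of order [delta n x]; [dV] makes room for rounding up. *)
pose k := (Num.truncn (delta * #|V|%:R)).+1.
have dk : delta * #|V|%:R <= k%:R by rewrite ltW // Num.Theory.truncnS_gt.
have kd : k%:R <= 2 * delta * #|V|%:R.
  have : (Num.truncn (delta * #|V|%:R))%:R <= delta * #|V|%:R.
    by rewrite Num.Theory.truncn_le (le_trans ler01).
  rewrite /k -natr1; have := dV; lra.
have kF : (k <= #|[set i | good_cell E c a b o v i]|)%N.
  by rewrite -(ler_nat R); apply: ltW; apply: le_lt_trans Fv2.
have [C0 C0g C0k] := subset_of_card kF.
have c_inj : injective c.
  by move=> i j cij; have := fc_blk_c FC i; rewrite cij (fc_blk_c FC j) => -[].
(* [mst_swap_near_ties] takes maps on vertices; away from the centres their value is arbitrary. *)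
pose idx (u : V) : option B := [pick i | c i == u].
have idxc i : idx (c i) = Some i.
  by rewrite /idx; case: pickP => [j /eqP/c_inj ->//|/(_ i)]; rewrite eqxx.
pose a' u := if idx u is Some i then a i else u.
pose b' u := if idx u is Some i then b i else u.
have ac i : a' (c i) = a i by rewrite /a' idxc.
have bc i : b' (c i) = b i by rewrite /b' idxc.
pose C := [set c i | i in C0].
have CP u : u \in C -> exists2 i, u = c i & good_cell E c a b o v i.
  by move=> /imsetP[i iC0 ->]; exists i => //; have := fintype.subsetP C0g i iC0; rewrite finset.inE.
have nC i u : blk u = Some i -> u != c i -> u \notin C.
  move=> bu uc; apply/negP => /CP[j uE _]; move: bu uc; rewrite uE (fc_blk_c FC) => -[->].
  by rewrite eqxx.
have vE e : e \in E -> v e = lab (L e w) by move=> eE; rewrite /v ffunE eE.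
have K2 : (bin (q1 - x) x K.+1 = lab) by [].
have lab_low e : e \in E -> v e = ord0 -> L e w < q1.
  move=> eE v0; have := vE _ eE; rewrite v0 => l0.
  have : ~~ (0 < lab (L e w))%N by rewrite -l0.
  by rewrite /lab bin_gt // mul1r subrK -ltNge.
have lab_mid e : e \in E -> (0 < v e <= K)%N ->
   q1 + ((v e)%:R - 1) * x <= L e w < q1 + (v e)%:R * x.
  move=> eE; rewrite vE // => /andP[h1 h2].
  have := bin_lower x0 h1; have := @bin_lt_upper _ (q1 - x) x K.+1 (L e w) x0.
  rewrite K2 ltnS h2 => /(_ isT); rewrite -natr1 => h3 h4.
  by apply/andP; split; lra.
have lab_top e : e \in E -> v e = ord_max -> q2 <= L e w.
  move=> eE vm; rewrite -q2E -(@bin_ge _ _ _ K.+1) // -/(lab (L e w)) -vE // vm.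
  exact: leqnn.
have mid12 e : e \in E -> (0 < v e <= K)%N -> q1 <= L e w < q2.
  move=> eE vK; have /andP[h1 h2] := lab_mid e eE vK.
  move/andP: vK => [v1 v2].
  have h3 : 1 <= (v e)%:R :> R by rewrite ler1n.
  have h4 : (v e)%:R <= K%:R :> R by rewrite ler_nat.
  apply/andP; split.
    by apply: (le_trans _ h1); rewrite lerDl; apply: mulr_ge0; [rewrite subr_ge0|exact: ltW].
  apply: (lt_le_trans h2); have -> : q2 = q1 + K%:R * x.
    by rewrite /x mulrC divfK ?pnatr_eq0 -?lt0n //; ring.
  by rewrite lerD2l ler_wpM2r // ltW.
have [T0 ST0] := spanning_tree_exists E2 Econn.
have mT := mst_spanning (fun e => L e w) ST0.
have [||||||T' [ST' CT' lT']] := @mst_swap_near_ties _ _ E (fun e => L e w) _ C a' b' q1 q2 x mT.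
- move=> _ /CP[i -> gi]; rewrite ac bc; split; [exact: (fc_ca FC i)|exact: (fc_cb FC i)| |].
    exact: (fc_neq_ca E2 FC i).
  exact: (fc_neq_cb E2 FC i).
- move=> _ /CP[i -> gi]; rewrite ac bc; split; first exact: (fc_neq_ab FC i).
    by apply: (nC i); [exact: (fc_blk_a FC)|rewrite eq_sym; exact: (fc_neq_ca E2 FC i)].
  by apply: (nC i); [exact: (fc_blk_b FC)|rewrite eq_sym; exact: (fc_neq_cb E2 FC i)].
- move=> _ /CP[i -> /and5P[_ _ /eqP vab vK _]]; rewrite ac bc; split; apply: mid12 => //.
  + exact: (fc_ca FC i).
  + exact: (fc_cb FC i).
  + by rewrite -vab.
- move=> _ /CP[i -> /and5P[_ _ /eqP vab vK _]]; rewrite ac bc.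
  have /andP[h1 h2] := lab_mid _ (fc_ca FC i) vK.
  rewrite vab in vK h1 h2; have /andP[h3 h4] := lab_mid _ (fc_cb FC i) vK.
  by rewrite ler_norml; apply/andP; split; lra.
- move=> _ /CP[i -> /and5P[/eqP vao /eqP vbo _ _ _]]; rewrite ac bc.
  apply: (@connect_trans _ _ (o i)).
    by apply: connect1; rewrite /adj finset.inE (fc_ao FC) /= lab_low // (fc_ao FC).
  rewrite adj_connect_sym.
  by apply: connect1; rewrite /adj finset.inE (fc_bo FC) /= lab_low // (fc_bo FC).
- move=> _ /CP[i -> /and5P[_ _ _ _ /forall_inP hE]] u uE; rewrite ac bc => ua ub.
  apply: lab_top => //; apply/eqP; have := hE _ uE; rewrite !finset.inE eqxx /=.
  move/implyP; apply; apply/andP; split.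
    apply: contra_neq ua => /set2_inj[[_ //]|[h1 h2]]; by rewrite h2 -h1.
  apply: contra_neq ub => /set2_inj[[_ //]|[h1 h2]]; by rewrite h2 -h1.
have Ck : #|C| = k by rewrite card_imset.
have dT' : delta * #|V|%:R <= #|T' :\: mst E (fun e => L e w)|%:R.
  by apply: (le_trans dk); rewrite ler_nat -Ck.
apply: (le_trans (eps_le ST' dT')).
rewrite lee_fin ler_pdivrMr //.
apply: (@le_trans _ _ (k%:R * x)); first by rewrite -Ck; lra.
by apply: le_trans (ler_wpM2r (ltW x0) kd) _; rewrite le_eqVlt; apply/orP; left; apply/eqP; ring.
Qed.

Let eps_bad w : (forall e, e \in E -> 0 <= L e w) ->
  (eps E (fun e => L e w) delta <= ((\sum_(e in E) L e w) / #|V|%:R)%:E)%E.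
Proof.
move=> L0; have [T0 ST0] := spanning_tree_exists E2 Econn.
have mT := mst_spanning (fun e => L e w) ST0.
have ST : spanning_tree E (mst E (fun e => L e w)) by case/andP: mT.
have [T' [ST' cT']] := four_cycles_far_tree E2 FC ST.
have dT' : delta * #|V|%:R <= #|T' :\: mst E (fun e => L e w)|%:R.
  have dB' : delta * #|V|%:R <= #|B|%:R.
    have : #|B|%:R * (8^-1 ^+ (Delta + 4) / K%:R) <= #|B|%:R :> R.
      rewrite ler_piMr // ler_pdivrMr ?ltr0n // mul1r; apply: (@le_trans _ _ 1).
        by rewrite exprn_ile1 // invf_le1 ?ler1n.
      by rewrite ler1n.
    by have := dB; have := dV; lra.
  by apply: (le_trans dB'); rewrite ler_nat.
apply: (le_trans (eps_le ST' dT')).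
rewrite lee_fin ler_wpM2r ?invr_ge0 //.
have lT : 0 <= len (fun e => L e w) (mst E (fun e => L e w)).
  apply: sumr_ge0 => e eT; apply: L0; have [TE _ _ _] := spanning_treeP _ _ ST.
  exact: fintype.subsetP eT.
have : len (fun e => L e w) T' <= \sum_(e in E) L e w.
  rewrite /len [leRHS](bigID (mem T')) /=.
  have -> : \sum_(e in E | e \in T') L e w = \sum_(e in T') L e w.
    apply: eq_bigl => e; have [TE _ _ _] := spanning_treeP _ _ ST'.
    by case eT: (e \in T'); rewrite ?andbF // (fintype.subsetP TE).
  by rewrite lerDl; apply: sumr_ge0 => e /andP[eE _]; exact: L0.
lra.
Qed.

(** Lengths and the bad event are dependent, so each length is split at [K0]: the part below costs
    at most [K0] times the probability of the event, and the part above is bounded by its tail mean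
    [eta], whatever the event. *)
Lemma expected_eps_le :
  (\int[P]_w eps E (fun e => L e w) delta <=
   (2 * delta * x + D * (K0%:R * (D / (4 * delta ^+ 2 * #|V|%:R)) + eta))%:E)%E.
Proof.
have [mS PS] := labels_event ord0 mL mlab indep Fbad.
set S : set Omega := [set w | Fbad (labels E L lab ord0 w)]%classic in mS PS.
have mneg e : e \in E -> measurable [set w | L e w < 0]%classic.
  move=> eE; have -> : [set w | L e w < 0]%classic = (setT `&` L e @^-1` [set` Interval -oo%O (BLeft 0)])%classic.
    by rewrite setTI; apply/seteqP; split => w; rewrite /= in_itv.
  exact: mL.
have mtop e : e \in E -> measurable (L e @^-1` [set t | K0%:R <= t])%classic.
  move=> eE; have -> : (L e @^-1` [set t | K0%:R <= t] = setT `&` L e @^-1` [set` Interval (BLeft K0%:R) +oo%O])%classic.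
    by rewrite setTI; apply/seteqP; split => w; rewrite /= in_itv /= andbT.
  exact: mL.
have [mN PN] := finite_null_union mneg Lneg.
set N := (\bigcup_(e in _) _)%classic in mN PN.
pose T e w : R := if e \in E then L e w * \1_(L e @^-1` [set t | K0%:R <= t]%classic) w else 0.
have T0 e w : 0 <= T e w.
  rewrite /T; case: ifP => // _; rewrite indicE.
  case: (boolP (_ \in _)) => [|_]; last by rewrite mulr0.
  by rewrite in_setE /= mulr1; exact: le_trans.
pose g e (w : Omega) : R := #|V|%:R^-1 * (K0%:R * \1_S w + T e w).
have g0 e w : 0 <= g e w by rewrite mulr_ge0 ?invr_ge0 // addr_ge0 // mulr_ge0.
have mT e : measurable_fun setT (T e).
  rewrite /T; case: (boolP (e \in E)) => [eE|_]; last exact: measurable_cst.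
  by apply: measurable_funM; [exact: mL|exact: measurable_indic (mtop _ eE)].
have mSR : measurable_fun setT (\1_S : Omega -> R) by exact: measurable_indic.
have mg e : measurable_fun setT (g e).
  apply: measurable_funM => //; apply: measurable_funD; last exact: mT.
  exact: measurable_funM.
have y0 : 0 <= 2 * delta * x.
  by apply: mulr_ge0; [apply: mulr_ge0 => //; exact: ltW|exact: ltW].
pose h w : \bar R := (2 * delta * x + \sum_(e in E) g e w)%:E.
have mh : measurable_fun setT h.
  apply/measurable_EFinP; apply: measurable_funD => //.
  by under eq_fun do rewrite -big_enum; exact: measurable_sum.
apply: le_trans (ge0_integral_ae_mono mN PN (fun w => eps_ge0 _ _ _) (h := h) _ mh _) _.
- by move=> w; rewrite lee_fin addr_ge0 // sumr_ge0.
- move=> w Nw.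
  have L0 e : e \in E -> 0 <= L e w.
    by move=> eE; rewrite leNgt; apply/negP => l0; apply: Nw; exists e.
  case: (boolP (Fbad (labels E L lab ord0 w))) => [bad|/eps_good good].
    apply: le_trans (eps_bad L0) _; rewrite lee_fin -[leLHS]add0r lerD //.
    rewrite mulrC mulr_sumr; apply: ler_sum => e eE; rewrite /g ler_wpM2l ?invr_ge0 //.
    rewrite indicE mem_set // mulr1 /T eE indicE.
    case: (boolP (_ \in _)) => [_|]; first by rewrite mulr1 lerDr.
    rewrite mulr0 addr0 notin_setE /= => /negP; rewrite -ltNge; exact: ltW.
  by apply: le_trans good _; rewrite lee_fin lerDl sumr_ge0.
have -> : (\int[P]_w h w = (2 * delta * x)%:E + \sum_(e in E) \int[P]_w (g e w)%:E)%E.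
  under eq_integral => w _ do rewrite /h EFinD -sumEFin.
  rewrite ge0_integralD //; first last.
  - by under eq_fun do rewrite -big_enum; apply: emeasurable_sum => e; exact/measurable_EFinP.
  - by move=> w _; apply: sume_ge0 => e _; rewrite lee_fin.
  congr (_ + _)%E; first by rewrite integral_cst // [X in (_ * X)%E]probability_setT mule1.
  under eq_integral => w _ do rewrite -big_enum.
  rewrite ge0_integral_sum //; first by rewrite big_enum.
  - by move=> e; exact/measurable_EFinP.
  by move=> e w _; rewrite lee_fin.
have ig e : e \in E -> (\int[P]_w (g e w)%:E <=
    (#|V|%:R^-1 * (K0%:R * (D / (4 * delta ^+ 2 * #|V|%:R)) + eta))%:E)%E.
  move=> eE; rewrite /g; under eq_integral do rewrite EFinM.
  rewrite ge0_integralZl_EFin ?invr_ge0 //; first last.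
  - by apply/measurable_EFinP; apply: measurable_funD => //; exact: measurable_funM.
  - by move=> w _; rewrite lee_fin addr_ge0 // mulr_ge0.
  rewrite EFinM lee_wpmul2l ?lee_fin ?invr_ge0 //.
  under eq_integral do rewrite EFinD.
  have m1 : measurable_fun setT (fun w : Omega => (K0%:R * \1_S w : R)%:E).
    by apply/measurable_EFinP; exact: measurable_funM.
  have m2 : measurable_fun setT (fun w : Omega => (T e w)%:E) by exact/measurable_EFinP.
  have n1 (w : Omega) : setT w -> (0 <= (K0%:R * \1_S w : R)%:E)%E by rewrite lee_fin mulr_ge0.
  have n2 (w : Omega) : setT w -> (0 <= (T e w)%:E)%E by rewrite lee_fin.
  rewrite (ge0_integralD P measurableT n1 m1 n2 m2).
  rewrite EFinD leeD //; last by rewrite /T eE; exact: Ltail.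
  under eq_integral do rewrite EFinM.
  rewrite ge0_integralZl_EFin //; last exact/measurable_EFinP.
  rewrite integral_indic // setIT EFinM lee_wpmul2l ?lee_fin //.
  have PSle : (P S <= (D / (4 * delta ^+ 2 * #|V|%:R))%:E)%E.
    by rewrite PS lee_fin; exact: prob_bad.
  exact: PSle.
rewrite EFinD leeD2l //; apply: le_trans (lee_sum _ ig) _.
rewrite sumEFin lee_fin; set Z := K0%:R * _ + eta.
have Z0 : 0 <= Z.
  apply: addr_ge0 => //; apply: mulr_ge0 => //; apply: divr_ge0 => //.
  by apply: mulr_ge0 => //; apply: mulr_ge0 => //; exact: sqr_ge0.
have -> : \sum_(e in E) #|V|%:R^-1 * Z = #|E|%:R / #|V|%:R * Z.
  by rewrite sumr_const -[LHS]mulr_natl mulrA.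
by apply: ler_wpM2r => //; rewrite ler_pdivrMr.
Qed.

End UpperBound.

(** * Geometry of the lattice *)

Section Lattice.
Variables (d m : nat).
Local Notation V := (lattice_vertex d m).
Implicit Types (u v w : V) (k : 'I_d).

Lemma lattice_adjC u v : lattice_adj u v = lattice_adj v u.
Proof. by rewrite /lattice_adj; congr (_ == _); apply: eq_bigr => k _; rewrite -sqrrN opprB. Qed.

Lemma lattice_adj_irr u : lattice_adj u u = false.
Proof. by rewrite /lattice_adj big1 // => k _; rewrite subrr expr0n. Qed.

Lemma lattice_edgesE u v : ([set u; v] \in lattice_edges d m) = lattice_adj u v.
Proof.
apply/imset2P/idP => [[u' v' _]|uv]; last by exists u v; rewrite ?finset.inE.
rewrite finset.inE => uv /set2_inj[[-> ->]//|[-> ->]]; by rewrite lattice_adjC.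
Qed.

Lemma card_lattice_edge e : e \in lattice_edges d m -> #|e| = 2.
Proof.
move=> /imset2P[u v _]; rewrite finset.inE => uv ->; rewrite cards2.
by have [uv'|//] := eqVneq u v; rewrite uv' lattice_adj_irr in uv.
Qed.

Lemma lattice_adj_near u v k : lattice_adj u v -> (u k <= v k + 1)%N /\ (v k <= u k + 1)%N.
Proof.
rewrite /lattice_adj (bigD1 k) //= => /eqP h.
have h0 : 0 <= \sum_(i < d | i != k) ((u i : nat)%:Z - (v i : nat)%:Z) ^+ 2.
  by apply: sumr_ge0 => i _; exact: sqr_ge0.
by move: h h0; move: (\sum_(i < d | _) _) => S h h0; split; nia.
Qed.

Lemma lattice_adj1 u v k : (forall i, i != k -> u i = v i) -> (v k : nat) = (u k).+1 ->
  lattice_adj u v.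
Proof.
move=> h uv; rewrite /lattice_adj (bigD1 k) //= big1 ?addr0.
  by rewrite uv; apply/eqP; nia.
by move=> i /h ->; rewrite subrr expr0n.
Qed.

(** The displacement to a neighbour is -1, 0 or 1 in each coordinate. *)
Lemma card_lattice_nbr u : (#|[set w | lattice_adj u w]| <= 3 ^ d)%N.
Proof.
pose g w : {ffun 'I_d -> 'I_3} := [ffun k => inord (w k + 1 - u k)].
rewrite -[X in (_ <= X ^ _)%N](card_ord 3) -[X in (_ <= _ ^ X)%N](card_ord d) -card_ffun.
have ginj : {in [set w | lattice_adj u w] &, injective g}.
  move=> w w'; rewrite !finset.inE => uw uw' /ffunP gww; apply/ffunP => k; apply: val_inj => /=.
  have := congr1 (@nat_of_ord 3) (gww k); rewrite !ffunE.
  have [h1 h2] := lattice_adj_near k uw; have [h3 h4] := lattice_adj_near k uw'.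
  by rewrite !inordK; lia.
by rewrite -(card_in_imset ginj); exact: max_card.
Qed.

Lemma card_lattice_edges : (#|lattice_edges d m| <= 3 ^ d * #|{: V}|)%N.
Proof.
have -> : lattice_edges d m = [set [set p.1; p.2] | p in [set p : V * V | lattice_adj p.1 p.2]].
  apply/setP => e; apply/imset2P/imsetP => [[u v _]|[[u v]]].
    by rewrite finset.inE => uv ->; exists (u, v); rewrite ?finset.inE.
  by rewrite finset.inE /= => uv ->; exists u v; rewrite ?finset.inE.
apply: leq_trans (leq_imset_card _ _) _.
rewrite -sum1dep_card -(pair_big_dep xpredT (fun u v => lattice_adj u v) (fun _ _ => 1%N)) /=.
rewrite mulnC -sum_nat_const; apply: leq_sum => u _.
by rewrite sum1dep_card; exact: card_lattice_nbr.
Qed.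

Lemma lattice_degree u : (#|[set e in lattice_edges d m | u \in e]| <= 3 ^ d)%N.
Proof.
apply: leq_trans (card_lattice_nbr u).
apply: leq_trans (leq_imset_card (fun w => [set u; w]) _).
apply: subset_leq_card; apply/fintype.subsetP => e; rewrite !finset.inE => /andP[/imset2P[v w _]].
rewrite finset.inE => vw -> ; rewrite !finset.inE => /orP[]/eqP uE; subst.
  by apply/imsetP; exists w; rewrite ?finset.inE.
by apply/imsetP; exists v; [rewrite finset.inE lattice_adjC|rewrite finset.setUC].
Qed.

(** Lowering positive coordinates by one leads every vertex to the origin. *)
Lemma lattice_connected u v : connect (adj (lattice_edges d m)) u v.
Proof.
have H (n : nat) (w z : V) : (\sum_k (w k : nat) <= n)%N -> (forall k, (z k : nat) = 0%N) ->
    connect (adj (lattice_edges d m)) w z.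
  elim: n w => [|n ih] w hw hz.
    have -> : w = z.
      apply/ffunP => k; apply: val_inj => /=; rewrite hz.
      by move: hw; rewrite (bigD1 k) //=; lia.
    exact: connect0.
  have [/forallP w0|/forallPn[k wk]] := boolP [forall k, (w k : nat) == 0%N].
    by apply: ih => //; rewrite big1 // => k _; exact/eqP.
  pose w' : V := [ffun i => if i == k then Ordinal (leq_ltn_trans (leq_pred (w k)) (ltn_ord (w k))) else w i].
  have w'w : lattice_adj w' w.
    apply: (@lattice_adj1 _ _ k) => [i ik|]; first by rewrite ffunE (negbTE ik).
    by rewrite ffunE eqxx /= prednK // lt0n.
  apply: (@connect_trans _ _ w').
    by apply: connect1; rewrite /adj lattice_edgesE lattice_adjC.
  apply: ih => //; rewrite -ltnS; apply: leq_trans hw.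
  rewrite [X in (_ < X)%N](bigD1 k) //= (bigD1 k) //= ffunE eqxx /=.
  have -> : (\sum_(i < d | i != k) w' i = \sum_(i < d | i != k) w i)%N.
    by apply: eq_bigr => i ik; rewrite ffunE (negbTE ik).
  by rewrite -addSn prednK // lt0n.
have Hz (k : 'I_d) : (0 < m)%N by exact: leq_ltn_trans (leq0n (u k)) (ltn_ord (u k)).
pose z : V := [ffun k => Ordinal (Hz k)].
have hz k : (z k : nat) = 0%N by rewrite ffunE.
apply: (connect_trans (H _ u z (leqnn _) hz)).
by rewrite adj_connect_sym; exact: (H _ v z (leqnn _) hz).
Qed.

Let B := {ffun 'I_d -> 'I_(m %/ 3)}.

Lemma block_ltn (q : 'I_(m %/ 3)) (t : 'I_3) : (3 * q + t < m)%N.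
Proof. by have := ltn_ord q; have := ltn_ord t; lia. Qed.

Definition block_point (t : 'I_d -> 'I_3) (i : B) : V :=
  [ffun k => Ordinal (block_ltn (i k) (t k))].

Definition block_of (u : V) : option B := [pick i : B | [forall k, (u k %/ 3)%N == i k]].

Lemma block_ofE u (i : B) : (forall k, (u k %/ 3)%N = i k) -> block_of u = Some i.
Proof.
move=> ui; rewrite /block_of; case: pickP => [j /forallP uj|/(_ i)/forallP[k]]; last first.
  exact/eqP.
by congr Some; apply/ffunP => k; apply: val_inj => /=; rewrite -ui (eqP (uj k)).
Qed.

Lemma block_of_point t (i : B) : block_of (block_point t i) = Some i.
Proof. by apply: block_ofE => k; rewrite ffunE /=; have := ltn_ord (t k); lia. Qed.

(** The middle point of a block of side three has all its neighbours inside the block; lowering its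
    coordinates [k0], [k1] or both gives the other corners of a unit square. *)
Lemma lattice_four_cycles (k0 k1 : 'I_d) : k0 != k1 ->
  let at_ (s : seq 'I_d) := block_point (fun k => if k \in s then ord0 else inord 1) in
  four_cycles (lattice_edges d m) (at_ [::]) (at_ [:: k0]) (at_ [:: k1]) (at_ [:: k0; k1]) block_of.
Proof.
move=> k01 at_.
have atE s i k : (at_ s i k : nat) = (3 * i k + (k \notin s))%N.
  by rewrite ffunE /=; case: (k \in s); rewrite /= ?inordK.
have edge s i k : k \notin s -> [set at_ s i; at_ (k :: s) i] \in lattice_edges d m.
  move=> ks; rewrite lattice_edgesE lattice_adjC; apply: (@lattice_adj1 _ _ k) => [j jk|].
    by apply: val_inj; rewrite /= !atE inE (negbTE jk).
  by rewrite !atE inE eqxx ks /= addn0 addn1.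
have at_eq s t : s =i t -> at_ s = at_ t.
  move=> st; apply/funext => i; apply/ffunP => k; apply: val_inj.
  by rewrite /= !atE st.
split => i; rewrite ?block_of_point //.
- exact: edge.
- exact: edge.
- rewrite (@at_eq [:: k0; k1] [:: k1; k0]); last by move=> k; rewrite !inE orbC.
  by apply: edge; rewrite inE eq_sym.
- by apply: edge; rewrite inE.
- apply/negP => /eqP/ffunP/(_ k0)/(congr1 val); rewrite /= !atE !inE eqxx (negbTE k01) /=.
  by rewrite addn0 addn1; lia.
- apply/negP => /eqP/ffunP/(_ k0)/(congr1 val); rewrite /= !atE !inE eqxx /=.
  by rewrite addn0 addn1; lia.
move=> w; rewrite lattice_edgesE => cw; apply: block_ofE => k.
have [] := lattice_adj_near k cw; rewrite !atE /=; lia.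
Qed.

(** In each direction [m <= 5 (m %/ 3)], with equality at [m = 5]. *)
Lemma card_blocks : (0 < d)%N -> (3 <= m)%N -> (#|{: V}| <= 5 ^ d * #|{: B}|)%N.
Proof.
by move=> d0 m3; rewrite !card_ffun !card_ord -expnMn leq_exp2r //; lia.
Qed.

End Lattice.

Section Model1.
Context {R : realType}.
Variable d : nat.
Hypothesis hd : (2 <= d)%N.
Context {dO : measure_display} {Omega : measurableType dO}.
Variables (P : nat -> probability Omega R).
Variables (L : forall m : nat, {set lattice_vertex d m} -> Omega -> R) (f : R -> R).
Arguments L : clear implicits.
Hypothesis mf : measurable_fun setT f.
Hypothesis f0 : forall x, 0 <= f x.
Hypothesis fneg : forall x, x <= 0 -> f x = 0.
Hypothesis fM : exists M : R, forall x, f x <= M.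
Hypothesis fmean : (\int[@lebesgue_measure R]_x (`|x| * f x)%:E < +oo)%E.
Hypothesis mL : forall m e, e \in lattice_edges d m -> measurable_fun setT (L m e).
Hypothesis law : forall m e, e \in lattice_edges d m -> forall B : set R, measurable B ->
  P m (L m e @^-1` B)%classic = (\int[@lebesgue_measure R]_(x in B) (f x)%:E)%E.
Hypothesis indep : forall m, mutually_independent (P m) (lattice_edges d m) (L m).

Let Eeps (delta : R) (m : nat) : \bar R :=
  (\int[P m]_w eps (lattice_edges d m) (fun e => L m e w) delta)%E.
Local Notation D := ((3 ^ d)%:R : R).

Let ED m : #|lattice_edges d m|%:R <= D * #|{: lattice_vertex d m}|%:R.
Proof. by rewrite -natrM ler_nat; exact: card_lattice_edges. Qed.

Let cardV m : #|{: lattice_vertex d m}| = (m ^ d)%N.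
Proof. by rewrite card_ffun !card_ord. Qed.

Let D0 : 0 < D.
Proof. by rewrite ltr0n expn_gt0. Qed.

Lemma model1_lower : exists c : R, 0 < c /\ forall delta, 0 < delta ->
  \forall m \near \oo%classic, ((c * delta ^+ 2)%:E <= Eeps delta m)%E.
Proof.
have [M0 hM0] := fM; pose M := `|M0| + 1.
have M_gt0 : 0 < M by rewrite ltr_wpDl.
have hM x : f x <= M by apply: le_trans (hM0 x) _; rewrite /M; have := ler_norm M0; lra.
exists (32 * M * D)^-1; split; first by rewrite invr_gt0 !mulr_gt0.
move=> delta delta0; near=> m.
rewrite mulrC; apply: (expected_eps_ge (M := M) (D := D)) => //.
- exact: card_lattice_edge.
- rewrite cardV expn_gt0; apply/orP; left; near: m; exact: nbhs_infty_gt.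
- exact: mL.
move=> x x0.
(* Beyond [K0] the law has mass at most [M x]; [K] is taken so large that the last, unbounded bin
   starts there. *)
have [K0 K00 tail] := density_tail mf f0 fmean (mulr_gt0 M_gt0 x0).
pose K := (Num.truncn (K0%:R / x)).+1.
exists K => e eE a.
have mB (b : 'I_K.+1) : measurable [set t | bin 0 x K t = b]%classic by exact: measurable_bin.
have [aK|aK] := ltnP a K.
  have := density_bounded_interval mf f0 fneg hM (law eE) (mB a) (a := a%:R * x) (b := a.+1%:R * x).
  rewrite -mulrBl -natrB // subSnn mul1r; apply.
    by rewrite ler_wpM2r ?ler_nat // ltW.
  move=> t t0 /= ta; have := @bin_lt_upper _ 0 x K t x0; rewrite ta add0r => /(_ aK) -> ; rewrite andbT.
  have [a0|a0] := posnP a; first by rewrite a0 mul0r ltW.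
  by have := @bin_lower _ 0 x K t x0; rewrite ta add0r; apply.
have sub : ([set w | bin 0 x K (L m e w) = a] `<=` L m e @^-1` [set` Interval (BLeft K0%:R) +oo%O])%classic.
  move=> w /= ba; rewrite in_itv /= andbT.
  have /eqP aK' : (a == K :> nat)%N by rewrite eqn_leq aK andbT -ltnS.
  have := @bin_lower _ 0 x K (L m e w) x0; rewrite ba add0r aK' => /(_ isT).
  apply: le_trans; rewrite -ler_pdivrMr // ltW // Num.Theory.truncnS_gt //.
apply: (@le_trans _ _ (P m (L m e @^-1` [set` Interval (BLeft K0%:R) +oo%O])%classic)).
  apply: le_measure => //; rewrite inE.
    exact: (measurable_label_eq (@mL m) mB).
  by rewrite -[X in measurable X]setTI; apply: mL => //; exact: measurable_itv.
by apply: le_trans tail; exact: (density_prob_ge mf f0 (law eE) K00).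
Unshelve. all: by end_near. Qed.

Lemma model1_upper : exists C d0 : R, 0 < d0 /\ forall delta, 0 < delta < d0 ->
  \forall m \near \oo%classic, (Eeps delta m <= (C * delta ^+ 2)%:E)%E.
Proof.
have [M hM] := fM.
pose k0 : 'I_d := Ordinal (ltnW hd); pose k1 : 'I_d := Ordinal hd.
have k01 : k0 != k1 by [].
have fc m := lattice_four_cycles m k01.
(* A lower bound for the expected number of good cells per vertex, multiplied by the number of bins:
   the probability from [Ew_good_cell] times at least [5 ^- d] blocks per vertex. *)
pose gam : R := 8^-1 ^+ (3 ^ d + 4) * ((5 ^ d)%:R)^-1.
have gam0 : 0 < gam by rewrite mulr_gt0 // ?exprn_gt0 // invr_gt0 ltr0n expn_gt0.
(* All edges have the same law, so its quantiles are read off an edge of the lattice of side 3,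
   which contains one block. *)
have i3 : {ffun 'I_d -> 'I_(3 %/ 3)} := [ffun=> ord0].
have eE3 := fc_ca (fc 3) i3.
have [q1 [q2 [q10 q12 nu1 nu2 nu3]]] := density_quantiles mf f0 fneg hM fmean (mL eE3) (law eE3).
rewrite !(law eE3) in nu1 nu2 nu3; try exact: measurable_itv.
pose C := 16 * (q2 - q1) / gam + 2 * D.
exists C, (gam / 4); split; first by rewrite divr_gt0.
move=> delta /andP[delta0 deltag].
(* About [1 / delta] bins, few enough for [4 delta n] good cells to be expected. *)
pose K := Num.truncn (gam / (4 * delta)).
have gd1 : 1 <= gam / (4 * delta) by rewrite ler_pdivlMr ?mulr_gt0 //; lra.
have K_gt0 : (0 < K)%N by rewrite Num.Theory.truncn_gt0.
have Kle : K%:R <= gam / (4 * delta) by rewrite Num.Theory.truncn_le (le_trans ler01).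
have Kge : gam / (8 * delta) <= K%:R.
  have h := Num.Theory.truncnS_gt (gam / (4 * delta)).
  have K1 : 1 <= K%:R :> R by rewrite ler1n.
  have E : gam / (8 * delta) = gam / (4 * delta) / 2 by field; rewrite gt_eqF.
  rewrite E; move: h; rewrite -/K -natr1; lra.
have d2 : 0 < delta ^+ 2 by rewrite exprn_gt0.
(* Half of [delta ^+ 2], because [density_mean_ge] doubles the tail. Since [K0] depends only on
   [delta] and the law, [m] can afterwards be taken large against it. *)
have [K0 K00 tail] := density_tail mf f0 fmean (divr_gt0 d2 (ltr0n _ 2)).
near=> m.
have m3 : (3 <= m)%N by near: m; exact: nbhs_infty_ge.
have nm : m%:R <= #|{: lattice_vertex d m}|%:R :> R.
  by rewrite cardV ler_nat -{1}(expn1 m) leq_pexp2l // ?(leq_trans _ m3) // ltnW.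
have n0 : 0 < #|{: lattice_vertex d m}|%:R :> R.
  by apply: lt_le_trans nm; rewrite ltr0n (leq_trans _ m3).
have dn : 1 <= delta * #|{: lattice_vertex d m}|%:R.
  apply: (@le_trans _ _ (delta * m%:R)); last by rewrite ler_wpM2l // ltW.
  rewrite mulrC -ler_pdivrMr // mul1r ltW //; near: m; exact: nbhs_infty_gtr.
have Kn : K0%:R * (D / (4 * delta ^+ 2 * #|{: lattice_vertex d m}|%:R)) <= delta ^+ 2.
  rewrite mulrA ler_pdivrMr ?mulr_gt0 //.
  have : K0%:R * D / (4 * delta ^+ 2 * delta ^+ 2) <= #|{: lattice_vertex d m}|%:R.
    apply: le_trans nm; apply: ltW; near: m; exact: nbhs_infty_gtr.
  rewrite ler_pdivrMr ?mulr_gt0 //; lra.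
apply: (@le_trans _ _ (2 * delta * ((q2 - q1) / K%:R) +
   D * (K0%:R * (D / (4 * delta ^+ 2 * #|{: lattice_vertex d m}|%:R)) + delta ^+ 2))%:E).
  apply: (expected_eps_le (@card_lattice_edge d m) (@lattice_connected d m) (fc m)
    (nu := fun B => (\int[@lebesgue_measure R]_(x in B) (f x)%:E)%E) (Delta := (3 ^ d)%N)) => //.
  - exact: mL.
  - exact: law.
  - by move=> i; exact: lattice_degree.
  - exact: ltW.
  - pose nB : R := #|{: {ffun 'I_d -> 'I_(m %/ 3)}}|%:R.
    have cB : #|{: lattice_vertex d m}|%:R <= (5 ^ d)%:R * nB.
      by rewrite /nB -natrM ler_nat; exact: card_blocks (ltnW hd) m3.
    have nB0 : 0 <= nB by exact: ler0n.
    have hK : 4 * delta <= gam / K%:R.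
      by rewrite ler_pdivlMr ?ltr0n // mulrC -ler_pdivlMr // mulr_gt0.
    apply: le_trans (ler_wpM2r (ltW n0) hK) _.
    apply: (@le_trans _ _ (gam / K%:R * ((5 ^ d)%:R * nB))).
      by apply: ler_wpM2l; [apply: divr_ge0; [exact: ltW|exact: ler0n]|exact: cB].
    rewrite le_eqVlt; apply/orP; left; apply/eqP; rewrite /gam; field.
    by rewrite !pnatr_eq0 -lt0n K_gt0 expn_eq0.
  - move=> e eE; have -> : [set w | L m e w < 0]%classic = (L m e @^-1` [set` Interval -oo%O (BLeft (0 : R))])%classic.
      by apply/seteqP; split => w; rewrite /= in_itv.
    rewrite (law eE); last exact: measurable_itv.
    apply: integral0_eq => t; rewrite /= in_itv /= => t0; by rewrite fneg // ltW.
  - move=> e eE; have -> : (L m e @^-1` [set t | K0%:R <= t])%classic =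
        (L m e @^-1` [set` Interval (BLeft (K0%:R : R)) +oo%O])%classic.
      by apply/seteqP; split => w; rewrite /= in_itv /= andbT.
    apply: le_trans (density_mean_ge mf f0 (mL eE) (law eE) K00) _.
    apply: le_trans (lee_wpmul2l _ tail) _; first by rewrite lee_fin.
    by rewrite -EFinM lee_fin mulrCA mulfV ?mulr1.
rewrite lee_fin.
have hK : (q2 - q1) / K%:R <= (q2 - q1) * (8 * delta / gam).
  rewrite ler_pM2l ?subr_gt0 // -[leRHS]invrK lef_pV2 ?posrE ?ltr0n //.
    by rewrite invf_div.
  by rewrite invr_gt0 divr_gt0 // mulr_gt0.
have h1 : 2 * delta * ((q2 - q1) / K%:R) <= 16 * (q2 - q1) / gam * delta ^+ 2.
  apply: le_trans (ler_wpM2l (ltW (mulr_gt0 (ltr0n _ 2) delta0)) hK) _.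
  rewrite le_eqVlt; apply/orP; left; apply/eqP; field; by rewrite gt_eqF.
rewrite /C [leRHS]mulrDl lerD //.
apply: (@le_trans _ _ (D * (delta ^+ 2 + delta ^+ 2))).
  by apply: ler_wpM2l; [exact: ltW|rewrite lerD2r].
by rewrite le_eqVlt; apply/orP; left; apply/eqP; ring.
Unshelve. all: by end_near. Qed.

End Model1.

(** * Random Euclidean points *)

Section Euclid.
Context {R : realType} {d : nat}.
Implicit Types (x y z : 'I_d -> R).

Definition enorm x : R := Num.sqrt (\sum_k x k ^+ 2).
Definition edist x y : R := enorm (fun k => x k - y k).

Lemma enorm_ge0 x : 0 <= enorm x. Proof. exact: sqrtr_ge0. Qed.

Lemma enorm_sqr x : enorm x ^+ 2 = \sum_k x k ^+ 2.
Proof. by rewrite sqr_sqrtr // sumr_ge0 // => k _; exact: sqr_ge0. Qed.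

(** Lagrange's identity: the squares of [x i * y j - x j * y i] sum to twice the difference of the
    two sides. *)
Lemma cauchy_schwarz x y : (\sum_k x k * y k) ^+ 2 <= (\sum_k x k ^+ 2) * (\sum_k y k ^+ 2).
Proof.
have -> : (\sum_k x k * y k) ^+ 2 = \sum_i \sum_j (x i * y i) * (x j * y j).
  by rewrite expr2 mulr_suml; apply: eq_bigr => i _; rewrite mulr_sumr.
have E : (\sum_k x k ^+ 2) * (\sum_k y k ^+ 2) = \sum_i \sum_j x i ^+ 2 * y j ^+ 2.
  by rewrite mulr_suml; apply: eq_bigr => i _; rewrite mulr_sumr.
have E' : (\sum_k x k ^+ 2) * (\sum_k y k ^+ 2) = \sum_i \sum_j x j ^+ 2 * y i ^+ 2.
  by rewrite E exchange_big.
have : 0 <= \sum_i \sum_j (x i * y j - x j * y i) ^+ 2.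
  by apply: sumr_ge0 => i _; apply: sumr_ge0 => j _; exact: sqr_ge0.
have -> : \sum_i \sum_j (x i * y j - x j * y i) ^+ 2 =
    \sum_i \sum_j x i ^+ 2 * y j ^+ 2 + \sum_i \sum_j x j ^+ 2 * y i ^+ 2 +
    (-2) * \sum_i \sum_j (x i * y i) * (x j * y j).
  rewrite mulr_sumr -!big_split /=; apply: eq_bigr => i _.
  by rewrite mulr_sumr -!big_split /=; apply: eq_bigr => j _; ring.
by rewrite -E -E'; lra.
Qed.

Lemma enormD x y : enorm (fun k => x k + y k) <= enorm x + enorm y.
Proof.
have h0 : 0 <= enorm x + enorm y by rewrite addr_ge0 // enorm_ge0.
rewrite -[leRHS]ger0_norm // -sqrtr_sqr /enorm ler_wsqrtr //.
rewrite -/(enorm x) -/(enorm y).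
have cs : \sum_k x k * y k <= enorm x * enorm y.
  have [neg|pos] := ltP (\sum_k x k * y k) 0.
    by apply: le_trans (ltW neg) _; rewrite mulr_ge0 // enorm_ge0.
  rewrite -ler_sqr ?nnegrE ?mulr_ge0 ?enorm_ge0 //.
  by rewrite exprMn !enorm_sqr; exact: cauchy_schwarz.
have -> : \sum_k (x k + y k) ^+ 2 = \sum_k x k ^+ 2 + 2 * (\sum_k x k * y k) + \sum_k y k ^+ 2.
  by rewrite mulr_sumr -!big_split /=; apply: eq_bigr => k _; ring.
by rewrite -!enorm_sqr; nra.
Qed.

Lemma edistC x y : edist x y = edist y x.
Proof. by congr Num.sqrt; apply: eq_bigr => k _; rewrite -sqrrN opprB. Qed.

Lemma edist_ge0 x y : 0 <= edist x y. Proof. exact: enorm_ge0. Qed.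

Lemma edist_triangle x y z : edist x z <= edist x y + edist y z.
Proof.
rewrite /edist; apply: le_trans (enormD _ _); rewrite le_eqVlt; apply/orP; left; apply/eqP.
by congr Num.sqrt; apply: eq_bigr => k _; rewrite addrA subrK.
Qed.

Lemma enorm_le x (t : R) : (forall k, `|x k| <= t) -> enorm x <= d%:R * t.
Proof.
move=> xt; case: (posnP d) => [d0|d0].
  rewrite /enorm big1 ?sqrtr0; last by move=> k; have := ltn_ord k; rewrite {2}d0.
  by rewrite {1}d0 mul0r.
have t0 : 0 <= t by apply: le_trans (xt (Ordinal d0)).
have dt0 : 0 <= d%:R * t by rewrite mulr_ge0.
rewrite -[leRHS]ger0_norm // -sqrtr_sqr ler_wsqrtr //.
apply: (@le_trans _ _ (\sum_(k < d) t ^+ 2)).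
  apply: ler_sum => k _; rewrite -real_normK ?num_real //.
  by apply: lerXn2r; rewrite ?nnegrE.
rewrite sumr_const card_ord -[leLHS]mulr_natl exprMn ler_wpM2r ?sqr_ge0 //.
by rewrite expr2 ler_peMl // ler1n.
Qed.

Lemma coord_le_enorm x k : `|x k| <= enorm x.
Proof.
rewrite -sqrtr_sqr ler_wsqrtr // (bigD1 k) //= lerDl sumr_ge0 // => i _; exact: sqr_ge0.
Qed.

Lemma edist_approx x y x' y' (t : R) : (forall k, `|x k - x' k| <= t) ->
  (forall k, `|y k - y' k| <= t) -> `|edist x y - edist x' y'| <= 2 * d%:R * t.
Proof.
move=> hx hy; have h1 := enorm_le hx; have h2 := enorm_le hy.
rewrite -/(edist _ _) in h1; rewrite -/(edist _ _) in h2.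
have := edist_triangle x x' y; have := edist_triangle x' y' y.
have := edist_triangle x' x y'; have := edist_triangle x y y'.
rewrite (edistC x' x) (edistC y' y) ler_norml => *; apply/andP; split; lra.
Qed.

End Euclid.

Lemma eucl_lenE {R : realType} {n d : nat} (x : 'I_n -> 'I_d -> R) (i j : 'I_n) :
  i != j -> eucl_len x [set i; j] = edist (x i) (x j).
Proof.
wlog ij : i j / (i < j)%N => [hw nij|nij].
  have [ij|ji|ij] := ltngtP i j; first exact: hw.
    by rewrite finset.setUC edistC; apply: hw => //; rewrite eq_sym.
  by case/eqP: nij; apply: val_inj.
have mem (F : 'I_n -> R) : \sum_(k in [set i; j]) F k = F i + F j.
  by rewrite big_setU1 ?big_set1 // finset.inE.
have inner1 (F : 'I_n -> R) : \sum_(k in [set i; j] | (i < k)%N) F k = F j.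
  apply: big_pred1 => k; rewrite !finset.inE; have [->|nkj] := eqVneq k j; first by rewrite orbT ij.
  by rewrite orbF; case: eqP => //= ->; rewrite ltnn.
have inner2 (F : 'I_n -> R) : \sum_(k in [set i; j] | (j < k)%N) F k = 0.
  apply: big_pred0 => k; rewrite !finset.inE; apply/negP => /andP[/orP[]/eqP-> h].
    by move: h; rewrite ltnNge ltnW.
  by rewrite ltnn in h.
by rewrite /eucl_len mem inner1 inner2 addr0.
Qed.

(** * Grid positions of the random points *)

Section Discretization.
Context {d : measure_display} {Omega : measurableType d} {R : realType}.
Variables (P : probability Omega R) (n dim g : nat) (X : 'I_n -> 'I_dim -> Omega -> R) (s : R).
Hypothesis s0 : 0 < s.
Hypothesis mX : forall i k, measurable_fun setT (X i k).
Hypothesis law : forall i k (B : set R), measurable B ->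
  (P (X i k @^-1` B) = (@lebesgue_measure R (B `&` `[0%R, s]) * (s^-1)%:E)%E)%classic.
Hypothesis indep : mutually_independent P [set: 'I_n * 'I_dim] (fun ik => X ik.1 ik.2).

Definition grid := {ffun 'I_dim -> 'I_g.+1}.
Let eta := s / g.+1%:R.

Definition conf (w : Omega) : {ffun 'I_n -> grid} :=
  [ffun i => [ffun k => bin 0 eta g (X i k w)]].

Definition unif : 'I_n -> grid -> R := fun _ _ => (#|{: grid}|%:R)^-1.

Let eta0 : 0 < eta. Proof. by rewrite divr_gt0. Qed.

(** Within the cube the clipped last bin differs from the others only by containing its right end
    [s], of measure zero, so all bins are equally likely. *)
Let bin_law i k (a : 'I_g.+1) :
  P [set w | bin 0 eta g (X i k w) = a]%classic = (g.+1%:R^-1)%:E.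
Proof.
have mB : measurable [set t | bin 0 eta g t = a]%classic by exact: measurable_bin.
have -> : P [set w | bin 0 eta g (X i k w) = a]%classic =
  P (X i k @^-1` [set t | bin 0 eta g t = a])%classic by [].
rewrite law //; set I := (_ `&` _)%classic.
have sE : s = g.+1%:R * eta by rewrite /eta mulrC divfK.
have aE : (a.+1%:R - a%:R) * eta = eta by rewrite -natrB // subSnn mul1r.
have aeta : a%:R * eta < a.+1%:R * eta by rewrite ltr_pM2r // ltr_nat.
have lo t : 0 <= t -> bin 0 eta g t = a -> a%:R * eta <= t.
  move=> t0 ta; have [a0|a0] := posnP a; first by rewrite a0 mul0r.
  by have := @bin_lower _ 0 eta g t eta0; rewrite ta add0r; apply.
have muI : (@lebesgue_measure R I = eta%:E)%E.
  have [ag|ag] := ltnP a g.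
    have -> : I = [set` Interval (BLeft (a%:R * eta)) (BLeft (a.+1%:R * eta))]%classic.
      apply/seteqP; split => t; rewrite /I /= !in_itv /=.
        move=> [ta /andP[t0 ts]]; rewrite lo //=.
        by have := @bin_lt_upper _ 0 eta g t eta0; rewrite ta add0r; apply.
      move=> /andP[h1 h2]; have t0 : 0 <= t by apply: le_trans h1; rewrite mulr_ge0 // ltW.
      split; last first.
        rewrite t0 /= (le_trans (ltW h2)) // sE ler_pM2r // ler_nat; exact: ltn_ord.
      apply: val_inj; apply/eqP; rewrite /= eqn_leq; apply/andP; split.
        by rewrite leqNgt bin_gt // add0r -ltNge.
      have [->//|a0] := posnP a; by rewrite bin_ge // ?add0r // ltnW.
    rewrite lebesgue_measure_itv /= lte_fin aeta -EFinB -mulrBl aE //.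
  have ag' : (a : nat) = g by apply/eqP; rewrite eqn_leq ag andbT -ltnS ltn_ord.
  have -> : I = [set` Interval (BLeft (a%:R * eta)) (BRight (a.+1%:R * eta))]%classic.
    apply/seteqP; split => t; rewrite /I /= !in_itv /=.
      by move=> [ta /andP[t0 ts]]; rewrite lo //= ag' -sE.
    move=> /andP[h1 h2]; have t0 : 0 <= t by apply: le_trans h1; rewrite mulr_ge0 // ltW.
    split; last by rewrite t0 /= sE -ag'.
    apply: val_inj; apply/eqP; rewrite /= eqn_leq; apply/andP; split.
      by rewrite ag' -ltnS.
    have [->//|a0] := posnP a; by rewrite bin_ge // ?add0r // ag'.
  rewrite lebesgue_measure_itv /= lte_fin aeta -EFinB -mulrBl aE //.
rewrite muI -EFinM; congr EFin; by rewrite /eta mulrAC mulfV ?mul1r // gt_eqF.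
Qed.

Lemma unif_ge0 i a : 0 <= unif i a. Proof. by rewrite invr_ge0. Qed.

Lemma sum_unif i : \sum_a unif i a = 1.
Proof.
rewrite /unif sumr_const -[LHS]mulr_natl mulfV // pnatr_eq0 -lt0n card_ffun !card_ord.
by rewrite expn_gt0.
Qed.

(** Independence is given for the coordinates of all points together, indexed by pairs; currying
    turns the product law of the labels into [n] independent uniform grid points. *)
Lemma conf_event (S : pred {ffun 'I_n -> grid}) :
  measurable [set w | S (conf w)]%classic /\
  P [set w | S (conf w)]%classic = (Ew unif (fun v => (S v)%:R))%:E.
Proof.
pose cur (v : {ffun 'I_n * 'I_dim -> 'I_g.+1}) : {ffun 'I_n -> grid} := [ffun i => [ffun k => v (i, k)]].
pose unc (u : {ffun 'I_n -> grid}) : {ffun 'I_n * 'I_dim -> 'I_g.+1} := [ffun ik => u ik.1 ik.2].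
have cK : cancel cur unc by move=> v; apply/ffunP => -[i k]; rewrite !ffunE.
have uK : cancel unc cur by move=> u; apply/ffunP => i; apply/ffunP => k; rewrite !ffunE.
pose lab := bin 0 eta g.
have mlab a : measurable [set t | lab t = a]%classic by exact: measurable_bin.
have mX' ik : ik \in [set: 'I_n * 'I_dim] -> measurable_fun setT (X ik.1 ik.2) by move=> _; exact: mX.
have [mS PS] := labels_event ord0 mX' mlab indep [pred v | S (cur v)].
have E w : conf w = cur (labels [set: 'I_n * 'I_dim] (fun ik => X ik.1 ik.2) lab ord0 w).
  by apply/ffunP => i; apply/ffunP => k; rewrite !ffunE finset.inE.
have -> : [set w | S (conf w)]%classic =
  [set w | [pred v | S (cur v)] (labels [set: 'I_n * 'I_dim] (fun ik => X ik.1 ik.2) lab ord0 w)]%classic.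
  by apply/seteqP; split => w /=; rewrite E.
split => //; rewrite PS; congr EFin; rewrite /Ew.
rewrite (reindex unc) /=; last by apply: onW_bij; exists cur.
apply: eq_bigr => u _; rewrite uK; congr (_ * _).
under eq_bigr => ik _.
  rewrite /label_law finset.inE /= bin_law /=.
over.
rewrite !prodr_const !card_ord card_prod !card_ord /unif card_ffun !card_ord natrX.
by rewrite mulnC exprM exprVn.
Qed.

Lemma cube_full : measurable [set w | exists ik : 'I_n * 'I_dim, ~~ (0 <= X ik.1 ik.2 w <= s)]%classic /\
  P [set w | exists ik : 'I_n * 'I_dim, ~~ (0 <= X ik.1 ik.2 w <= s)]%classic = 0%E.
Proof.
pose N (ik : 'I_n * 'I_dim) := (X ik.1 ik.2 @^-1` ~` [set` Interval (BLeft (0:R)) (BRight s)])%classic.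
have mI : measurable (~` [set` Interval (BLeft (0:R)) (BRight s)])%classic.
  by apply: measurableC; exact: measurable_itv.
have [mN PN] := @finite_null_union _ _ _ P _ xpredT N
  (fun ik _ => ltac:(by rewrite -[X in measurable X]setTI; apply: mX))
  (fun ik _ => ltac:(by rewrite /N law // setICl measure0 mul0e)).
have -> : [set w | exists ik : 'I_n * 'I_dim, ~~ (0 <= X ik.1 ik.2 w <= s)]%classic =
  (\bigcup_(ik in [set` xpredT]) N ik)%classic; last by [].
apply/seteqP; split => w /=.
  by move=> [ik h]; exists ik => //; rewrite /N /= in_itv /=; apply/negP.
by move=> [ik _]; rewrite /N /= in_itv /= => /negP h; exists ik.
Qed.

Lemma conf_bounds w i k : 0 <= X i k w <= s ->
  (conf w i k)%:R * eta <= X i k w <= (conf w i k)%:R * eta + eta.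
Proof.
move=> /andP[X0 Xs]; rewrite !ffunE; set a := bin 0 eta g (X i k w).
have lo : a%:R * eta <= X i k w.
  have [a0|a0] := posnP a; first by rewrite a0 mul0r.
  by have := bin_lower eta0 a0; rewrite add0r.
have hi : X i k w <= (a%:R + 1) * eta.
  rewrite natr1; have [ag|ag] := ltnP a g.
    by have := bin_lt_upper eta0 ag; rewrite add0r; exact: ltW.
  have -> : (a : nat) = g by apply/eqP; rewrite eqn_leq ag andbT -ltnS ltn_ord.
  by rewrite /eta mulrC divfK.
by rewrite lo; apply: (le_trans hi); rewrite mulrDl mul1r.
Qed.

Lemma conf_near w i k : 0 <= X i k w <= s ->
  `|X i k w - (conf w i k)%:R * eta| <= eta.
Proof.
move=> /(@conf_bounds w) /andP[lo hi]; rewrite ler_distl.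
by rewrite (le_trans _ lo) ?lerBlDr ?lerDl ?(ltW eta0) // hi.
Qed.

End Discretization.

(** * Lower bound for Euclidean points *)

Lemma leq_card_bigcup (I T : finType) (F : I -> {set T}) :
  (#|\bigcup_i F i| <= \sum_i #|F i|)%N.
Proof.
elim/big_ind2: _ => [|A a B b hA hB|//]; first by rewrite cards0.
by apply: leq_trans (leq_card_setU _ _) _; exact: leq_add.
Qed.

(** * Counting grid points in annuli *)

Section Counting.
Variables (dim g : nat).
Local Notation grid := {ffun 'I_dim -> 'I_g.+1}.
Implicit Types (h : grid) (k : 'I_dim).

Lemma card_ord_interval (G : nat) (A : pred 'I_G) (lo m : nat) :
  (forall a : 'I_G, A a -> (lo <= a < lo + m)%N) -> (#|A| <= m)%N.
Proof.
case: m => [|m] hA.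
  rewrite leqn0; apply/eqP/eq_card0 => a; apply/negP => /hA; rewrite addn0.
  by move=> /andP[h1 h2]; have := leq_ltn_trans h1 h2; rewrite ltnn.
pose f (a : 'I_G) : 'I_m.+1 := inord (a - lo).
have finj : {in A &, injective f}.
  move=> a b /hA/andP[a1 a2] /hA/andP[b1 b2] /(congr1 (@nat_of_ord _)).
  by rewrite !inordK ?ltn_subLR // => ab; apply: val_inj => /=; lia.
by rewrite -(card_in_image finj) -[X in (_ <= X)%N]card_ord; exact: max_card.
Qed.

Lemma card_grid_family (F : 'I_dim -> pred 'I_g.+1) :
  #|[set h : grid | [forall k, F k (h k)]]| = (\prod_k #|F k|)%N.
Proof.
have -> : #|[set h : grid | [forall k, F k (h k)]]| = #|family F|.
  by apply: eq_card => h; rewrite finset.inE.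
by rewrite card_family foldrE big_map big_enum.
Qed.

(** Reducing coordinate [k0] modulo [T.+1] is injective on [A], because points on one line in
    direction [k0] lie within [T.+1] consecutive values. *)
Lemma card_grid_fiber (A : {set grid}) (F : 'I_dim -> pred 'I_g.+1) k0 (T rho : nat) :
  (forall h, h \in A -> forall k, F k (h k)) -> (forall k, (#|F k| <= rho)%N) ->
  (forall h h', h \in A -> h' \in A -> (forall k, k != k0 -> h k = h' k) ->
     (h k0 <= h' k0 + T)%N) ->
  (#|A| <= rho ^ dim.-1 * T.+1)%N.
Proof.
move=> hF cF hT.
pose phi h : grid := [ffun k => if k == k0 then inord (h k0 %% T.+1) else h k].
have mod_lt h : (h k0 %% T.+1 < g.+1)%N by exact: leq_ltn_trans (leq_mod _ _) (ltn_ord _).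
have phi_inj : {in A &, injective phi}.
  move=> h h' hA hA' E.
  have off k : k != k0 -> h k = h' k.
    by move=> kk0; have /ffunP/(_ k) := E; rewrite !ffunE (negbTE kk0).
  have at0 : h k0 = h' k0 %[mod T.+1].
    by have /ffunP/(_ k0)/(congr1 (@nat_of_ord _)) := E; rewrite !ffunE eqxx !inordK.
  apply/ffunP => k; have [->|/off //] := eqVneq k k0; apply: val_inj => /=.
  have h1 := hT _ _ hA hA' off; have h2 := hT _ _ hA' hA (fun k kk => esym (off k kk)).
  move: at0 h1 h2; move: (nat_of_ord (h k0)) (nat_of_ord (h' k0)) => a b.
  rewrite (divn_eq a T.+1) (divn_eq b T.+1).
  set qa := (a %/ _)%N; set qb := (b %/ _)%N.
  have := ltn_pmod a (ltn0Sn T); have := ltn_pmod b (ltn0Sn T).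
  rewrite !modnMDl !modn_mod => hb ha ->.
  case: (ltngtP qa qb) => [lt|gt|->] //.
    have : (qa.+1 * T.+1 <= qb * T.+1)%N by rewrite leq_mul2r lt orbT.
    by rewrite mulSn; lia.
  have : (qb.+1 * T.+1 <= qa * T.+1)%N by rewrite leq_mul2r gt orbT.
  by rewrite mulSn; lia.
rewrite -(card_in_imset phi_inj).
pose F' k : pred 'I_g.+1 := fun a => if k == k0 then (a < T.+1)%N else F k a.
apply: (@leq_trans #|[set h : grid | [forall k, F' k (h k)]]|).
  apply: subset_leq_card; apply/fintype.subsetP => _ /imsetP[h hA ->].
  rewrite finset.inE; apply/forallP => k; rewrite /F' ffunE; case: eqP => [_|_].
    by rewrite /= inordK // ltn_pmod.
  exact: hF.
rewrite card_grid_family (bigD1 k0) //= mulnC; apply: leq_mul.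
  apply: (@leq_trans (\prod_(k < dim | k != k0) rho)%N).
    apply: leq_prod => k kk0; apply: leq_trans (cF k); apply: eq_leq; apply: eq_card => a.
    by rewrite !unfold_in /F' (negbTE kk0).
  by rewrite prod_nat_const cardC1 card_ord.
by apply: (@card_ord_interval _ _ 0) => a; rewrite /F' eqxx.
Qed.

End Counting.

Section Annulus.
Context {R : realType}.
Variables (dim g : nat) (eta : R).
Hypothesis eta0 : 0 < eta.
Local Notation grid := {ffun 'I_dim -> 'I_g.+1}.
Implicit Types (h z : grid) (k : 'I_dim).

Definition gpos h : 'I_dim -> R := fun k => (h k)%:R * eta.
Definition gdist h z : R := edist (gpos h) (gpos z).

(* Two grid points at distances [r], [r'] from [z] that agree off a coordinate [k] of maximal
   displacement, on the same side of [z]: moving along [k] changes the distance at rate at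
   least [1 / dim], because that displacement is at least [r / dim]. *)
Lemma gdist_coord h h' z k (y : R) : 0 <= y -> (forall i, i != k -> h i = h' i) ->
  (forall i, `|gpos h i - gpos z i| <= `|gpos h k - gpos z k|) ->
  (forall i, `|gpos h' i - gpos z i| <= `|gpos h' k - gpos z k|) ->
  (z k <= h' k)%N = (z k <= h k)%N -> (h' k <= h k)%N = (z k <= h k)%N ->
  gdist h z - gdist h' z <= y ->
  `|gpos h k - gpos h' k| <= dim%:R * y.
Proof.
move=> y0 off hmax hmax' side ord ry.
set r := gdist h z in ry; set r' := gdist h' z in ry.
set a := `|gpos h k - gpos z k|; set a' := `|gpos h' k - gpos z k|.
have aa : `|gpos h k - gpos h' k| = a - a' /\ a' <= a.
  rewrite /a /a'; have mono (p q : 'I_g.+1) : (p <= q)%N -> p%:R * eta <= q%:R * eta.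
    by move=> pq; rewrite ler_wpM2r ?ler_nat // ltW.
  have [zh|zh] := leqP (z k) (h k).
    rewrite zh in side ord; have h1 := mono _ _ zh; have h2 := mono _ _ side; have h3 := mono _ _ ord.
    rewrite /gpos !ger0_norm ?subr_ge0 //; split; lra.
  have nzh : (z k <= h k)%N = false by rewrite leqNgt zh.
  rewrite nzh in side ord; have {}side : (h' k < z k)%N by rewrite ltnNge side.
  have {}ord : (h k < h' k)%N by rewrite ltnNge ord.
  have h1 := mono _ _ (ltnW zh); have h2 := mono _ _ (ltnW side); have h3 := mono _ _ (ltnW ord).
  rewrite /gpos !ler0_norm ?subr_le0 //; split; lra.
have [-> a'a] := aa.
have a0 : 0 <= a by exact: normr_ge0.
have a'0 : 0 <= a' by exact: normr_ge0.
have dim1 : 1 <= dim%:R :> R by rewrite ler1n (leq_ltn_trans _ (ltn_ord k)).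
have E : r ^+ 2 - r' ^+ 2 = a ^+ 2 - a' ^+ 2.
  rewrite /r /r' /gdist /edist !enorm_sqr (bigD1 k) //= [X in _ - X](bigD1 k) //=.
  have -> : \sum_(i < dim | i != k) (gpos h' i - gpos z i) ^+ 2 =
            \sum_(i < dim | i != k) (gpos h i - gpos z i) ^+ 2.
    by apply: eq_bigr => i ik; rewrite /gpos (off i ik).
  by rewrite /a /a' !real_normK ?num_real //; ring.
have r0 : 0 <= r by exact: edist_ge0.
have r'0 : 0 <= r' by exact: edist_ge0.
have ra : r <= dim%:R * a by apply: enorm_le.
have [a_eq0|a_gt0] := eqVneq a 0; first by have := mulr_ge0 (ler0n R dim) y0; lra.
have apos : 0 < a by rewrite lt_neqAle eq_sym a_gt0.
have r'r : r' <= r.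
  by rewrite -ler_sqr ?nnegrE //; nra.
(* Both differences of squares agree, so [(a - a') (a + a') = (r - r') (r + r')]; the factor
   [a + a' > 0] then cancels because [r + r' <= dim (a + a')]. *)
have key : (a - a') * (a + a') <= dim%:R * (r - r') * (a + a').
  have -> : (a - a') * (a + a') = (r - r') * (r + r').
    by transitivity (a ^+ 2 - a' ^+ 2); [ring|rewrite -E; ring].
  have ra' : r' <= dim%:R * a' by apply: enorm_le.
  rewrite mulrAC; apply: (@le_trans _ _ ((r - r') * (dim%:R * (a + a')))).
    by apply: ler_wpM2l; [rewrite subr_ge0|lra].
  by rewrite le_eqVlt; apply/orP; left; apply/eqP; ring.
have : a - a' <= dim%:R * (r - r') by move: key; rewrite ler_pM2r // ltr_wpDr.
by move=> h1; apply: le_trans h1 _; rewrite ler_wpM2l.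
Qed.

(** The set is cut into [2 dim] classes by the coordinate of largest displacement from [z] and its
    side. By [gdist_coord], a line in that direction meets a class in a stretch of length at most
    [dim y]. *)
Lemma card_annulus (S : {set grid}) z (F : 'I_dim -> pred 'I_g.+1) (rho : nat) (y : R) :
  (0 < dim)%N -> 0 <= y ->
  (forall h, h \in S -> forall k, F k (h k)) -> (forall k, (#|F k| <= rho)%N) ->
  (forall h h', h \in S -> h' \in S -> gdist h z - gdist h' z <= y) ->
  #|S|%:R <= 2 * dim%:R * (rho%:R ^+ dim.-1 * (dim%:R * y / eta + 1)) :> R.
Proof.
move=> dim0 y0 hF cF hy.
pose T := Num.truncn (dim%:R * y / eta).
have yT : dim%:R * y < T.+1%:R * eta.
  by rewrite -ltr_pdivrMr // Num.Theory.truncnS_gt.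
have Ty : T%:R <= dim%:R * y / eta.
  by rewrite Num.Theory.truncn_le divr_ge0 ?mulr_ge0 // ltW.
pose maxk h k := [forall i, `|gpos h i - gpos z i| <= `|gpos h k - gpos z k|].
pose Sk k (b : bool) := [set h in S | maxk h k && ((z k <= h k)%N == b)].
have cSk k b : (#|Sk k b| <= rho ^ dim.-1 * T.+1)%N.
  apply: (card_grid_fiber (F := F) (k0 := k)) => //.
    by move=> h; rewrite finset.inE => /andP[hS _]; exact: hF.
  move=> h h'; rewrite !finset.inE => /and3P[hS /forallP hm /eqP hb] /and3P[hS' /forallP hm' /eqP hb'] off.
  have off' i : i != k -> h' i = h i by move=> /off.
  have sd : (z k <= h' k)%N = (z k <= h k)%N by rewrite hb hb'.
  suff : `|gpos h k - gpos h' k| <= dim%:R * y.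
    rewrite /gpos => h1; rewrite leqNgt; apply/negP => hT.
    have : (h' k + T.+1)%:R * eta <= (h k)%:R * eta.
      by rewrite ler_wpM2r ?ler_nat ?addnS // ltW.
    have := ler_norm ((h k)%:R * eta - (h' k)%:R * eta).
    rewrite natrD mulrDl => h2 h3; lra.
  (* [gdist_coord] takes the farther of the two points first; in the other case the roles are
     exchanged. *)
  case: (boolP ((h' k <= h k)%N == (z k <= h k)%N)) => [/eqP o|o].
    by apply: gdist_coord => //; exact: hy.
  rewrite distrC; have [hk|hk] := eqVneq (h k : nat) (h' k).
    by rewrite /gpos hk subrr normr0 mulr_ge0.
  apply: gdist_coord => //; last exact: hy.
  rewrite sd; move: o; case: (ltngtP (h k) (h' k)) hk => //= _ _; by case: (z k <= h k)%N.
have sub : S \subset \bigcup_k (Sk k true :|: Sk k false).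
  apply/fintype.subsetP => h hS.
  have [k _ hk] := @arg_maxP _ _ _ (Ordinal dim0) xpredT (fun k => `|gpos h k - gpos z k|) isT.
  apply/bigcupP; exists k => //; rewrite !finset.inE hS /=.
  have -> : maxk h k by apply/forallP => i; exact: hk.
  by case: (z k <= h k)%N.
have : (#|S| <= \sum_(k < dim) 2 * (rho ^ dim.-1 * T.+1))%N.
  apply: leq_trans (subset_leq_card sub) _.
  apply: leq_trans (leq_card_bigcup _) _; apply: leq_sum => k _.
  apply: leq_trans (leq_card_setU _ _) _; rewrite mul2n -addnn; exact: leq_add.
rewrite -(ler_nat R) sum_nat_const card_ord !natrM natrX => h; apply: le_trans h _.
rewrite mulrCA mulrA; apply: ler_wpM2l; first by rewrite mulr_ge0.
by apply: ler_wpM2l; [rewrite exprn_ge0|rewrite -natr1 lerD2r].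
Qed.

End Annulus.

(** The path is cut at its first arrival at [j]; everything before avoids [j]. *)
Lemma connect_adj_last {V : finType} (T : {set {set V}}) (i j : V) :
  connect (adj T) i j -> i != j ->
  exists b, [set b; j] \in T /\ connect (adj [set f in T | j \notin f]) i b.
Proof.
move=> /connectP[p]; elim: p i => [|z p ih] i /=; first by move=> _ ->; rewrite eqxx.
move=> /andP[iz zp] jE ij; have [zj|zj] := eqVneq z j.
  by exists i; split; [rewrite -zj|exact: connect0].
have [b [bj zb]] := ih z zp jE zj; exists b; split => //.
apply: connect_trans zb; apply: connect1; rewrite /adj finset.inE.
by rewrite (iz : [set i; z] \in T) /= !finset.inE negb_or eq_sym ij eq_sym.
Qed.

Section Moving.
Context {R : realType}.
Variables (n dim g : nat).
Local Notation grid := (grid dim g).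
Implicit Types (v : {ffun 'I_n -> grid}) (Ev : pred {ffun 'I_n -> grid}).

Let card_grid0 : 0 < #|{: grid}|%:R :> R.
Proof. by rewrite ltr0n card_ffun !card_ord expn_gt0. Qed.

(* Average over the position of [p] first, the other points being fixed. *)
Lemma Ew_moving Ev (p i1 i2 : 'I_n) (Rg Q : pred grid) (a : R) :
  p != i1 -> p != i2 -> i1 != i2 -> 0 <= a ->
  (forall v, Ev v -> [&& Rg (v i1), Rg (v i2) &
     [forall r, (r != p) && (r != i1) && (r != i2) ==> ~~ Q (v r)]]) ->
  (forall v, #|[set h | Ev (upd v p h)]|%:R <= a) ->
  Ew (@unif R n dim g) (fun v => (Ev v)%:R) <=
  a / #|{: grid}|%:R * (#|Rg|%:R / #|{: grid}|%:R) ^+ 2 *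
  (1 - #|Q|%:R / #|{: grid}|%:R) ^+ (n - 3).
Proof.
move=> pi1 pi2 i12 a0 hEv ha.
(* A majorant in product form: once [p] is averaged out, each other point keeps a constraint of its
   own. *)
pose h (r : 'I_n) (x : grid) : R :=
  if r == p then 1 else if (r == i1) || (r == i2) then (Rg x)%:R else (~~ Q x)%:R.
have h01 r x : 0 <= h r x <= 1.
  by rewrite /h; do ?[case: ifP => _]; rewrite ?ler0n ?lern1 ?leq_b1 ?ler01 ?lexx.
have u1 := @sum_unif R n dim g.
rewrite -(Ew_avg u1 p).
have step v : avg (@unif R n dim g) p (fun v => (Ev v)%:R) v <= a / #|{: grid}|%:R * \prod_r h r (v r).
  have avgE : avg (@unif R n dim g) p (fun v => (Ev v)%:R) v = #|[set x | Ev (upd v p x)]|%:R / #|{: grid}|%:R.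
    rewrite /avg /unif -mulr_sumr mulrC; congr (_ * _).
    rewrite -sum1dep_card natr_sum [RHS]big_mkcond /=; apply: eq_bigr => x _.
    by case: (Ev _).
  rewrite avgE.
  have prod0 : 0 <= \prod_r h r (v r) by apply: prodr_ge0 => r _; have /andP[] := h01 r (v r).
  case: (set_0Vmem [set x | Ev (upd v p x)]) => [->|[x]].
    by rewrite cards0 mul0r mulr_ge0 // divr_ge0.
  rewrite finset.inE => /hEv /and3P[e1 e2 /forallP e3].
  have -> : \prod_r h r (v r) = 1.
    apply: big1 => r _; rewrite /h; case: eqP => // /eqP rp.
    case: ifP => [/orP[]/eqP rE|]; first by rewrite rE; rewrite upd_ne 1?eq_sym // in e1; rewrite e1.
      by rewrite rE; rewrite upd_ne 1?eq_sym // in e2; rewrite e2.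
    move/negbT; rewrite negb_or => /andP[r1 r2].
    by have := e3 r; rewrite rp r1 r2 upd_ne //= => ->.
  by rewrite mulr1 ler_wpM2r ?invr_ge0.
apply: (@le_trans _ _ (Ew (@unif R n dim g) (fun v => a / #|{: grid}|%:R * \prod_r h r (v r)))).
  by apply: ler_Ew => // r x; exact: unif_ge0.
rewrite EwZ Ew_prod -[leRHS]mulrA; apply: ler_wpM2l; first by rewrite divr_ge0.
have sumI (S : pred grid) r : \sum_x @unif R n dim g r x * (S x)%:R = #|S|%:R / #|{: grid}|%:R.
  rewrite /unif -mulr_sumr mulrC; congr (_ * _).
  rewrite -sum1_card natr_sum [RHS]big_mkcond /=; apply: eq_bigr => x _.
  by rewrite unfold_in; case: (S x).
have sumC r : \sum_x @unif R n dim g r x * (~~ Q x)%:R = 1 - #|Q|%:R / #|{: grid}|%:R.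
  apply/eqP; rewrite eq_sym subr_eq -(sumI Q r) -big_split /=; apply/eqP.
  rewrite -[LHS](u1 r); apply: eq_bigr => x _; rewrite -mulrDr.
  by case: (Q x); rewrite ?add0r ?addr0 mulr1.
rewrite (bigD1 p) //= (bigD1 i1) //=; last by rewrite eq_sym.
rewrite (bigD1 i2) //=; last by rewrite eq_sym pi2 eq_sym.
rewrite {1}/h eqxx; under eq_bigr do rewrite mulr1.
rewrite u1 mul1r {1}/h eq_sym (negbTE pi1) eqxx /= sumI {1}/h eq_sym (negbTE pi2) eqxx orbT /= sumI.
rewrite mulrA -expr2; apply: ler_wpM2l; first exact: sqr_ge0.
rewrite (eq_bigr (fun=> 1 - #|Q|%:R / #|{: grid}|%:R)); last first.
  move=> r /andP[/andP[r1 r2] r3]; rewrite -(sumC r); apply: eq_bigr => x _.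
  by rewrite /h (negbTE r1) (negbTE r2) (negbTE r3).
rewrite prodr_const.
have -> // : #|[pred r : 'I_n | (r != p) && (r != i1) && (r != i2)]| = (n - 3)%N.
have -> : #|[pred r : 'I_n | (r != p) && (r != i1) && (r != i2)]| = #|~: [set p; i1; i2]|.
  by apply: eq_card => r; rewrite !inE !negb_or -andbA.
rewrite cardsCs finset.setCK card_ord finset.setUC cardsU1 cards2 !finset.inE negb_or pi1.
by rewrite eq_sym pi2 eq_sym i12.
Qed.

End Moving.

(** * Dyadic localization of pairs without a shortcut *)

Section Triples.
Context {R : realType}.
Variables (n dim J G0 g : nat) (s xi zeta : R).
Hypothesis dim0 : (0 < dim)%N.
Hypothesis s0 : 0 < s.
Hypothesis hG : g.+1 = (2 ^ J * G0)%N.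
Hypothesis sJ : (2 ^ J)%:R <= s.
Local Notation eta := (s / g.+1%:R).
Local Notation grid := (grid dim g).
Implicit Types (v : {ffun 'I_n -> grid}) (i j b : 'I_n) (tau : nat).
Hypothesis zetaE : zeta = 2 * dim%:R * eta.
Hypothesis xi0 : 0 <= xi.
Hypothesis small : xi + 2 * zeta + 2 * dim%:R * eta <= 3.

Definition width tau : nat := (2 ^ (J - tau) * G0)%N.
(** In cell widths from the corner of the cell of the midpoint: [8 dim] to reach [j] and [16 dim]
    more to reach [b], [4 dim] for the rounding of distances, and 2 for the position in the cell and
    the integer midpoint. *)
Definition reach : nat := (28 * dim + 2)%N.
Definition vdist v i j : R := gdist eta (v i) (v j).

Definition near_cell tau (q : 'I_dim -> nat) : pred grid := fun h =>
  [forall k, (q k * width tau <= h k + reach * width tau)%N &&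
             (h k <= q k * width tau + reach * width tau)%N].
Definition in_cell tau (q : 'I_dim -> nat) : pred grid := fun h =>
  [forall k, (h k %/ width tau == q k)%N].

Let eta0 : 0 < eta. Proof. by rewrite divr_gt0. Qed.

Let G0_gt0 : (0 < G0)%N.
Proof. by rewrite lt0n; apply/eqP => G0E; move: hG; rewrite G0E muln0. Qed.

Lemma width_gt0 tau : (0 < width tau)%N.
Proof. by rewrite muln_gt0 expn_gt0. Qed.

Lemma widthE tau : (tau <= J)%N -> (2 ^ tau * width tau)%N = g.+1.
Proof. by move=> tJ; rewrite hG mulnA -expnD subnKC. Qed.

Let mesh tau : R := (width tau)%:R * eta.

Let meshS tau : (tau < J)%N -> mesh tau = 2 * mesh tau.+1.
Proof.
move=> tJ; rewrite /mesh [RHS]mulrA -natrM /width mulnA -expnS -subSn //.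
Qed.

Let mesh0 : mesh 0 = s.
Proof. by rewrite /mesh -(mul1n (width 0)) -(expn0 2) widthE // mulrC divfK. Qed.

Let mesh_ge1 tau : (tau <= J)%N -> 1 <= mesh tau.
Proof.
move=> tJ; rewrite /mesh mulrA ler_pdivlMr ?ltr0n // mul1r.
rewrite -(widthE tJ) natrM mulrC ler_wpM2l //.
by apply: le_trans sJ; rewrite ler_nat leq_pexp2l.
Qed.

Let gpos_bound (h : grid) k : 0 <= gpos eta h k <= s.
Proof.
rewrite /gpos mulr_ge0 ?(ltW eta0) //=.
by rewrite mulrCA ler_piMr ?(ltW s0) // ler_pdivrMr // mul1r ler_nat ltnW.
Qed.

Let vdist_le v i j : vdist v i j <= dim%:R * s.
Proof.
apply: enorm_le => k; have /andP[h1 h2] := gpos_bound (v i) k.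
by have /andP[h3 h4] := gpos_bound (v j) k; rewrite ler_norml; apply/andP; split; lra.
Qed.

(** The finest scale at which the upper bound holds; unless it is the last one, the bound fails at
    the next scale, and since the mesh halves this is the lower bound. *)
Lemma scale_exists v i j : exists tau, [/\ (tau <= J)%N, vdist v i j < 16 * dim%:R * mesh tau &
  (tau < J)%N -> 8 * dim%:R * mesh tau <= vdist v i j].
Proof.
have d0 : 0 < dim%:R :> R by rewrite ltr0n.
have ex0 : exists tau, (tau <= J)%N && (vdist v i j < 16 * dim%:R * mesh tau).
  exists 0%N; rewrite leq0n mesh0 /=; apply: (le_lt_trans (vdist_le v i j)).
  by have := mulr_gt0 d0 s0; lra.
have bnd tau : (tau <= J)%N && (vdist v i j < 16 * dim%:R * mesh tau) -> (tau <= J)%N.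
  by case/andP.
case: (ex_maxnP ex0 bnd) => tau /andP[tJ ht] tmax; exists tau; split => // tltJ.
rewrite leNgt; apply/negP => h; have := tmax tau.+1; rewrite tltJ ltnn /=.
suff h' : vdist v i j < 16 * dim%:R * mesh tau.+1 by move/(_ h').
by move: h; rewrite (meshS tltJ); lra.
Qed.

(** A shortcut [p] would join [i] to [j] by two edges shorter by more than [xi]; the margin
    [2 * zeta] absorbs the rounding to the grid. *)
Definition no_shortcut v i j : Prop := forall p, p != i -> p != j ->
  ~ (vdist v i p <= vdist v i j - xi - 2 * zeta /\ vdist v p j <= vdist v i j - xi - 2 * zeta).

Definition localized tau (q : 'I_dim -> nat) i j b : pred {ffun 'I_n -> grid} := fun v =>
  [&& near_cell tau q (v i), near_cell tau q (v j), near_cell tau q (v b) &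
   (tau < J)%N ==> [forall p, (p != i) && (p != j) ==> ~~ in_cell tau q (v p)]].

Let coord_vdist v i j k : `|(v i k)%:R - (v j k)%:R| * eta <= vdist v i j.
Proof.
apply: le_trans (coord_le_enorm _ k); rewrite /gpos -mulrBl normrM.
by rewrite (ger0_norm (ltW eta0)).
Qed.

Let diff_nat v i j (t : nat) : vdist v i j <= t%:R * eta ->
  forall k, (v i k <= v j k + t)%N /\ (v j k <= v i k + t)%N.
Proof.
move=> h k; have := le_trans (coord_vdist v i j k) h; rewrite ler_pM2r // ler_norml.
move=> /andP[h1 h2]; rewrite -!(ler_nat R) !natrD; split; lra.
Qed.

(* Around the midpoint of [ij] there is a dyadic cell, of size comparable to the distance
   [ij], which contains no other point: such a point would be a shortcut. At the finest
   scale, where cells hold about one point, nothing is claimed. *)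
Lemma localize v i j b : vdist v b j <= vdist v i j + 2 * zeta -> no_shortcut v i j ->
  exists (tau : 'I_J.+1) (q : {ffun 'I_dim -> 'I_(2 ^ tau)}), localized tau (fun k => q k) i j b v.
Proof.
move=> hbj nosc; have [tau [tJ hlt hge]] := scale_exists v i j.
set D := vdist v i j in hbj hlt hge *.
have w0 := width_gt0 tau.
pose m k := ((v i k + v j k) %/ 2)%N.
have mG k : (m k < g.+1)%N.
  by rewrite /m; have := ltn_ord (v i k); have := ltn_ord (v j k); clear; lia.
have qlt k : (m k %/ width tau < 2 ^ tau)%N by rewrite ltn_divLR // widthE.
exists (Ordinal (tJ : (tau < J.+1)%N)), [ffun k => Ordinal (qlt k)].
have qE k : (([ffun k => Ordinal (qlt k)] : {ffun 'I_dim -> 'I_(2 ^ tau)}) k : nat) = (m k %/ width tau)%N.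
  by rewrite ffunE.
have hij : D <= (16 * dim * width tau)%:R * eta.
  have -> : (16 * dim * width tau)%:R * eta = 16 * dim%:R * mesh tau by rewrite /mesh !natrM !mulrA.
  exact: ltW.
have hbj' : vdist v b j <= (16 * dim * width tau + 4 * dim)%:R * eta.
  apply: (le_trans hbj).
  have -> : (16 * dim * width tau + 4 * dim)%:R * eta =
    (16 * dim * width tau)%:R * eta + 2 * zeta by rewrite zetaE natrD mulrDl natrM; congr (_ + _); ring.
  by rewrite lerD2r.
have dij := diff_nat hij; have dbj := diff_nat hbj'.
have W1 : (4 * dim <= 4 * dim * width tau)%N by rewrite leq_pmulr.
have rW : (reach * width tau = 16 * dim * width tau + 8 * dim * width tau + 4 * dim * width tau + 2 * width tau)%N.
  by rewrite /reach; clear; lia.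
have lo k : (m k %/ width tau * width tau <= m k < m k %/ width tau * width tau + width tau)%N.
  by rewrite leq_divM /= {1}(divn_eq (m k) (width tau)) ltn_add2l ltn_pmod.
have near p : (forall k, (v p k <= m k + 24 * dim * width tau + 4 * dim + 1)%N /\
    (m k <= v p k + 24 * dim * width tau + 4 * dim + 1)%N) ->
  near_cell tau (fun k => ([ffun k => Ordinal (qlt k)] : {ffun 'I_dim -> 'I_(2 ^ tau)}) k) (v p).
  move=> hp; apply/forallP => k; rewrite qE rW.
  have [h1 h2] := hp k; have /andP[h3 h4] := lo k; clear -h1 h2 h3 h4 W1; apply/andP; split; lia.
have mid k : (v i k <= m k + 8 * dim * width tau + 1)%N /\ (m k <= v i k + 8 * dim * width tau + 1)%N
    /\ (v j k <= m k + 8 * dim * width tau + 1)%N /\ (m k <= v j k + 8 * dim * width tau + 1)%N.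
  have := dij k; rewrite /m -[(16 * dim * _)%N]mulnA -[(8 * dim * _)%N]mulnA; clear.
  by move: (dim * width tau)%N (v i k : nat) (v j k : nat) => A x y [h1 h2]; lia.
apply/and4P; split.
- by apply: near => k; have [h1 [h2 [h3 h4]]] := mid k; clear -h1 h2; lia.
- by apply: near => k; have [h1 [h2 [h3 h4]]] := mid k; clear -h3 h4; lia.
- apply: near => k; have [h1 [h2 [h3 h4]]] := mid k; have [h5 h6] := dbj k.
  by clear -h3 h4 h5 h6; lia.
apply/implyP => /= tltJ; have {}hge := hge tltJ.
apply/forallP => p; apply/implyP => /andP[pi pj]; apply/negP => /forallP pq.
apply: (nosc p pi pj).
have d1 : 1 <= dim%:R :> R by rewrite ler1n.
(* A point of the cell is within [D / 8] of the integer midpoint, hence within [5 D / 8] of both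
   ends up to rounding; the remaining [3 D / 8] is at least 3 and absorbs [xi] and the errors by
   [small]. *)
have D8 : 8 <= D by apply: le_trans hge; have := mesh_ge1 tJ; nra.
have mD : dim%:R * mesh tau <= D / 8 by rewrite ler_pdivlMr //; lra.
have pm k : `|(v p k)%:R - (m k)%:R| <= (width tau)%:R :> R.
  have := eqP (pq k); rewrite qE => hq; have /andP[h1 h2] := lo k.
  have h3 : (m k %/ width tau * width tau <= v p k < m k %/ width tau * width tau + width tau)%N.
    by rewrite -hq leq_divM /= {1}(divn_eq (v p k) (width tau)) ltn_add2l ltn_pmod.
  move/andP: h3 => [h3 h4].
  have a1 : (v p k)%:R <= (m k)%:R + (width tau)%:R :> R by rewrite -natrD ler_nat; clear -h1 h2 h3 h4; lia.
  have a2 : (m k)%:R <= (v p k)%:R + (width tau)%:R :> R by rewrite -natrD ler_nat; clear -h1 h2 h3 h4; lia.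
  by rewrite ler_norml; apply/andP; split; lra.
pose mpos k : R := (m k)%:R * eta.
have dpm : edist (gpos eta (v p)) mpos <= dim%:R * mesh tau.
  apply: enorm_le => k; rewrite /gpos /mpos -mulrBl normrM (ger0_norm (ltW eta0)).
  by rewrite /mesh ler_wpM2r // ltW.
pose hpos k : R := ((v i k)%:R + (v j k)%:R) / 2 * eta.
have dmh : edist mpos hpos <= dim%:R * eta.
  apply: enorm_le => k; rewrite /mpos /hpos -mulrBl normrM (ger0_norm (ltW eta0)).
  rewrite ler_piMl ?(ltW eta0) //.
  have h1 : ((m k) * 2)%:R <= (v i k + v j k)%:R :> R by rewrite ler_nat /m; clear; lia.
  have h2 : (v i k + v j k)%:R <= (m k * 2 + 1)%:R :> R by rewrite ler_nat /m; clear; lia.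
  rewrite natrM natrD in h1; rewrite !natrD natrM in h2.
  by rewrite ler_norml; apply/andP; split; lra.
have d0 : 0 <= D by exact: edist_ge0.
have half a c : (a = i /\ c = j) \/ (a = j /\ c = i) -> edist hpos (gpos eta (v a)) <= D / 2.
  move=> ac; rewrite -(ler_sqr (edist_ge0 _ _)) ?nnegrE ?divr_ge0 //.
  rewrite exprMn /D /vdist /gdist /edist !enorm_sqr mulr_suml.
  rewrite le_eqVlt; apply/orP; left; apply/eqP; apply: eq_bigr => k _.
  by rewrite /hpos /gpos; case: ac => -[-> _]; field.
have fin a c : (a = i /\ c = j) \/ (a = j /\ c = i) -> vdist v p a <= D - xi - 2 * zeta.
  move=> ac; have h1 := half a c ac; rewrite /vdist /gdist.
  have h2 := edist_triangle (gpos eta (v p)) mpos (gpos eta (v a)).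
  have h3 := edist_triangle mpos hpos (gpos eta (v a)).
  have de0 : 0 <= dim%:R * eta by rewrite mulr_ge0 // ltW.
  apply: le_trans h2 _; apply: le_trans (lerD dpm (le_trans h3 (lerD dmh h1))) _.
  have sm : xi + 2 * zeta + 2 * (dim%:R * eta) <= 3 by rewrite mulrA; exact: small.
  move: (dim%:R * mesh tau) (dim%:R * eta) mD sm de0 => e1 e2 mD sm de0.
  move: mD D8; move: (D : R) => D1 mD D8.
  have t1 : 3 <= 3 / 8 * D1 by lra.
  have t2 : xi + 2 * zeta + e2 <= 3 / 8 * D1 by lra.
  lra.
split; first by rewrite /vdist /gdist edistC; apply: (fin i j); left.
by apply: (fin j i); right.
Qed.

End Triples.

Section CheapTriples.
Context {R : realType}.
Variables (n dim J G0 g : nat) (s xi zeta : R).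
Hypothesis dim0 : (0 < dim)%N.
Hypothesis s0 : 0 < s.
Hypothesis hG : g.+1 = (2 ^ J * G0)%N.
Hypothesis sJ : (2 ^ J)%:R <= s.
Local Notation eta := (s / g.+1%:R).
Local Notation grid := (grid dim g).
Implicit Types (v : {ffun 'I_n -> grid}) (i j b : 'I_n) (tau : nat).
Hypothesis zetaE : zeta = 2 * dim%:R * eta.
Hypothesis xi0 : 0 <= xi.
Hypothesis small : xi + 2 * zeta + 2 * dim%:R * eta <= 3.

Local Notation vdist := (vdist s).

Definition glen v (f : {set 'I_n}) : R := eucl_len (fun i => gpos eta (v i)) f.

Definition joined_avoiding v j (t : R) i b : bool :=
  connect (adj [set f in complete_edges n | (j \notin f) && (glen v f <= t)]) i b.

(* Two ways for [ij] to be cheap: on the path from [i] to [j] at level [|ij|], either the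
   last edge [bj] has nearly the length of [ij], a thin annulus for [b], or removing [j]
   leaves a graph in which [i] and [b] become joined near level [|ij|], a thin annulus for
   [j] around [i]. *)
Definition cheap_last tau (q : 'I_dim -> nat) i j b : pred {ffun 'I_n -> grid} := fun v =>
  localized J G0 tau q i j b v && (vdist v i j - xi - 2 * zeta <= vdist v b j <= vdist v i j + 2 * zeta).

Definition cheap_rest tau (q : 'I_dim -> nat) i j b : pred {ffun 'I_n -> grid} := fun v =>
  [&& localized J G0 tau q i j b v, joined_avoiding v j (vdist v i j + 2 * zeta) i b &
    ~~ joined_avoiding v j (vdist v i j - xi - 2 * zeta) i b].

Lemma joined_avoiding_mono v j (t t' : R) i b : t <= t' ->
  joined_avoiding v j t i b -> joined_avoiding v j t' i b.
Proof.
move=> tt; apply: connect_adjS; apply/fintype.subsetP => f; rewrite !finset.inE.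
by move=> /and3P[-> -> h] /=; exact: le_trans tt.
Qed.

Lemma glenE v i j : i != j -> glen v [set i; j] = vdist v i j.
Proof. by move=> ij; rewrite /glen eucl_lenE. Qed.

(** Edges at [j] are excluded, so the level at which [i] and [b] become joined stays fixed while [j]
    moves. *)
Lemma joined_avoiding_upd v j h (t : R) i b :
  joined_avoiding (upd v j h) j t i b = joined_avoiding v j t i b.
Proof.
rewrite /joined_avoiding; congr (connect (adj _) i b); apply/setP => f; rewrite !finset.inE.
case: (boolP (#|f| == 2)) => //= /cards2P[a [c [ac ->]]].
case: (boolP (j \in _)) => //=; rewrite !finset.inE negb_or => /andP[ja jc].
by rewrite !glenE // /vdist !upd_ne // eq_sym.
Qed.

(** [b] precedes [j] on the path witnessing cheapness. If [bj] is below the lower threshold, then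
    [i] and [b] are not joined below it without [j], since [bj] would complete a forbidden path.
    Comparing two true lengths through the grid costs [2 * zeta]. *)
Lemma cheap_edge_triple (x : 'I_n -> 'I_dim -> R) v i j :
  (forall i k, `|x i k - gpos eta (v i) k| <= eta) -> i != j ->
  cheap_edge (complete_edges n) (eucl_len x) xi i j ->
  exists b (tau : 'I_J.+1) (q : {ffun 'I_dim -> 'I_(2 ^ tau)}),
    [/\ b != i, b != j & cheap_last tau (fun k => q k) i j b v || cheap_rest tau (fun k => q k) i j b v].
Proof.
move=> hx ij /andP[c1 c2].
have approx a c : a != c -> `|eucl_len x [set a; c] - vdist v a c| <= zeta.
  by move=> ac; rewrite eucl_lenE // zetaE; apply: edist_approx.
have up a c : a != c -> eucl_len x [set a; c] <= vdist v a c + zeta.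
  by move=> /approx; rewrite ler_norml => /andP[]; lra.
have dn a c : a != c -> vdist v a c <= eucl_len x [set a; c] + zeta.
  by move=> /approx; rewrite ler_norml => /andP[]; lra.
have [b [bj ib]] := connect_adj_last c1 ij.
move: bj; rewrite !finset.inE => /andP[/andP[bjij bj2] lbj].
have nbj : b != j by exact: card2_neq (eqP bj2).
have nbi : b != i by apply: contraNneq bjij => ->.
have hbj : vdist v b j <= vdist v i j + 2 * zeta.
  by have := dn _ _ nbj; have := up _ _ ij; lra.
have edge a c : a != c -> ((a != i) || (c != j)) && ((a != j) || (c != i)) ->
    vdist v a c <= vdist v i j - xi - 2 * zeta ->
    [set a; c] \in [set f in complete_edges n :\ [set i; j] | eucl_len x f <= eucl_len x [set i; j] - xi].
  move=> ac nac h; rewrite !finset.inE cards2 ac eqxx andbT.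
  apply/andP; split; last by have := dn _ _ ij; have := up _ _ ac; lra.
  apply: contraTneq nac => /set2_inj [[-> ->]|[-> ->]]; by rewrite !eqxx ?andbF.
have nosc : no_shortcut s xi zeta v i j.
  move=> p pi pj [h1 h2]; move/negP: c2; apply.
  apply: (@connect_trans _ _ p); apply: connect1; apply: edge => //.
  - by rewrite eq_sym.
  - by rewrite pj orbT ij.
  - by rewrite pi pj.
have [tau [q loc]] := localize dim0 s0 hG sJ zetaE small hbj nosc.
exists b, tau, q; split => //; rewrite /cheap_last /cheap_rest loc hbj andbT /=.
case: (lerP (vdist v i j - xi - 2 * zeta) (vdist v b j)) => //= hlt.
apply/andP; split.
  apply: connect_adjS ib; apply/fintype.subsetP => f; rewrite !finset.inE.
  move=> /andP[/andP[/andP[fij f2] lf] jf]; rewrite f2 jf /=.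
  move/cards2P: (f2) lf => [a [c [ac ->]]] lf; rewrite glenE //.
  by have := dn _ _ ac; have := up _ _ ij; lra.
apply: contraNN c2 => ib'; apply: (@connect_trans _ _ b); last first.
  apply: connect1; apply: edge => //; first by rewrite nbi nbj.
  exact: ltW.
apply: connect_adjS ib'; apply/fintype.subsetP => f; rewrite !finset.inE.
move=> /and3P[f2 jf gf]; have fij : f != [set i; j].
  by apply: contraNneq jf => ->; rewrite !finset.inE eqxx orbT.
rewrite fij f2 /=; move/cards2P: (f2) gf => [a [c [ac ->]]]; rewrite glenE // => gf.
by have := up _ _ ac; have := dn _ _ ij; lra.
Qed.

End CheapTriples.

Lemma bernoulli_exp {R : realFieldType} (e : R) k : 0 <= e <= 1 -> (1 - e) ^+ k * (1 + k%:R * e) <= 1.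
Proof.
move=> /andP[e0 e1]; elim: k => [|k ih]; first by rewrite expr0 mul0r addr0 mulr1.
apply: le_trans ih; rewrite exprS -mulrA mulrCA; apply: ler_wpM2l.
  by rewrite exprn_ge0 // subr_ge0.
by rewrite -natr1; have := ler0n R k; have := sqr_ge0 e; nra.
Qed.

(** Bernoulli's inequality, cubed. The third power beats the two cell volumes left in [sum_scales];
    a square would leave a logarithm of [n]. The constant is [6 ^ 3], the integer third of [n - 3]
    being at least [n / 6]. *)
Lemma one_sub_exp_le {R : realFieldType} (e : R) n : 0 < e <= 1 -> (12 <= n)%N ->
  (1 - e) ^+ (n - 3) <= 216 / (n%:R * e) ^+ 3.
Proof.
move=> /andP[e0 e1] n12; set k := ((n - 3) %/ 3)%N.
have f0 : 0 <= 1 - e <= 1 by rewrite subr_ge0 e1 lerBlDr lerDl ltW.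
have /andP[f00 f01] := f0.
have ke : 0 < n%:R * e by rewrite mulr_gt0 // ltr0n; lia.
have kn : n%:R / 6 <= k%:R :> R.
  rewrite ler_pdivrMr // -natrM ler_nat /k; lia.
have h1 : (1 - e) ^+ k <= 6 / (n%:R * e).
  rewrite ler_pdivlMr //; have := @bernoulli_exp _ e k; rewrite (ltW e0) e1 => /(_ isT) h.
  have : (1 - e) ^+ k * (n%:R * e) <= 6 * ((1 - e) ^+ k * (1 + k%:R * e)).
    rewrite [leRHS]mulrCA; apply: ler_wpM2l; first by rewrite exprn_ge0.
    by have := ler_wpM2r (ltW e0) kn; lra.
  by lra.
apply: (@le_trans _ _ ((1 - e) ^+ (k * 3))).
  by apply: ler_wiXn2l => //; rewrite /k; lia.
rewrite exprM; apply: le_trans (_ : (6 / (n%:R * e)) ^+ 3 <= _).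
  by apply: lerXn2r => //; rewrite nnegrE ?exprn_ge0 // divr_ge0 // ltW.
by rewrite expr_div_n -natrX.
Qed.

Section CellCounts.
Variables (dim g J G0 tau : nat) (q : 'I_dim -> nat).
Hypothesis hG : g.+1 = (2 ^ J * G0)%N.
Hypothesis tauJ : (tau <= J)%N.
Local Notation w := (width J G0 tau).
Local Notation W := (2 * reach dim + 1)%N.

Let w0 : (0 < w)%N.
Proof. exact: width_gt0 hG tau. Qed.

Lemma card_near_interval k :
  (#|[pred a : 'I_g.+1 | (q k * w <= a + reach dim * w)%N && (a <= q k * w + reach dim * w)%N]| <= W * w)%N.
Proof.
apply: (@card_ord_interval _ _ (q k * w - reach dim * w)%N) => a /= /andP[h1 h2].
by move: w0 h1 h2; move: (q k * w)%N (reach dim) (nat_of_ord a) => Q r x; clear; nia.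
Qed.

Lemma card_near_cell : (#|near_cell J G0 tau q : pred (grid dim g)| <= (W * w) ^ dim)%N.
Proof.
rewrite -[X in (X <= _)%N](cardsE (near_cell J G0 tau q)).
have -> : [set h in (near_cell J G0 tau q : pred (grid dim g))] =
   [set h : grid dim g | [forall k, [pred a : 'I_g.+1 | (q k * w <= a + reach dim * w)%N && (a <= q k * w + reach dim * w)%N] (h k)]].
  by apply/setP => h; rewrite !finset.inE.
rewrite (card_grid_family (fun k => [pred a : 'I_g.+1 | (q k * w <= a + reach dim * w)%N && (a <= q k * w + reach dim * w)%N])).
rewrite -[X in (_ <= _ ^ X)%N]card_ord -prod_nat_const; apply: leq_prod => k _; exact: card_near_interval.
Qed.

Lemma card_in_cell : (forall k, q k < 2 ^ tau)%N ->
  (w ^ dim <= #|in_cell J G0 tau q : pred (grid dim g)|)%N.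
Proof.
move=> hq; rewrite -[X in (_ <= X)%N](cardsE (in_cell J G0 tau q)).
have -> : [set h in (in_cell J G0 tau q : pred (grid dim g))] =
   [set h : grid dim g | [forall k, [pred a : 'I_g.+1 | (a %/ w == q k)%N] (h k)]].
  by apply/setP => h; rewrite !finset.inE.
rewrite (card_grid_family (fun k => [pred a : 'I_g.+1 | (a %/ w == q k)%N])).
rewrite -[X in (_ ^ X <= _)%N]card_ord -prod_nat_const; apply: leq_prod => k _.
have lt (r : 'I_w) : (q k * w + r < g.+1)%N.
  rewrite -(widthE hG tauJ); apply: (@leq_trans ((q k).+1 * w)%N).
    by rewrite mulSn addnC ltn_add2r.
  by rewrite leq_mul2r hq orbT.
pose f (r : 'I_w) : 'I_g.+1 := Ordinal (lt r).
have finj : injective f by move=> r r' /(congr1 val) /= /addnI ?; apply: val_inj.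
rewrite -[X in (X <= _)%N]card_ord -(card_imset _ finj).
apply: subset_leq_card; apply/fintype.subsetP => _ /imsetP[r _ ->].
by rewrite inE /= divnMDl // divn_small ?addn0.
Qed.

End CellCounts.

(** * Probability of localized events and the sum over scales *)

Section LocalizedBound.
Context {R : realType}.
Variables (n dim J G0 g : nat) (s y : R).
Hypothesis dim0 : (0 < dim)%N.
Hypothesis s0 : 0 < s.
Hypothesis hG : g.+1 = (2 ^ J * G0)%N.
Hypothesis sJ : (2 ^ J)%:R <= s.
Local Notation eta := (s / g.+1%:R).
Hypothesis y0 : 0 <= y.
Hypothesis etay : eta <= dim%:R * y.
Local Notation grid := (grid dim g).
Implicit Types (v : {ffun 'I_n -> grid}) (tau : nat).

Definition cell_vol tau : R := (2 ^ tau)%:R ^- dim.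
(** [4 dim ^ 2] stems from the annulus count, and each of the three points contributes [2 reach + 1]
    to the power [dim]. *)
Definition loc_const : R := 4 * dim%:R ^+ 2 * (2 * reach dim + 1)%:R ^+ (3 * dim).

Lemma cell_vol_gt0 tau : 0 < cell_vol tau.
Proof. by rewrite invr_gt0 exprn_gt0 // ltr0n expn_gt0. Qed.

Lemma cell_vol_le1 tau : cell_vol tau <= 1.
Proof. by rewrite invf_le1 ?exprn_gt0 ?ltr0n ?expn_gt0 // exprn_ege1 // ler1n expn_gt0. Qed.

(** Three points near a cell have probability of order [cell_vol ^ 3]; confining [p] to an annulus
    of width [y] gains a factor of order [y], because cells have side at least 1. Emptiness of the
    cell supplies the last factor. *)
Lemma Ew_localized (Ev : pred {ffun 'I_n -> grid}) tau (q : 'I_dim -> nat) (p i1 i2 : 'I_n) :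
  (tau <= J)%N -> (forall k, q k < 2 ^ tau)%N -> p != i1 -> p != i2 -> i1 != i2 ->
  (forall v, Ev v -> [&& near_cell J G0 tau q (v p), near_cell J G0 tau q (v i1), near_cell J G0 tau q (v i2) &
     (tau < J)%N ==> [forall r, (r != p) && (r != i1) && (r != i2) ==> ~~ in_cell J G0 tau q (v r)]]) ->
  (forall v, exists z, forall h h', Ev (upd v p h) -> Ev (upd v p h') ->
     gdist eta h z - gdist eta h' z <= y) ->
  Ew (@unif R n dim g) (fun v => (Ev v)%:R) <=
  loc_const * y * cell_vol tau ^+ 3 * (if (tau < J)%N then (1 - cell_vol tau) ^+ (n - 3) else 1).
Proof.
move=> tJ hq pi1 pi2 i12 hEv hz.
have eta0 : 0 < eta by rewrite divr_gt0.
set w := width J G0 tau; set W := (2 * reach dim + 1)%N.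
have w0 : (0 < w)%N by exact: width_gt0 hG tau.
have W0 : (0 < W)%N by rewrite /W addn1.
pose a : R := 2 * dim%:R * ((W * w)%:R ^+ dim.-1 * (dim%:R * y / eta + 1)).
have a0 : 0 <= a.
  by rewrite /a !mulr_ge0 ?exprn_ge0 // addr_ge0 // divr_ge0 ?mulr_ge0 // ltW.
pose Q : pred grid := if (tau < J)%N then in_cell J G0 tau q else pred0.
pose e := cell_vol tau; have e0 : 0 < e := cell_vol_gt0 tau.
pose N : R := #|{: grid}|%:R.
have NE : N = ((2 ^ tau)%:R * w%:R) ^+ dim.
  by rewrite /N card_ffun !card_ord -natrM (widthE hG tJ) natrX.
have Ne : N * e = w%:R ^+ dim.
  by rewrite NE /e /cell_vol exprMn mulrAC mulfV ?mul1r // expf_neq0 // pnatr_eq0 expn_eq0.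
have N0 : 0 < N by rewrite NE exprn_gt0 // mulr_gt0 // ltr0n // expn_gt0.
have QN : #|Q|%:R / N <= 1 by rewrite ler_pdivrMr // mul1r ler_nat max_card.
apply: le_trans (Ew_moving (Rg := near_cell J G0 tau q) (Q := Q) pi1 pi2 i12 a0 _ _) _.
- move=> v /hEv /and4P[_ -> -> /implyP h]; rewrite /Q.
  case: ifP => [tJ'|_]; first exact: h.
  by apply/forallP => r; apply/implyP.
- move=> v; have [z hz'] := hz v.
  apply: (card_annulus eta0 (z := z) (F := fun k => [pred b : 'I_g.+1 |
    (q k * w <= b + reach dim * w)%N && (b <= q k * w + reach dim * w)%N])) => //.
  + move=> h; rewrite finset.inE => /hEv /and4P[+ _ _ _]; rewrite upd_at => /forallP hh k.
    exact: hh.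
  + by move=> k; exact: card_near_interval.
  by move=> h h'; rewrite !finset.inE; exact: hz'.
rewrite -/N -/e.
have b1 : a / N <= 4 * dim%:R ^+ 2 * W%:R ^+ dim * y * e.
  rewrite ler_pdivrMr // -[leRHS]mulrA [e * N]mulrC Ne.
  have h1 : dim%:R * y / eta + 1 <= 2 * dim%:R * y * w%:R.
    have : 1 <= dim%:R * y / eta by rewrite ler_pdivlMr // mul1r.
    have : dim%:R * y / eta <= dim%:R * y * w%:R.
      apply: ler_wpM2l; first by rewrite mulr_ge0.
      rewrite invf_div ler_pdivrMr // -(widthE hG tJ) natrM mulrC; apply: ler_wpM2l => //.
      by apply: le_trans sJ; rewrite ler_nat leq_pexp2l.
    by lra.
  apply: (@le_trans _ _ (2 * dim%:R * ((W * w)%:R ^+ dim.-1 * (2 * dim%:R * y * w%:R)))).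
    by rewrite /a; apply: ler_wpM2l; [rewrite mulr_ge0|apply: ler_wpM2l; [rewrite exprn_ge0|]].
  have -> : 2 * dim%:R * ((W * w)%:R ^+ dim.-1 * (2 * dim%:R * y * w%:R)) =
    4 * dim%:R ^+ 2 * W%:R ^+ dim.-1 * y * w%:R ^+ dim :> R.
    have -> : w%:R ^+ dim = w%:R ^+ dim.-1 * w%:R :> R by rewrite -exprSr prednK.
    by rewrite natrM exprMn; ring.
  apply: ler_wpM2r; first by rewrite exprn_ge0.
  apply: ler_wpM2r => //; apply: ler_wpM2l; first by rewrite mulr_ge0 ?exprn_ge0.
  by apply: ler_weXn2l; rewrite ?ler1n ?leq_pred.
have b2 : #|near_cell J G0 tau q : pred grid|%:R / N <= W%:R ^+ dim * e.
  rewrite ler_pdivrMr // -mulrA [e * N]mulrC Ne -exprMn -natrM -natrX ler_nat.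
  exact: card_near_cell.
have b3 : (1 - #|Q|%:R / N) ^+ (n - 3) <= if (tau < J)%N then (1 - e) ^+ (n - 3) else 1.
  have q0 : 0 <= 1 - #|Q|%:R / N by rewrite subr_ge0.
  rewrite /Q in q0 *; case: ifP q0 => [tJ'|_] q0; last first.
    by rewrite exprn_ile1 // lerBlDr lerDl divr_ge0 // ltW.
  apply: lerXn2r => //; first by rewrite nnegrE subr_ge0 cell_vol_le1.
  rewrite lerB // ler_pdivlMr // mulrC Ne -natrX ler_nat; exact: card_in_cell.
have c1 : 0 <= a / N by rewrite divr_ge0 // ltW.
have c2 : 0 <= #|near_cell J G0 tau q : pred grid|%:R / N by rewrite divr_ge0 // ltW.
have c3 : 0 <= 1 - #|Q|%:R / N by rewrite subr_ge0.
have -> : loc_const * y * e ^+ 3 = 4 * dim%:R ^+ 2 * W%:R ^+ dim * y * e * (W%:R ^+ dim * e) ^+ 2.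
  by rewrite /loc_const -/W mulnC exprM exprMn; ring.
apply: (ler_pM _ _ _ b3).
- by rewrite mulr_ge0 // sqr_ge0.
- by rewrite exprn_ge0.
apply: (ler_pM c1 (sqr_ge0 _) b1).
apply: lerXn2r => //; rewrite nnegrE; apply: mulr_ge0; last exact: ltW.
by rewrite exprn_ge0.
Qed.

End LocalizedBound.

Lemma sum_pow2_exp_le (R : realDomainType) dim J : (0 < dim)%N ->
  \sum_(tau < J) (2 ^ tau)%:R ^+ dim <= (2 ^ J)%:R ^+ dim :> R.
Proof.
move=> dim0; elim: J => [|J ih]; first by rewrite big_ord0 exprn_ge0.
rewrite big_ord_recr /=; apply: le_trans (lerD ih (lexx _)) _.
rewrite expnS natrM exprMn -mulr2n -[leLHS]mulr_natl; apply: ler_wpM2r; first by rewrite exprn_ge0.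
by case: dim dim0 {ih} => // m _; rewrite exprS ler_peMr // exprn_ege1 // ler1n.
Qed.

Section CheapPairs.
Context {R : realType}.
Variables (n dim J G0 g : nat) (s xi zeta : R).
Hypothesis dim0 : (0 < dim)%N.
Hypothesis s0 : 0 < s.
Hypothesis hG : g.+1 = (2 ^ J * G0)%N.
Hypothesis sJ : (2 ^ J)%:R <= s.
Hypothesis Js : s <= (2 ^ J.+1)%:R.
Hypothesis sn : s ^+ dim = n%:R.
Hypothesis n12 : (12 <= n)%N.
Local Notation eta := (s / g.+1%:R).
Local Notation grid := (grid dim g).
Implicit Types (v : {ffun 'I_n -> grid}) (i j b : 'I_n) (tau : nat).
Hypothesis zeta0 : 0 <= zeta.
Hypothesis xi0 : 0 <= xi.
Local Notation y := (xi + 4 * zeta).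
Hypothesis etay : eta <= dim%:R * y.

Let y0 : 0 <= y. Proof. by rewrite addr_ge0 // mulr_ge0. Qed.

(** [216] bounds all scales with an empty cell, and [4 ^ dim] the finest scale, where [cell_vol] is
    at most [2 ^ dim / n]. *)
Definition scale_const : R := 216 + 4 ^+ dim.

Lemma scale_const_ge0 : 0 <= scale_const.
Proof. by rewrite addr_ge0 // exprn_ge0. Qed.

(** Scale [tau] has [1 / cell_vol] cells, so two volume factors remain; against the inverse cube
    from [one_sub_exp_le] the terms grow like [(2 ^ tau) ^ dim], and their sum is at most of order
    [n] times [n ^- 3]. *)
Lemma sum_scales (c : R) : 0 <= c ->
  \sum_(tau < J.+1) \sum_(q : {ffun 'I_dim -> 'I_(2 ^ tau)})
     c * cell_vol dim tau ^+ 3 * (if (tau < J)%N then (1 - cell_vol dim tau) ^+ (n - 3) else 1)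
  <= c * scale_const / n%:R ^+ 2.
Proof.
move=> c0; have n0 : 0 < n%:R :> R by rewrite ltr0n; lia.
have cv0 tau := @cell_vol_gt0 R dim tau.
have inner tau (x : R) : \sum_(q : {ffun 'I_dim -> 'I_(2 ^ tau)}) c * cell_vol dim tau ^+ 3 * x
    = c * (cell_vol dim tau ^+ 2 * x).
  rewrite sumr_const card_ffun !card_ord -[LHS]mulr_natl natrX.
  have -> : (2 ^ tau)%:R ^+ dim = (cell_vol dim tau)^-1 :> R by rewrite /cell_vol invrK.
  by field; rewrite gt_eqF.
under eq_bigr do rewrite inner; rewrite -mulr_sumr -mulrA; apply: ler_wpM2l => //.
rewrite big_ord_recr /= ltnn mulr1 /scale_const mulrDl; apply: lerD.
  apply: (@le_trans _ _ (\sum_(tau < J) 216 / n%:R ^+ 3 * (2 ^ tau)%:R ^+ dim)).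
    apply: ler_sum => tau _; rewrite ltn_ord.
    have := @one_sub_exp_le R (cell_vol dim tau) n.
    rewrite cv0 cell_vol_le1 => /(_ isT n12) h.
    apply: (le_trans (ler_wpM2l (sqr_ge0 _) h)).
    have -> : (2 ^ tau)%:R ^+ dim = (cell_vol dim tau)^-1 :> R by rewrite /cell_vol invrK.
    rewrite le_eqVlt; apply/orP; left; apply/eqP; field.
    by rewrite !gt_eqF.
  rewrite -mulr_sumr; apply: (@le_trans _ _ (216 / n%:R ^+ 3 * n%:R)).
    apply: ler_wpM2l; first by rewrite divr_ge0 // exprn_ge0.
    apply: le_trans (sum_pow2_exp_le _ _ dim0) _.
    by rewrite -sn; apply: lerXn2r; rewrite // nnegrE ltW.
  by rewrite le_eqVlt; apply/orP; left; apply/eqP; field; rewrite gt_eqF.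
have -> : 4 ^+ dim / n%:R ^+ 2 = (2 ^+ dim / n%:R) ^+ 2 :> R.
  have -> : 4 = 2 ^+ 2 :> R by rewrite -natrX.
  by rewrite expr_div_n -!exprM mulnC.
apply: lerXn2r; rewrite ?nnegrE ?divr_ge0 ?exprn_ge0 ?(ltW (cv0 _)) //.
rewrite /cell_vol ler_pdivlMr // mulrC ler_pdivrMr ?exprn_gt0 ?ltr0n ?expn_gt0 //.
rewrite -sn -exprMn -natrM -expnS; apply: lerXn2r; rewrite ?nnegrE // ltW //.
Qed.

Lemma Ew_cheap_last tau (q : 'I_dim -> nat) i j b : (tau <= J)%N -> (forall k, q k < 2 ^ tau)%N ->
  b != i -> b != j -> i != j ->
  Ew (@unif R n dim g) (fun v => (cheap_last J G0 s xi zeta tau q i j b v)%:R) <=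
  loc_const dim * y * cell_vol dim tau ^+ 3 * (if (tau < J)%N then (1 - cell_vol dim tau) ^+ (n - 3) else 1).
Proof.
move=> tJ hq bi bj ij; apply: (Ew_localized dim0 s0 hG sJ y0 etay tJ hq bi bj ij).
  move=> v /andP[/and4P[-> -> -> h] _]; apply/implyP => tJ'.
  move: h; rewrite tJ' => /forallP h; apply/forallP => r; apply/implyP => /andP[/andP[_ ri] rj].
  by have := h r; rewrite ri rj.
(* [b] moves and [j] stays: the distance to [j] varies in a window of width [y]. *)
move=> v; exists (v j) => h h' /andP[_ /andP[_ h1]] /andP[_ /andP[h2 _]].
move: h1 h2; rewrite /vdist !upd_at !upd_ne 1?eq_sym // => h1 h2.
have := le_trans h1 (lexx _); lra.
Qed.

Lemma Ew_cheap_rest tau (q : 'I_dim -> nat) i j b : (tau <= J)%N -> (forall k, q k < 2 ^ tau)%N ->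
  b != i -> b != j -> i != j ->
  Ew (@unif R n dim g) (fun v => (cheap_rest J G0 s xi zeta tau q i j b v)%:R) <=
  loc_const dim * y * cell_vol dim tau ^+ 3 * (if (tau < J)%N then (1 - cell_vol dim tau) ^+ (n - 3) else 1).
Proof.
move=> tJ hq bi bj ij; have ji : j != i by rewrite eq_sym.
have jb : j != b by rewrite eq_sym.
have ib : i != b by rewrite eq_sym.
apply: (Ew_localized dim0 s0 hG sJ y0 etay tJ hq ji jb ib).
  move=> v /and3P[/and4P[-> -> -> h] _ _]; apply/implyP => tJ'.
  move: h; rewrite tJ' => /forallP h; apply/forallP => r; apply/implyP => /andP[/andP[rj ri] _].
  by have := h r; rewrite ri rj.
(* [j] moves: positions whose distances to [i] differ by more than [y] would contradict the
   monotonicity of [joined_avoiding] in its level. *)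
move=> v; exists (v i) => h h' /and3P[_ _ h1] /and3P[_ h2 _].
move: h1 h2; rewrite !joined_avoiding_upd /vdist !upd_at !upd_ne // => h1 h2.
rewrite leNgt; apply: contraNN h1 => lt; apply: joined_avoiding_mono h2.
rewrite /gdist edistC -/(gdist _ _ _) (edistC (gpos _ (v i))).
by move: lt; rewrite /gdist; lra.
Qed.

Definition cheap_pair v i j : bool :=
  [exists b, [exists tau : 'I_J.+1, [exists q : {ffun 'I_dim -> 'I_(2 ^ tau)},
    [&& b != i, b != j & cheap_last J G0 s xi zeta tau (fun k => q k) i j b v ||
                         cheap_rest J G0 s xi zeta tau (fun k => q k) i j b v]]]].

(** There are [n] choices for each of [i], [j] and [b], against [n ^- 2] from [sum_scales]; the
    factor 2 is for the two ways of being cheap. *)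
Lemma Ew_cheap_pairs :
  Ew (@unif R n dim g) (fun v => \sum_i \sum_(j | i != j) (cheap_pair v i j)%:R) <=
  2 * loc_const dim * scale_const * y * n%:R.
Proof.
have n0 : 0 < n%:R :> R by rewrite ltr0n; lia.
set c := loc_const dim * y.
have c0 : 0 <= c.
  by rewrite /c /loc_const !mulr_ge0 ?exprn_ge0.
have per i j : i != j -> Ew (@unif R n dim g) (fun v => (cheap_pair v i j)%:R) <=
    2 * c * scale_const / n%:R.
  move=> ij.
  apply: (@le_trans _ _ (Ew (@unif R n dim g) (fun v => \sum_(b | (b != i) && (b != j))
    \sum_(tau < J.+1) \sum_(q : {ffun 'I_dim -> 'I_(2 ^ tau)})
      ((cheap_last J G0 s xi zeta tau (fun k => q k) i j b v)%:R +
       (cheap_rest J G0 s xi zeta tau (fun k => q k) i j b v)%:R)))).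
    apply: ler_Ew => [|v]; first by move=> r x; exact: unif_ge0.
    have sum0 (b : 'I_n) (tau : 'I_J.+1) (P : pred {ffun 'I_dim -> 'I_(2 ^ tau)}) : 0 <= \sum_(q | P q)
      ((cheap_last J G0 s xi zeta tau (fun k => q k) i j b v)%:R +
       (cheap_rest J G0 s xi zeta tau (fun k => q k) i j b v)%:R) :> R.
      by apply: sumr_ge0 => q _; rewrite addr_ge0.
    case: (boolP (cheap_pair v i j)) => [|_]; last first.
      by apply: sumr_ge0 => b _; apply: sumr_ge0 => tau _; exact: sum0.
    move=> /existsP[b /existsP[tau /existsP[q /and3P[bi bj h]]]].
    rewrite (bigD1 b) ?bi //= (bigD1 tau) //= (bigD1 q) //= -!addrA.
    apply: (@le_trans _ _ ((cheap_last J G0 s xi zeta tau (fun k => q k) i j b v)%:R +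
       (cheap_rest J G0 s xi zeta tau (fun k => q k) i j b v)%:R)).
      by case/orP: h => ->; rewrite ?lerDl ?lerDr.
    rewrite -[leLHS]addr0 -!addrA !lerD2l !addr_ge0 ?sum0 //.
      by apply: sumr_ge0 => tau' _; exact: sum0.
    by apply: sumr_ge0 => b' _; apply: sumr_ge0 => tau' _; exact: sum0.
  rewrite Ew_sum; apply: (@le_trans _ _ (\sum_(b | (b != i) && (b != j)) 2 * c * scale_const / n%:R ^+ 2)).
    apply: ler_sum => b /andP[bi bj]; rewrite Ew_sum.
    apply: le_trans (@sum_scales (2 * c) _); last by rewrite mulr_ge0.
    apply: ler_sum => tau _; rewrite Ew_sum; apply: ler_sum => q _; rewrite EwD.
    have tJ : (tau <= J)%N by rewrite -ltnS.
    have hq k : (q k < 2 ^ tau)%N by [].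
    have := Ew_cheap_last tJ hq bi bj ij; have := Ew_cheap_rest tJ hq bi bj ij.
    rewrite -/c => h1 h2; apply: le_trans (lerD h2 h1) _.
    by rewrite -mulr2n -[leLHS]mulr_natl !mulrA.
  rewrite sumr_const -[leLHS]mulr_natl; apply: (@le_trans _ _ (n%:R * (2 * c * scale_const / n%:R ^+ 2))).
    apply: ler_wpM2r; first by rewrite divr_ge0 ?exprn_ge0 // !mulr_ge0 // scale_const_ge0.
    by rewrite ler_nat -[X in (_ <= X)%N]card_ord max_card.
  by rewrite le_eqVlt; apply/orP; left; apply/eqP; field; rewrite gt_eqF.
rewrite Ew_sum; apply: (@le_trans _ _ (\sum_(i < n) 2 * c * scale_const)).
  apply: ler_sum => i _; rewrite Ew_sum.
  apply: (@le_trans _ _ (\sum_(j | i != j) 2 * c * scale_const / n%:R)).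
    by apply: ler_sum => j; exact: per.
  rewrite sumr_const -[leLHS]mulr_natl; apply: (@le_trans _ _ (n%:R * (2 * c * scale_const / n%:R))).
    apply: ler_wpM2r; first by rewrite divr_ge0 // !mulr_ge0 // scale_const_ge0.
    by rewrite ler_nat -[X in (_ <= X)%N]card_ord max_card.
  by rewrite mulrC divfK ?gt_eqF.
rewrite sumr_const card_ord -[leLHS]mulr_natl /c le_eqVlt; apply/orP; left; apply/eqP; ring.
Qed.

End CheapPairs.

Definition side {R : realType} (n dim : nat) : R := n%:R `^ (dim%:R)^-1.

Lemma side_exp {R : realType} n dim : (0 < dim)%N -> side n dim ^+ dim = n%:R :> R.
Proof.
move=> dim0; rewrite /side -powR_mulrn ?powR_ge0 // -powRrM mulVf ?pnatr_eq0 -?lt0n //.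
by rewrite powRr1.
Qed.

Lemma side_gt0 {R : realType} n dim : (0 < n)%N -> 0 < side n dim :> R.
Proof. by move=> n0; rewrite powR_gt0 // ltr0n. Qed.

Lemma side_ge1 {R : realType} n dim : (0 < n)%N -> (0 < dim)%N -> 1 <= side n dim :> R.
Proof.
move=> n0 dim0; rewrite leNgt; apply/negP => s1.
have : side n dim ^+ dim < 1 :> R by rewrite exprn_ilt1 -?lt0n // ltW // side_gt0.
by rewrite side_exp // ltrn1 ltnNge n0.
Qed.

Lemma dyadic_bracket {R : realType} (s : R) : 1 <= s ->
  exists J, (2 ^ J)%:R <= s <= (2 ^ J.+1)%:R.
Proof.
move=> s1; have s0 : 0 <= s by exact: le_trans ler01 s1.
set t := Num.truncn s; have t0 : (0 < t)%N by rewrite Num.Theory.truncn_gt0.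
have /andP[h1 h2] := trunc_log_bounds (isT : (1 < 2)%N) t0.
exists (trunc_log 2 t); apply/andP; split.
  by apply: (@le_trans _ _ t%:R); rewrite ?ler_nat // Num.Theory.truncn_le.
by apply: ltW; apply: (lt_le_trans (Num.Theory.truncnS_gt s)); rewrite ler_nat.
Qed.

Section EuclideanLowerBound.
Context {d : measure_display} {Omega : measurableType d} {R : realType}.
Variables (P : nat -> probability Omega R) (dim : nat).
Variable X : forall n, 'I_n -> 'I_dim -> Omega -> R.
Hypothesis dim0 : (0 < dim)%N.
Hypothesis mX : forall n i k, measurable_fun setT (@X n i k).
Hypothesis law : forall n, (0 < n)%N -> forall i k (B : set R), measurable B ->
  (P n (@X n i k @^-1` B) = (@lebesgue_measure R (B `&` `[0%R, side n dim]) * ((side n dim)^-1)%:E)%E)%classic.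
Hypothesis indep : forall n, mutually_independent (P n) [set: 'I_n * 'I_dim] (fun ik => @X n ik.1 ik.2).

Let Eeps (delta : R) (n : nat) : \bar R :=
  (\int[P n]_w eps (complete_edges n) (eucl_len (fun i k => @X n i k w)) delta)%E.

Lemma model2_lower : exists c d0 : R, [/\ 0 < c, 0 < d0 & forall delta, 0 < delta < d0 ->
  \forall n \near \oo%classic, ((c * delta ^+ 2)%:E <= Eeps delta n)%E].
Proof.
have dimR : 1 <= dim%:R :> R by rewrite ler1n.
have [C3 C3E C30] : exists2 C3 : R, 2 * loc_const dim * scale_const dim = C3 & 0 < C3.
  eexists; first by [].
  have l0 : 0 < loc_const dim :> R.
    by rewrite /loc_const !mulr_gt0 ?exprn_gt0 ?ltr0n // addn1.
  have c0 : 0 < scale_const dim :> R by rewrite /scale_const addr_gt0 ?exprn_gt0.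
  by apply: mulr_gt0 => //; apply: mulr_gt0.
exists (32 * C3)^-1, (12 * C3); split; rewrite ?invr_gt0 ?mulr_gt0 //.
(* As [xi + 4 zeta <= 2 xi], the expected number of cheap pairs is at most
   [2 C3 xi n = delta n / 4]. The bound [12 C3] on [delta] gives [xi <= 3 / 2], as [small]
   requires. *)
move=> delta /andP[delta0 deltad]; pose xi := delta / (8 * C3).
have xi0 : 0 < xi by rewrite divr_gt0 ?mulr_gt0.
have xi1 : xi <= 3 / 2.
  by rewrite ler_pdivrMr ?mulr_gt0 //; lra.
near=> n.
have n12 : (12 <= n)%N by near: n; exact: nbhs_infty_ge.
have n0 : (0 < n)%N by exact: leq_trans n12.
have nR : 0 < n%:R :> R by rewrite ltr0n.
set s : R := side n dim.
have s1 : 1 <= s by exact: side_ge1.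
have s0 : 0 < s by exact: lt_le_trans ltr01 s1.
have [J /andP[sJ Js]] := dyadic_bracket s1.
(* The grid is refined until [dim eta], the scale of all rounding errors, is at most an eighth of
   [xi]. *)
pose G0 := (Num.truncn (8 * dim%:R * s / xi)).+1.
pose g := (2 ^ J * G0).-1.
have hG : g.+1 = (2 ^ J * G0)%N by rewrite prednK // muln_gt0 expn_gt0.
pose eta := s / g.+1%:R.
have eta0 : 0 < eta by rewrite divr_gt0.
have eta8 : 8 * (dim%:R * eta) <= xi.
  rewrite /eta !mulrA ler_pdivrMr // [xi * _]mulrC -ler_pdivrMr //.
  apply: (@le_trans _ _ G0%:R); first by apply: ltW; exact: Num.Theory.truncnS_gt.
  by rewrite ler_nat hG leq_pmull // expn_gt0.
pose zeta := 2 * dim%:R * eta.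
have zeta0 : 0 <= zeta by rewrite !mulr_ge0 // ltW.
have zeta4 : 4 * zeta <= xi by rewrite /zeta; move: eta8; rewrite -mulrA; lra.
have etad : eta <= dim%:R * eta by rewrite ler_peMl // ltW.
have small : xi + 2 * zeta + 2 * dim%:R * (s / g.+1%:R) <= 3.
  by rewrite -/eta -/zeta; lra.
have etay : s / g.+1%:R <= dim%:R * (xi + 4 * zeta).
  rewrite -/eta; apply: (@le_trans _ _ (xi + 4 * zeta)); first by move: etad eta8 zeta0; lra.
  by rewrite ler_peMl //; move: zeta0 xi0; lra.
have EF := Ew_cheap_pairs dim0 s0 hG sJ Js (side_exp n dim0) n12 zeta0 (ltW xi0) etay.
pose F v : R := \sum_(i < n) \sum_(j < n | i != j) (@cheap_pair R n dim J G0 g s xi zeta v i j)%:R.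
have {}EF : Ew (@unif R n dim g) F <= delta * n%:R / 4.
  apply: (le_trans EF); rewrite C3E; apply: (@le_trans _ _ (C3 * (2 * xi) * n%:R)).
    apply: ler_wpM2r => //; apply: ler_wpM2l; first exact: ltW.
    by lra.
  by rewrite le_eqVlt; apply/orP; left; apply/eqP; rewrite /xi; field; rewrite gt_eqF.
have F0 v : 0 <= F v by apply: sumr_ge0 => i _; apply: sumr_ge0.
have p0 := @unif_ge0 R n dim g; have p1 := @sum_unif R n dim g.
pose S := [pred v : {ffun 'I_n -> grid dim g} | ~~ (delta * n%:R / 2 <= F v)].
have PS : 1 / 2 <= Ew (@unif R n dim g) (fun v => (S v)%:R).
  rewrite /S /= Ew_negb //.
  have : Ew (@unif R n dim g) (fun v => (delta * n%:R / 2 <= F v)%R%:R) <= 1 / 2.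
    apply: le_trans (Ew_markov p0 F0 _) _; first by rewrite divr_gt0 // mulr_gt0.
    by rewrite ler_pdivrMr ?divr_gt0 ?mulr_gt0 //; lra.
  lra.
have lawn := @law n n0.
have [mS PSE] := conf_event s0 (@mX n) lawn (@indep n) S.
have [mN PN] := cube_full (@mX n) lawn.
set N := [set w | exists _, _]%classic in mN PN.
set A := [set w | _]%classic in mS PSE.
have mAN : measurable (A `\` N)%classic by exact: measurableD.
have PAN : P n (A `\` N)%classic = P n A.
  rewrite (measureDI (P n) mS mN) [X in (_ + X)%E](_ : _ = 0%E) ?adde0 //.
  apply: (subset_measure0 _ mN _ PN); first exact: measurableI.
  by move=> w [].
have main w : (A `\` N)%classic w ->
    ((xi * delta / 2)%:E <= eps (complete_edges n) (eucl_len (fun i k => @X n i k w)) delta)%E.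
  move=> [Sw Nw]; set v := conf g (@X n) s w.
  pose pairs := [set ij : 'I_n * 'I_n | (ij.1 != ij.2) && cheap_pair J G0 s xi zeta v ij.1 ij.2].
  apply: (eps_ge (B := [set [set ij.1; ij.2] | ij in pairs])); rewrite ?card_ord //.
  - exact: ltW.
  - move=> a b _ nab h; apply/imsetP; exists (a, b) => //; rewrite finset.inE nab /=.
    have hx i k : `|@X n i k w - gpos (s / g.+1%:R) (v i) k| <= s / g.+1%:R.
      apply: conf_near => //; apply/negPn/negP => hn; apply: Nw; by exists (i, k).
    have [c [tau [q [h1 h2 h3]]]] := cheap_edge_triple dim0 s0 hG sJ erefl small hx nab h.
    apply/existsP; exists c; apply/existsP; exists tau; apply/existsP; exists q.
    by rewrite h1 h2.
  rewrite leNgt; apply: contraNN Sw => h; apply: ltW; apply: (lt_le_trans h).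
  apply: (@le_trans _ _ #|pairs|%:R); first by rewrite ler_nat leq_imset_card.
  rewrite /F pair_big_dep /= -natr_sum ler_nat -sum1dep_card big_mkcondr /=.
  by apply: leq_sum => ij _; case: (cheap_pair _ _ _ _ _ _ _ _).
apply: le_trans (integral_ge_event (P n) mAN _ _ main).
- rewrite PAN PSE -EFinM lee_fin; apply: (@le_trans _ _ (xi * delta / 2 * (1 / 2))).
    rewrite le_eqVlt; apply/orP; left; apply/eqP; rewrite /xi; field.
    by rewrite !gt_eqF.
  by rewrite ler_wpM2l // divr_ge0 // mulr_ge0 // ltW.
- by rewrite divr_ge0 // mulr_ge0 // ltW.
- by move=> w; exact: eps_ge0.
Unshelve. all: by end_near. Qed.

End EuclideanLowerBound.

(** * Upper bound for Euclidean points *)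

Section CompleteGraph.
Variables (n : nat).
Implicit Types (T : {set {set 'I_n}}).

Lemma complete_edge (i j : 'I_n) : i != j -> [set i; j] \in complete_edges n.
Proof. by move=> ij; rewrite finset.inE cards2 ij. Qed.

Lemma complete_edges_card e : e \in complete_edges n -> #|e| = 2.
Proof. by rewrite finset.inE => /eqP. Qed.

Lemma complete_connected (i j : 'I_n) : connect (adj (complete_edges n)) i j.
Proof.
have [->|ij] := eqVneq i j; first exact: connect0.
by apply: connect1; exact: complete_edge.
Qed.

Lemma tree_misses_triangle T (a b c : 'I_n) : spanning_tree (complete_edges n) T ->
  a != b -> b != c -> a != c ->
  exists e, [/\ e \in complete_edges n, e \notin T & e \subset [set a; b; c]].
Proof.
move=> /spanning_treeP[_ _ _ Ta] ab bc ac.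
case: (boolP ([set a; b] \in T)) => [abT|]; last first.
  by exists [set a; b]; split; rewrite ?complete_edge // finset.subsetUl.
case: (boolP ([set b; c] \in T)) => [bcT|]; last first.
  exists [set b; c]; split; rewrite ?complete_edge //.
  by apply/fintype.subsetP => x; rewrite !finset.inE => /orP[]->; rewrite ?orbT.
case: (boolP ([set a; c] \in T)) => [acT|]; last first.
  exists [set a; c]; split; rewrite ?complete_edge //.
  by apply/fintype.subsetP => x; rewrite !finset.inE => /orP[]->; rewrite ?orbT.
case/negP: (Ta _ _ abT ab); apply: (@connect_trans _ _ c); apply: connect1.
  rewrite /adj !finset.inE acT andbT; apply: contraNneq bc => /set2_inj[[_ ->//]|[_ h]].
  by rewrite h eqxx in ac.
rewrite /adj !finset.inE [ [set c; b] ]finset.setUC bcT andbT.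
by apply: contraNneq ac => /set2_inj[[_ h]|[_ ->//]]; rewrite h eqxx in bc.
Qed.

(** Consecutive triples of points form disjoint triangles, each missing an edge of the tree. Keeping
    [T'] inside [T :|: S] lets the excess be charged to at most [n] edges; the total length of the
    complete graph would be too large. *)
Lemma complete_far_tree T : spanning_tree (complete_edges n) T ->
  exists T', [/\ spanning_tree (complete_edges n) T', (n %/ 3 <= #|T' :\: T|)%N &
    exists2 S : {set {set 'I_n}}, (#|S| <= n)%N & S \subset complete_edges n /\ T' \subset T :|: S].
Proof.
move=> ST; pose B := 'I_(n %/ 3).
have lt (i : B) r : (r < 3)%N -> (3 * i + r < n)%N.
  by have := ltn_ord i; have := leq_divM n 3; lia.
pose vtx (i : B) r (h : (r < 3)%N) : 'I_n := Ordinal (lt i r h).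
have hex (i : B) : exists e, [&& e \in complete_edges n, e \notin T & [forall w in e, w %/ 3 == i]]%N.
  have [|||e [eE eT es]] := @tree_misses_triangle T (@vtx i 0 isT) (@vtx i 1 isT) (@vtx i 2 isT) ST.
  - by rewrite -val_eqE /=; lia.
  - by rewrite -val_eqE /=; lia.
  - by rewrite -val_eqE /=; lia.
  exists e; rewrite eE eT /=; apply/forall_inP => w /(fintype.subsetP es).
  by rewrite !finset.inE => /orP[/orP[]|] /eqP-> /=; apply/eqP; lia.
pose s i := xchoose (hex i).
have sP i : [/\ s i \in complete_edges n, s i \notin T & {in s i, forall w : 'I_n, (w %/ 3 = i :> nat)%N}].
  have /and3P[-> -> /forall_inP h] := xchooseP (hex i).
  by split => // w /h/eqP.
have s_inj : injective s.
  move=> i j sij; have [si _ hi] := sP i; have [_ _ hj] := sP j.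
  have /cards2P[u [v [_ E']]] : #|s i| == 2 by rewrite complete_edges_card.
  have ui : u \in s i by rewrite E' !finset.inE eqxx.
  by apply: val_inj; rewrite /= -(hi _ ui) -(hj u) // -sij.
have [||e f /imsetP[i _ ->] /imsetP[j _ ->] ne|T' [ST' ST0 ST1]] :=
    @spanning_tree_insert _ (complete_edges n) T [set s i | i : B] complete_edges_card ST.
- by apply/fintype.subsetP => e /imsetP[i _ ->]; have [] := sP i.
- by move=> e /imsetP[i _ ->]; have [] := sP i.
- rewrite -setI_eq0; apply/eqP/setP => w; rewrite !finset.inE.
  apply/negP => /andP[wi wj]; have [_ _ hi] := sP i; have [_ _ hj] := sP j.
  by case/eqP: ne; congr s; apply: val_inj; rewrite /= -(hi _ wi) -(hj _ wj).
exists T'; split => //.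
  by rewrite -[X in (X <= _)%N]card_ord -(card_imset _ s_inj); apply: subset_leq_card.
exists [set s i | i : B]; first by rewrite card_imset // card_ord leq_div.
by split => //; apply/fintype.subsetP => e /imsetP[i _ ->]; have [] := sP i.
Qed.

Lemma eps_complete_le {R : realType} (l : {set 'I_n} -> R) (delta y : R) :
  (0 < n)%N -> 0 <= y -> delta * n%:R <= (n %/ 3)%:R ->
  {in complete_edges n, forall e, 0 <= l e <= y} ->
  (eps (complete_edges n) l delta <= y%:E)%E.
Proof.
move=> n0 y0 dn hl.
have n0R : 0 < n%:R :> R by rewrite ltr0n.
have [T0 ST0] := spanning_tree_exists complete_edges_card complete_connected.
have mT := mst_spanning l ST0; have ST : spanning_tree (complete_edges n) (mst (complete_edges n) l) by case/andP: mT.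
have [T' [ST' cT' [S cS [SE T'S]]]] := complete_far_tree ST.
have dT' : delta * #|'I_n|%:R <= #|T' :\: mst (complete_edges n) l|%:R.
  by rewrite card_ord; apply: (le_trans dn); rewrite ler_nat.
apply: (le_trans (eps_le ST' dT')).
rewrite lee_fin card_ord ler_pdivrMr //.
have [T2 _ _ _] := spanning_treeP _ _ ST.
have lS : len l T' <= len l (mst (complete_edges n) l) + len l S.
  rewrite /len; apply: (@le_trans _ _ (\sum_(e in mst (complete_edges n) l :|: S) l e)).
    rewrite [leRHS](bigID (mem T')) /=.
    have -> : \sum_(e in mst (complete_edges n) l :|: S | e \in T') l e = \sum_(e in T') l e.
      by apply: eq_bigl => e; case eT: (e \in T'); rewrite ?andbF // (fintype.subsetP T'S).
    rewrite lerDl; apply: sumr_ge0 => e /andP[]; rewrite !finset.inE => eT _.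
    have /hl/andP[//] : e \in complete_edges n.
    by case/orP: eT; [exact: (fintype.subsetP T2)|exact: (fintype.subsetP SE)].
  rewrite [leLHS](bigID (mem (mst (complete_edges n) l))) /=; apply: lerD.
    rewrite le_eqVlt; apply/orP; left; apply/eqP; apply: eq_bigl => e.
    by rewrite finset.inE; case: (e \in mst _ _); rewrite ?andbF.
  rewrite [leRHS](bigID (mem (mst (complete_edges n) l))) /= -[leLHS]add0r lerD //.
    apply: sumr_ge0 => e /andP[eS _]; by have /andP[] := hl _ (fintype.subsetP SE _ eS).
  rewrite le_eqVlt; apply/orP; left; apply/eqP; apply: eq_bigl => e.
  by rewrite finset.inE; case: (e \in mst _ _); rewrite ?andbF.
have : len l S <= y * n%:R.
  apply: (@le_trans _ _ (\sum_(e in S) y)).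
    by apply: ler_sum => e /(fintype.subsetP SE)/hl/andP[].
  by rewrite sumr_const -[leLHS]mulr_natr ler_wpM2l // ler_nat.
lra.
Qed.

End CompleteGraph.

(** * Euclidean cells with a near tie *)

Section BoxGeometry.
Context {R : realType} {dim : nat}.
Variables (k0 : 'I_dim) (h : nat) (u : R).
Hypothesis u0 : 0 <= u.
Implicit Types (q z : 'I_dim -> nat) (x y : 'I_dim -> R).

Definition in_box q x : Prop := forall k, (q k)%:R * u <= x k <= (q k)%:R * u + u.

Definition shift k : nat := if k == k0 then h else 0%N.

Lemma edist_same_box q x y : in_box q x -> in_box q y -> edist x y <= dim%:R * u.
Proof.
move=> hx hy; apply: enorm_le => k; have /andP[x1 x2] := hx k; have /andP[y1 y2] := hy k.
by rewrite ler_norml; apply/andP; split; lra.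
Qed.

Lemma edist_shifted_box q x y : (0 < h)%N -> in_box q x ->
  in_box (fun k => (q k + shift k)%N) y ->
  h.-1%:R * u <= edist x y <= (h + dim)%:R * u.
Proof.
move=> h0 hx hy; apply/andP; split.
  apply: le_trans (coord_le_enorm _ k0); have /andP[x1 x2] := hx k0; have /andP[y1 y2] := hy k0.
  have -> : h.-1%:R = h%:R - 1 :> R by rewrite -subn1 natrB.
  rewrite /shift eqxx natrD in y1 y2; rewrite ler_normr; apply/orP; right; lra.
pose y' k := y k - (shift k)%:R * u.
have hy' : in_box q y'.
  by move=> k; rewrite /y'; have := hy k; rewrite natrD => /andP[y1 y2]; apply/andP; split; lra.
apply: le_trans (edist_triangle x y' y) _; rewrite natrD mulrDl addrC; apply: lerD; last exact: edist_same_box hy'.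
rewrite /edist /enorm (bigD1 k0) //= big1 ?addr0; last first.
  by move=> k /negbTE kk; rewrite /y' /shift kk mul0r subr0 subrr expr0n.
by rewrite /y' /shift eqxx addrAC subrr add0r sqrrN sqrtr_sqr ger0_norm // mulr_ge0.
Qed.

(** Box [2 h] is central in a row of [4 h] boxes; on its narrower side [2 h - 1] boxes separate it
    from the boundary. *)
Lemma edist_outside z x y k : in_box (fun k => (4 * h * z k + 2 * h)%N) x ->
  (y k <= (4 * h * z k)%:R * u) \/ ((4 * h * (z k).+1)%:R * u <= y k) ->
  (2 * h%:R - 1) * u <= edist x y.
Proof.
move=> hx hy; apply: le_trans (coord_le_enorm _ k); have /andP[] := hx k.
rewrite !natrD !natrM => x1 x2; rewrite ler_normr; apply/orP.
have hu : 0 <= h%:R * u by rewrite mulr_ge0.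
by case: hy; rewrite ?mulnS ?natrD !natrM => hy; [left|right]; lra.
Qed.

End BoxGeometry.

Section Boxes.
Variables (dim g : nat).
Implicit Types (q : 'I_dim -> nat) (w : nat).

Definition box w q : pred (grid dim g) := fun a => [forall k, (a k %/ w == q k)%N].

Lemma card_box w q : (0 < w)%N -> (forall k, (q k).+1 * w <= g.+1)%N -> #|box w q| = (w ^ dim)%N.
Proof.
move=> w0 hq; rewrite -(cardsE (box w q)).
have -> : [set a in box w q] = [set a : grid dim g | [forall k, [pred b : 'I_g.+1 | (b %/ w == q k)%N] (a k)]].
  by apply/setP => a; rewrite !finset.inE.
rewrite (card_grid_family (fun k => [pred b : 'I_g.+1 | (b %/ w == q k)%N])).
rewrite -[in RHS](card_ord dim) -prod_nat_const; apply: eq_bigr => k _.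
have lt (r : 'I_w) : (q k * w + r < g.+1)%N.
  by apply: leq_trans (hq k); rewrite mulSn addnC ltn_add2r.
pose f (r : 'I_w) : 'I_g.+1 := Ordinal (lt r).
have finj : injective f by move=> r r' /(congr1 val) /= /addnI ?; apply: val_inj.
rewrite -[RHS]card_ord -(card_imset _ finj); apply: eq_card => b; rewrite inE /=.
apply/idP/imsetP => [/eqP bq|[r _ ->]]; last by rewrite /= divnMDl // divn_small ?addn0.
exists (Ordinal (ltn_pmod b w0)) => //; apply: val_inj => /=.
by rewrite -bq -divn_eq.
Qed.

End Boxes.

Section GoodCells.
Context {R : realType}.
Variables (n dim g M h G0 K : nat) (k0 : 'I_dim) (s : R).
Hypothesis h0 : (0 < h)%N.
Hypothesis G00 : (0 < G0)%N.
Local Notation eta := (s / g.+1%:R).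
Local Notation grid := (grid dim g).
Implicit Types (v : {ffun 'I_n -> grid}) (i c a b : 'I_n) (z : {ffun 'I_dim -> 'I_M}) (x : grid).

(* Cells are cut into [(4 h) ^ dim] boxes. A good cell holds exactly three points: [c] in the
   central box, [a] and [b] together in the box at offset [h] in direction [k0], at nearly
   equal distances from [c]. *)
Definition center z : 'I_dim -> nat := fun k => (4 * h * z k + 2 * h)%N.
Definition side_center z : 'I_dim -> nat := fun k => (center z k + shift k0 h k)%N.
Definition cell z : pred grid := box (4 * h * G0) (fun k => z k).
Definition center_box z : pred grid := box G0 (center z).
Definition side_box z : pred grid := box G0 (side_center z).
Definition tie_bin x y : 'I_K.+1 := bin 0 (2 / K%:R) K (gdist eta x y).

Definition good_at z c a b v : bool :=
  [&& [&& c != a, c != b & a != b], center_box z (v c), side_box z (v a), side_box z (v b),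
    tie_bin (v c) (v a) == tie_bin (v c) (v b) &
    [forall r, (r != c) && (r != a) && (r != b) ==> ~~ cell z (v r)]].

Definition good z v : bool := [exists c, [exists a, [exists b, good_at z c a b v]]].

Definition num_good_cells v : nat := #|[set z | good z v]|.

Lemma center_box_cell z x : center_box z x -> cell z x.
Proof.
move=> /forallP hx; apply/forallP => k; rewrite mulnC divnMA (eqP (hx k)) /center.
rewrite mulnC divnMDl ?muln_gt0 // divn_small ?addn0 //; move: h0; clear; lia.
Qed.

Lemma side_box_cell z x : side_box z x -> cell z x.
Proof.
move=> /forallP hx; apply/forallP => k; rewrite mulnC divnMA (eqP (hx k)) /side_center /center.
rewrite -addnA mulnC divnMDl ?muln_gt0 // divn_small ?addn0 // /shift.
by case: ifP => _; move: h0; clear; lia.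
Qed.

Lemma cell_inj z z' x : cell z x -> cell z' x -> z = z'.
Proof.
move=> /forallP h1 /forallP h2; apply/ffunP => k; apply: val_inj => /=.
by rewrite -(eqP (h1 k)) (eqP (h2 k)).
Qed.

Lemma good_upd z v i x y : ~~ cell z x -> ~~ cell z y -> good z (upd v i x) -> good z (upd v i y).
Proof.
move=> zx zy /existsP[c /existsP[a /existsP[b /and5P[ne vc va vb /andP[tb hr]]]]].
have ni r : cell z (upd v i x r) -> r != i.
  by apply: contraTneq => ->; rewrite upd_at.
have ci := ni _ (center_box_cell vc); have ai := ni _ (side_box_cell va); have bi := ni _ (side_box_cell vb).
apply/existsP; exists c; apply/existsP; exists a; apply/existsP; exists b.
rewrite /good_at ne /=; move: vc va vb tb; rewrite !upd_ne // => -> -> -> -> /=.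
apply/forallP => r; apply/implyP => rr; have := forallP hr r; rewrite rr /=.
have [->|ri] := eqVneq r i; first by rewrite !upd_at.
by rewrite !upd_ne.
Qed.

(** A moved point affects only the cell it leaves and the cell it enters. *)
Lemma num_good_cells_upd v i x y : (num_good_cells (upd v i x) <= num_good_cells (upd v i y) + 2)%N.
Proof.
have card1 t : (#|[set z | cell z t]| <= 1)%N.
  by apply/card_le1_eqP => z z'; rewrite !finset.inE => hz hz'; exact: (cell_inj hz' hz).
apply: (@leq_trans #|[set z | good z (upd v i y)] :|: ([set z | cell z x] :|: [set z | cell z y])|).
  apply: subset_leq_card; apply/fintype.subsetP => z; rewrite !finset.inE => gz.
  case: (boolP (cell z x)) => [_|zx]; first by rewrite orbT.
  case: (boolP (cell z y)) => [_|zy]; first by rewrite !orbT.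
  by rewrite (good_upd zx zy gz).
apply: leq_trans (leq_card_setU _ _) _; rewrite leq_add2l.
by apply: leq_trans (leq_card_setU _ _) _; exact: (leq_add (card1 x) (card1 y)).
Qed.

Section Swap.
Variables (x : 'I_n -> 'I_dim -> R) (v : {ffun 'I_n -> grid}).
Hypothesis hdim : h = (dim + 2)%N.
Hypothesis K0 : (0 < K)%N.
Hypothesis s0 : 0 < s.
Local Notation u := (G0%:R * eta).
Hypothesis u1 : (h + dim)%:R * u <= 1.
Hypothesis hx : forall i k, gpos eta (v i) k <= x i k <= gpos eta (v i) k + eta.
Local Notation E := (complete_edges n).
Local Notation l := (eucl_len x).

Let eta0 : 0 < eta. Proof. by rewrite divr_gt0. Qed.
Let u0 : 0 < u. Proof. by rewrite mulr_gt0 // ltr0n. Qed.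

Let box_pos q i : box G0 q (v i) -> in_box u q (x i) /\ in_box u q (gpos eta (v i)).
Proof.
move=> /forallP hq.
have hk k : (q k)%:R * u <= gpos eta (v i) k /\ gpos eta (v i) k + eta <= (q k)%:R * u + u.
  have /eqP qk := hq k; have dE := divn_eq (v i k) G0; have md := ltn_pmod (v i k) G00.
  have a1 : (q k * G0 <= v i k)%N by rewrite -qk leq_divM.
  have a2 : (v i k + 1 <= q k * G0 + G0)%N by rewrite -qk {1}dE -addnA leq_add2l addn1.
  have b1 : (q k)%:R * G0%:R * eta <= (v i k)%:R * eta.
    by rewrite -natrM ler_wpM2r ?ler_nat // (ltW eta0).
  have b2 : ((v i k)%:R + 1) * eta <= ((q k)%:R * G0%:R + G0%:R) * eta.
    by rewrite -natrM -natrD natr1 -addn1 ler_wpM2r ?ler_nat // (ltW eta0).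
  split; first by rewrite -(mulrA (q k)%:R) in b1.
  by rewrite !mulrDl mul1r -(mulrA (q k)%:R) in b2.
split => k; have [a1 a2] := hk k; have /andP[b1 b2] := hx i k.
  by rewrite (le_trans a1 b1) (le_trans b2 a2).
by rewrite a1 /= (le_trans _ a2) // lerDl ltW.
Qed.

Let len_approx i j : i != j -> `|l [set i; j] - gdist eta (v i) (v j)| <= 2 * dim%:R * eta.
Proof.
have shrink (p q e : R) : q <= p <= q + e -> `|p - q| <= e.
  by move=> /andP[b1 b2]; rewrite ler_norml; apply/andP; split; lra.
by move=> ij; rewrite eucl_lenE //; apply: edist_approx => k; apply: shrink.
Qed.

Let outside z c r : center_box z (v c) -> ~~ cell z (v r) -> (2 * h%:R - 1) * u <= edist (x c) (x r).
Proof.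
move=> hc; rewrite negb_forall => /existsP[k hk]; have [bx _] := box_pos hc.
have W0 : (0 < 4 * h * G0)%N by rewrite !muln_gt0 h0.
apply: (edist_outside (ltW u0) bx (k := k)).
have E' q : (4 * h * q)%:R * u = (q * (4 * h * G0))%:R * eta.
  by rewrite mulrA -natrM mulnAC mulnC.
have /andP[b1 b2] := hx r k; move: hk; rewrite neq_ltn !E' => /orP[lt|gt].
  left; move: lt; rewrite ltn_divLR // => lt; apply: (le_trans b2).
  have : (v r k).+1%:R * eta <= (z k * (4 * h * G0))%:R * eta.
    by rewrite ler_wpM2r ?ler_nat // (ltW eta0).
  by rewrite -natr1 mulrDl mul1r.
right; move: gt; rewrite leq_divRL // => gt.
by apply: le_trans b1; rewrite ler_wpM2r ?ler_nat // (ltW eta0).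
Qed.

(** With [h = dim + 2] three levels separate: [ab] is at most [dim u], [ca] and [cb] lie between
    [(dim + 1) u] and [(2 dim + 2) u], and every other edge at [c] has length at least
    [(2 dim + 3) u]. An exchange costs at most one bin width plus two rounding errors. *)
Lemma good_cells_swap (D0 : {set {ffun 'I_dim -> 'I_M}}) : D0 \subset [set z | good z v] ->
  exists T', [/\ spanning_tree E T', (#|D0| <= #|T' :\: mst E l|)%N &
    len l T' <= len l (mst E l) + #|D0|%:R * (2 / K%:R + 4 * dim%:R * eta)].
Proof.
move=> D0g.
have [T0 ST0] := spanning_tree_exists (@complete_edges_card n) (@complete_connected n).
have mT := mst_spanning l ST0.
have [D00|[z0 z0D]] := set_0Vmem D0.
  exists (mst E l); split; first by case/andP: mT.
    by rewrite D00 cards0.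
  by rewrite D00 cards0 mul0r addr0.
have /existsP[c0 _] : good z0 v by have := fintype.subsetP D0g _ z0D; rewrite finset.inE.
pose t z := odflt (c0, c0, c0) [pick t : 'I_n * 'I_n * 'I_n | good_at z t.1.1 t.1.2 t.2 v].
have tP z : z \in D0 -> good_at z (t z).1.1 (t z).1.2 (t z).2 v.
  move=> /(fintype.subsetP D0g); rewrite finset.inE => /existsP[c /existsP[a /existsP[b H]]].
  by rewrite /t; case: pickP => [//|/(_ (c, a, b))]; rewrite H.
pose cc z := (t z).1.1.
have cc_inj : {in D0 &, injective cc}.
  move=> z z' /tP/and3P[_ h1 _] /tP/and3P[_ h2 _] czz.
  apply: cell_inj (center_box_cell h1) _; rewrite -/(cc z) czz; exact: center_box_cell.
pose idx i := odflt z0 [pick z in D0 | cc z == i].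
have idxc z : z \in D0 -> idx (cc z) = z.
  move=> zD; rewrite /idx; case: pickP => [z' /andP[z'D /eqP/cc_inj->//]|/(_ z)].
  by rewrite zD eqxx.
pose aa i := (t (idx i)).1.2; pose bb i := (t (idx i)).2.
pose C := [set cc z | z in D0].
have Ck : #|C| = #|D0| by rewrite card_in_imset.
have aC z : z \in D0 -> aa (cc z) = (t z).1.2 by move=> zD; rewrite /aa idxc.
have bC z : z \in D0 -> bb (cc z) = (t z).2 by move=> zD; rewrite /bb idxc.
have h1R : h.-1%:R = dim%:R + 1 :> R by rewrite hdim addn2 /= natr1.
have hR : h%:R = dim%:R + 2 :> R by rewrite hdim natrD.
have dimR : 0 <= dim%:R :> R by [].
have near z c a : c != a -> center_box z (v c) -> side_box z (v a) ->
    (h.-1%:R * u <= l [set c; a] < (2 * h%:R - 1) * u) /\ gdist eta (v c) (v a) <= 1.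
  move=> ca hc ha; have [bc bc'] := box_pos hc; have [ba ba'] := box_pos ha.
  have /andP[g1 g2] := edist_shifted_box (ltW u0) h0 bc ba.
  have /andP[_ g3] := edist_shifted_box (ltW u0) h0 bc' ba'.
  split; last exact: le_trans g3 u1.
  rewrite eucl_lenE // g1 /=; apply: (le_lt_trans g2); rewrite ltr_pM2r // natrD hR; lra.
have notC z i : z \in D0 -> cell z (v i) -> i != cc z -> i \notin C.
  move=> zD zi ic; apply: contra_neqN ic => /imsetP[z' z'D iE]; rewrite iE; congr cc.
  have /and3P[_ h2 _] := tP _ z'D; apply: cell_inj (center_box_cell h2) _.
  by rewrite -/(cc z') -iE.
have [||||||T' [ST' CT' lT']] := @mst_swap_near_ties _ _ E l _ C aa bb (h.-1%:R * u)
    ((2 * h%:R - 1) * u) (2 / K%:R + 4 * dim%:R * eta) mT; last first.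
- by exists T'; rewrite -Ck.
- move=> _ /imsetP[z zD ->] i cE; rewrite aC // bC // => ia ib.
  have /and5P[_ hc _ _ /andP[_ /forallP hr]] := tP _ zD.
  have ci : cc z != i by exact: card2_neq (complete_edges_card cE).
  rewrite eucl_lenE //; apply: outside hc _; have := hr i.
  by rewrite eq_sym ci ia ib.
- move=> _ /imsetP[z zD ->]; rewrite aC // bC //.
  have /and5P[/and3P[_ _ ab] _ ha hb _] := tP _ zD.
  apply: connect1; rewrite /adj finset.inE complete_edge //= eucl_lenE //.
  apply: le_lt_trans (edist_same_box (box_pos ha).1 (box_pos hb).1) _.
  by rewrite ltr_pM2r // h1R; lra.
- move=> _ /imsetP[z zD ->]; rewrite aC // bC //.
  have /and5P[/and3P[ca cb _] hc ha hb /andP[/eqP tb _]] := tP _ zD.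
  have [_ ga] := near _ _ _ ca hc ha; have [_ gb] := near _ _ _ cb hc hb.
  have la := len_approx ca; have lb := len_approx cb.
  have K2 : 0 < 2 / K%:R :> R by rewrite divr_gt0 // ltr0n.
  (* The unclipped bins cover [[0, 2)] and the distances are at most 1, so the clipped label never
     occurs. *)
  have bin_near (y : R) : 0 <= y -> y <= 1 ->
      (bin 0 (2 / K%:R) K y)%:R * (2 / K%:R) <= y <= (bin 0 (2 / K%:R) K y)%:R * (2 / K%:R) + 2 / K%:R.
    move=> y0 y1; set m : nat := bin _ _ _ _; have mK : (m < K)%N.
      rewrite ltnNge /m bin_ge // add0r mulrC divfK ?gt_eqF ?ltr0n // -ltNge; lra.
    have := bin_lt_upper K2 mK; rewrite add0r -natr1 mulrDl mul1r => /ltW ->; rewrite andbT.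
    by have [->|m0] := posnP m; [rewrite mul0r|have := bin_lower K2 m0; rewrite add0r].
  have gd0 (p q : grid) : 0 <= gdist eta p q by exact: edist_ge0.
  have := bin_near _ (gd0 _ _) ga; have := bin_near _ (gd0 _ _) gb.
  rewrite -[bin _ _ _ (gdist _ _ (v (t z).2))]/(tie_bin _ _) -tb -[bin _ _ _ _]/(tie_bin _ _).
  move: la lb; rewrite /cc; set la := l _; set lb := l _; set da := gdist _ _ _; set db := gdist _ _ _.
  set m := _%:R * _; rewrite !ler_norml => /andP[a1 a2] /andP[a3 a4] /andP[a5 a6] /andP[a7 a8].
  have -> : 4 * dim%:R * eta = 2 * (2 * dim%:R * eta) by move: eta dim%:R => e D; ring.
  move: (2 * dim%:R * eta) (2 / K%:R) a1 a2 a3 a4 a5 a6 a7 a8 => e w a1 a2 a3 a4 a5 a6 a7 a8.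
  by clear -a1 a2 a3 a4 a5 a6 a7 a8; apply/andP; split; lra.
- move=> _ /imsetP[z zD ->]; rewrite aC // bC //.
  have /and5P[/and3P[ca cb _] hc ha hb _] := tP _ zD.
  by have [? _] := near _ _ _ ca hc ha; have [? _] := near _ _ _ cb hc hb.
- move=> _ /imsetP[z zD ->]; rewrite aC // bC //.
  have /and5P[/and3P[ca cb ab] hc ha hb _] := tP _ zD.
  split => //; apply: (notC z) => //; rewrite ?side_box_cell // eq_sym //.
- move=> _ /imsetP[z zD ->]; rewrite aC // bC //.
  have /and5P[/and3P[ca cb ab] hc ha hb _] := tP _ zD.
  by split => //; exact: complete_edge.
Qed.

End Swap.
End GoodCells.

Lemma prod_bool (R : comPzSemiRingType) (I : finType) (P B : pred I) :
  \prod_(i | P i) ((B i)%:R : R) = [forall i, P i ==> B i]%:R.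
Proof.
case: (boolP [forall i, P i ==> B i]) => [/forallP h|]; last first.
  rewrite negb_forall => /existsP[i]; rewrite negb_imply => /andP[Pi /negbTE Bi].
  by rewrite (bigD1 i) //= Bi mul0r.
by apply: big1 => i Pi; have := h i; rewrite Pi /= => ->.
Qed.

(** * Probability of a good cell *)

Section ThreePoints.
Context {R : realType}.
Variables (n dim g : nat).
Local Notation grid := (grid dim g).

(** Once the exact positions [t] of the three points are prescribed, the event is a product of
    conditions on single points. *)
Lemma Ew_three_points (c a b : 'I_n) (T : pred (grid * grid * grid)) (Q : pred grid) :
  c != a -> c != b -> a != b ->
  Ew (@unif R n dim g) (fun v => (T (v c, v a, v b) &&
     [forall r, (r != c) && (r != a) && (r != b) ==> ~~ Q (v r)])%:R) =
  #|T|%:R / #|{: grid}|%:R ^+ 3 * (1 - #|Q|%:R / #|{: grid}|%:R) ^+ (n - 3).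
Proof.
move=> ca cb ab; have ac : a != c by rewrite eq_sym.
have bc : b != c by rewrite eq_sym.
have ba : b != a by rewrite eq_sym.
pose h (t : grid * grid * grid) (r : 'I_n) (x : grid) : R :=
  if r == c then (x == t.1.1)%:R else if r == a then (x == t.1.2)%:R
  else if r == b then (x == t.2)%:R else (~~ Q x)%:R.
pose other (r : 'I_n) := (r != c) && (r != a) && (r != b).
have hprod t (F : 'I_n -> grid -> R) : (forall r, other r -> h t r =1 F r) -> forall v : 'I_n -> grid,
    \prod_r h t r (v r) = (v c == t.1.1)%:R * ((v a == t.1.2)%:R * ((v b == t.2)%:R * \prod_(r | other r) F r (v r))).
  move=> hF v; rewrite (bigD1 c) //= (bigD1 a) //= (bigD1 b) /=; last by rewrite bc.
  rewrite /h eqxx (negbTE ac) eqxx (negbTE bc) (negbTE ba) eqxx; congr (_ * (_ * (_ * _))).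
  by apply: eq_bigr => r hr; rewrite -hF.
have hother t r : other r -> h t r =1 (fun x => (~~ Q x)%:R).
  by move=> /andP[/andP[/negbTE rc /negbTE ra] /negbTE rb] x; rewrite /h rc ra rb.
have E v : (T (v c, v a, v b) && [forall r, other r ==> ~~ Q (v r)])%:R = \sum_(t | T t) \prod_r h t r (v r).
  under eq_bigr => t _ do rewrite (hprod t _ (hother t)) prod_bool.
  rewrite big_mkcond (bigD1 (v c, v a, v b)) //= !eqxx !mul1r big1 ?addr0.
    by case: (T _).
  move=> -[[x y] z] ne /=; case: (T _) => //.
  case: (eqVneq (v c) x) ne => [<-|_ _]; last by rewrite mul0r.
  case: (eqVneq (v a) y) => [<-|_ _]; last by rewrite mul0r mulr0.
  by case: (eqVneq (v b) z) => [<-|_ _]; [rewrite eqxx|rewrite mul0r !mulr0].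
under eq_Ew => v do rewrite E.
rewrite Ew_sum.
have N0 : #|{: grid}|%:R != 0 :> R by rewrite pnatr_eq0 -lt0n card_ffun !card_ord expn_gt0.
have sum1 (x : grid) r : \sum_y @unif R n dim g r y * (y == x)%:R = #|{: grid}|%:R^-1.
  by rewrite (bigD1 x) //= eqxx mulr1 big1 ?addr0 // => y /negbTE->; rewrite mulr0.
have sumQ r : \sum_x @unif R n dim g r x * (~~ Q x)%:R = 1 - #|Q|%:R / #|{: grid}|%:R.
  have sumI : \sum_x @unif R n dim g r x * (Q x)%:R = #|Q|%:R / #|{: grid}|%:R.
    rewrite /unif -mulr_sumr mulrC; congr (_ * _).
    rewrite -sum1_card natr_sum [RHS]big_mkcond /=; apply: eq_bigr => x _.
    by rewrite unfold_in; case: (Q x).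
  apply/eqP; rewrite eq_sym subr_eq -sumI -big_split /=; apply/eqP.
  rewrite -[LHS](@sum_unif R n dim g r); apply: eq_bigr => x _; rewrite -mulrDr.
  by case: (Q x); rewrite ?add0r ?addr0 mulr1.
have co : #|[pred r | other r]| = (n - 3)%N.
  have -> : #|[pred r | other r]| = #|~: [set c; a; b]|.
    by apply: eq_card => r; rewrite !inE !negb_or.
  rewrite cardsCs finset.setCK card_ord finset.setUC cardsU1 cards2 !finset.inE negb_or bc ba ca.
  by [].
rewrite (eq_bigr (fun=> #|{: grid}|%:R ^- 3 * (1 - #|Q|%:R / #|{: grid}|%:R) ^+ (n - 3))); last first.
  move=> t _; rewrite Ew_prod (bigD1 c) //= (bigD1 a) //= (bigD1 b) /=; last by rewrite bc.
  rewrite /h eqxx (negbTE ac) eqxx (negbTE bc) (negbTE ba) eqxx !sum1.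
  rewrite (eq_bigr (fun=> 1 - #|Q|%:R / #|{: grid}|%:R)); last first.
    move=> r hr; rewrite -(sumQ r); apply: eq_bigr => x _; have := hother t r hr x.
    by rewrite /h => ->.
  by rewrite prodr_const co; field.
rewrite sumr_const -[LHS]mulr_natl mulrA; congr (_ * _ * _).
Qed.

End ThreePoints.

Lemma one_sub_exp_ge {R : realFieldType} (e : R) k : 0 <= e <= 1 -> 1 - k%:R * e <= (1 - e) ^+ k.
Proof.
move=> /andP[e0 e1]; elim: k => [|k ih]; first by rewrite mul0r subr0 expr0.
rewrite exprS; apply: le_trans (_ : (1 - e) * (1 - k%:R * e) <= _); last first.
  by apply: ler_wpM2l => //; rewrite subr_ge0.
by rewrite -natr1; have := ler0n R k; have := sqr_ge0 e; nra.
Qed.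

(** Bernoulli's inequality gives [1 / 4] for a group of about [m / 2] factors, and [2 D] such groups
    cover the [n] factors. *)
Lemma one_sub_inv_exp_ge {R : realFieldType} (m n D : nat) : (2 <= m)%N -> (n <= D * m)%N ->
  4^-1 ^+ (2 * D) <= (1 - m%:R^-1) ^+ n :> R.
Proof.
move=> m2 nD; set e : R := m%:R^-1; set k := uphalf m.
have m0 : 0 < m%:R :> R by rewrite ltr0n; lia.
have e01 : 0 <= e <= 1 by rewrite invr_ge0 ler0n invf_le1 // ler1n; lia.
have f01 : 0 <= 1 - e <= 1 by move/andP: e01 => [h1 h2]; apply/andP; split; lra.
have /andP[f0 f1] := f01.
have km : (m <= 2 * k)%N by rewrite /k; lia.
have h1 : 4^-1 <= (1 - e) ^+ k.
  apply: le_trans (one_sub_exp_ge k e01).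
  have : k%:R * e <= 3 / 4.
    by rewrite ler_pdivrMr // mulrAC ler_pdivlMr // -!natrM ler_nat /k; lia.
  lra.
apply: (@le_trans _ _ ((1 - e) ^+ (k * (2 * D)))).
  by rewrite [leRHS]exprM; apply: lerXn2r; rewrite ?nnegrE ?exprn_ge0.
by apply: ler_wiXn2l => //; apply: (leq_trans nD); nia.
Qed.

Section GoodCellProbability.
Context {R : realType}.
Variables (n dim g M h G0 K : nat) (k0 : 'I_dim) (s : R).
Hypothesis h0 : (0 < h)%N.
Hypothesis G00 : (0 < G0)%N.
Hypothesis K0 : (0 < K)%N.
Hypothesis hG : g.+1 = (M * (4 * h * G0))%N.
Local Notation grid := (grid dim g).
Local Notation good_at := (@good_at R n dim g M h G0 K k0 s).
Local Notation good := (@good R n dim g M h G0 K k0 s).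
Local Notation N := (#|{: grid}|%:R : R).
Implicit Types (v : {ffun 'I_n -> grid}) (c a b : 'I_n) (z : {ffun 'I_dim -> 'I_M}).

Let M0 : (0 < M)%N.
Proof. by rewrite lt0n; apply/eqP => h1; move: hG; rewrite h1 mul0n. Qed.

Let NE : N = M%:R ^+ dim * (4 * h)%:R ^+ dim * G0%:R ^+ dim.
Proof. by rewrite card_ffun !card_ord hG natrX mulnA !natrM !exprMn. Qed.

Let side_not_center z z' (x : grid) : center_box h G0 z x -> side_box h G0 k0 z' x -> False.
Proof.
move=> hc hs; have := cell_inj (center_box_cell h0 hc) (side_box_cell h0 hs) => zz.
move: hc hs; rewrite -zz => /forallP/(_ k0)/eqP h1 /forallP/(_ k0)/eqP; rewrite h1.
by rewrite /side_center /shift eqxx; have := h0; lia.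
Qed.

Let good_at_unique z c a b c' a' b' v : good_at z c a b v -> good_at z c' a' b' v ->
  (c' == c) && (((a' == a) && (b' == b)) || ((a' == b) && (b' == a))).
Proof.
move=> /and5P[/and3P[ca cb ab] hc ha hb /andP[_ /forallP hr]].
move=> /and5P[/and3P[ca' cb' ab'] hc' ha' hb' _].
have mem r : cell h G0 z (v r) -> [|| r == c, r == a | r == b].
  by have := hr r; case: (r == c); case: (r == a); case: (r == b) => //= /negbTE->.
have cc : c' == c.
  have /or3P[//|/eqP E|/eqP E] := mem c' (center_box_cell h0 hc').
    by rewrite E in hc'; case: (side_not_center hc' ha).
  by rewrite E in hc'; case: (side_not_center hc' hb).
have nc r : side_box h G0 k0 z (v r) -> (r == a) || (r == b).
  move=> hr'; have /or3P[/eqP E|->|->] := mem r (side_box_cell h0 hr'); rewrite ?orbT //.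
  by rewrite E in hr'; case: (side_not_center hc hr').
rewrite cc /=; move: (nc _ ha') (nc _ hb') ab' => /orP[]/eqP-> /orP[]/eqP->; rewrite ?eqxx ?orbT //.
Qed.

(* The factor [2] accounts for exchanging [a] and [b]. *)
Lemma sum_good_at_le z v : \sum_c \sum_a \sum_b (good_at z c a b v)%:R <= 2 * (good z v)%:R :> R.
Proof.
case: (boolP (good z v)) => [/existsP[c /existsP[a /existsP[b H]]]|/negP ng]; last first.
  rewrite mulr0 big1 // => c _; rewrite big1 // => a _; rewrite big1 // => b _.
  case: (boolP (good_at z c a b v)) => // H; case: ng.
  by apply/existsP; exists c; apply/existsP; exists a; apply/existsP; exists b.
have U := good_at_unique H.
rewrite mulr1; apply: (@le_trans _ _ (\sum_c' \sum_a' \sum_b'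
   (c' == c)%:R * ((a' == a)%:R * (b' == b)%:R + (a' == b)%:R * (b' == a)%:R))).
  apply: ler_sum => c' _; apply: ler_sum => a' _; apply: ler_sum => b' _.
  case: (boolP (good_at z c' a' b' v)) => [/U|_]; last by rewrite mulr_ge0 // addr_ge0 // mulr_ge0.
  move=> /andP[-> /orP[/andP[-> ->]|/andP[-> ->]]]; rewrite !mul1r.
    by rewrite lerDl mulr_ge0.
  by rewrite lerDr mulr_ge0.
have delta (x : 'I_n) : \sum_y (y == x)%:R = 1 :> R.
  by rewrite (bigD1 x) //= eqxx big1 ?addr0 // => y /negbTE->.
have delta2 (x : 'I_n) (y : R) : \sum_z (z == x)%:R * y = y.
  by rewrite -mulr_suml delta mul1r.
rewrite (eq_bigr (fun c' => (c' == c)%:R * 2)); first by rewrite delta2.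
move=> c' _; under eq_bigr do rewrite -mulr_sumr; rewrite -mulr_sumr; congr (_ * _).
under eq_bigr do rewrite big_split /= -!mulr_sumr !delta !mulr1.
by rewrite big_split /= !delta.
Qed.

Let ties z : pred (grid * grid * grid) := fun t =>
  [&& center_box h G0 z t.1.1, side_box h G0 k0 z t.1.2, side_box h G0 k0 z t.2 &
      tie_bin K s t.1.1 t.1.2 == tie_bin K s t.1.1 t.2].

Let card_center z : #|center_box h G0 z : pred grid| = (G0 ^ dim)%N.
Proof.
apply: card_box => // k; rewrite hG mulnA leq_mul2r; apply/orP; right.
by rewrite /center; have := ltn_ord (z k); have := h0; clear; nia.
Qed.

Let card_side z : #|side_box h G0 k0 z : pred grid| = (G0 ^ dim)%N.
Proof.
apply: card_box => // k; rewrite hG mulnA leq_mul2r; apply/orP; right.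
rewrite /side_center /center /shift; have := ltn_ord (z k); have := h0; clear.
by case: ifP => _; nia.
Qed.

Let card_cell z : #|cell h G0 z : pred grid| = ((4 * h * G0) ^ dim)%N.
Proof. by apply: card_box => [|k]; rewrite ?muln_gt0 ?h0 // hG leq_mul2r ltn_ord orbT. Qed.

(** For each centre [x], Cauchy-Schwarz over the [K.+1] labels bounds below the number of pairs in
    the side box whose distances from [x] have equal labels. *)
Lemma card_ties_ge z : (G0%:R ^+ dim) ^+ 3 / K.+1%:R <= #|ties z|%:R :> R.
Proof.
pose cnt (x : grid) (k : 'I_K.+1) : R := \sum_(y in side_box h G0 k0 z) (tie_bin K s x y == k)%:R.
have cnt2 x : \sum_k cnt x k ^+ 2 = \sum_(y in side_box h G0 k0 z) \sum_(w in side_box h G0 k0 z)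
    (tie_bin K s x y == tie_bin K s x w)%:R.
  under eq_bigr do rewrite expr2 mulr_suml; rewrite exchange_big /=; apply: eq_bigr => y _.
  under eq_bigr do rewrite mulr_sumr; rewrite exchange_big /=; apply: eq_bigr => w _.
  rewrite (bigD1 (tie_bin K s x y)) //= eqxx mul1r big1 ?addr0; first by rewrite eq_sym.
  by move=> k; rewrite eq_sym => /negbTE->; rewrite mul0r.
have -> : #|ties z|%:R = \sum_(x in center_box h G0 z) \sum_k cnt x k ^+ 2 :> R.
  transitivity (\sum_(t : grid * grid * grid) (ties z t)%:R : R).
    by rewrite -natr_sum -sum1_card big_mkcond /=; congr (_%:R); apply: eq_bigr => t _; rewrite unfold_in; case: (ties z t).
  have mem (P : pred grid) (x : grid) : (x \in P) = P x by [].
  rewrite -(pair_bigA _ (fun p w => (ties z (p, w))%:R)) /=.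
  rewrite -(pair_bigA _ (fun x y => \sum_w (ties z ((x, y), w))%:R)) /= [RHS]big_mkcond /=.
  apply: eq_bigr => x _; rewrite mem; case hx: (center_box h G0 z x); last first.
    by rewrite big1 // => y _; rewrite big1 // => w _; rewrite /ties /= hx.
  rewrite cnt2 [RHS]big_mkcond /=; apply: eq_bigr => y _; rewrite mem.
  case hy: (side_box h G0 k0 z y); last by rewrite big1 // => w _; rewrite /ties /= hx hy.
  rewrite [RHS]big_mkcond /=; apply: eq_bigr => w _; rewrite mem.
  by rewrite /ties /= hx hy; case: (side_box h G0 k0 z w).
have cs x : (G0%:R ^+ dim) ^+ 2 / K.+1%:R <= \sum_k cnt x k ^+ 2.
  rewrite ler_pdivrMr ?ltr0n // mulrC.
  have := @sum_sqr_ge R _ [pred k : 'I_K.+1 | true] (cnt x).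
  rewrite card_ord /= (_ : \sum_(i in _) cnt x i = G0%:R ^+ dim) //.
  rewrite exchange_big /= (eq_bigr (fun=> 1)); last first.
    move=> y _; rewrite (bigD1 (tie_bin K s x y)) //= eqxx big1 ?addr0 // => k.
    by rewrite eq_sym => /negbTE->.
  by rewrite sumr_const card_side natrX.
have -> : (G0%:R ^+ dim) ^+ 3 / K.+1%:R = \sum_(x in (center_box h G0 z : pred grid)) (G0%:R ^+ dim) ^+ 2 / K.+1%:R :> R.
  by rewrite sumr_const card_center -[RHS]mulr_natl natrX mulrA -exprS.
by apply: ler_sum => x _; exact: cs.
Qed.

(** The sum runs over ordered triples of distinct points; the half comes from [sum_good_at_le]. *)
Lemma Ew_good_ge z : (3 <= n)%N ->
  n%:R * (n - 1)%:R * (n - 2)%:R / 2 * ((M%:R ^+ dim) * (4 * h)%:R ^+ dim) ^- 3 / K.+1%:R *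
  (1 - M%:R ^- dim) ^+ (n - 3) <= Ew (@unif R n dim g) (fun v => (good z v)%:R).
Proof.
move=> n3; have G0R : 0 < G0%:R ^+ dim :> R by rewrite exprn_gt0 // ltr0n.
have MR : 0 < M%:R ^+ dim :> R by rewrite exprn_gt0 // ltr0n.
have hR : 0 < (4 * h)%:R ^+ dim :> R by rewrite exprn_gt0 // ltr0n muln_gt0.
have KR : 0 < K.+1%:R :> R by rewrite ltr0n.
pose B : R := ((M%:R ^+ dim) * (4 * h)%:R ^+ dim) ^- 3 / K.+1%:R * (1 - M%:R ^- dim) ^+ (n - 3).
have M1 : 0 <= 1 - M%:R ^- dim :> R.
  by rewrite subr_ge0 invf_le1 // exprn_ege1 // ler1n.
have B0 : 0 <= B.
  by rewrite /B mulr_ge0 ?exprn_ge0 // divr_ge0 ?(ltW KR) // invr_ge0 exprn_ge0 // mulr_ge0 // ltW.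
have per c a b : c != a -> c != b -> a != b -> B <= Ew (@unif R n dim g) (fun v => (good_at z c a b v)%:R).
  move=> ca cb ab.
  have -> : Ew (@unif R n dim g) (fun v => (good_at z c a b v)%:R) =
     #|ties z|%:R / N ^+ 3 * (1 - #|cell h G0 z : pred grid|%:R / N) ^+ (n - 3).
    rewrite -(Ew_three_points (ties z) (cell h G0 z) ca cb ab); apply: eq_Ew => v.
    by rewrite /good_at ca cb ab /ties /= -!andbA.
  have -> : #|cell h G0 z : pred grid|%:R / N = M%:R ^- dim.
    by rewrite card_cell NE natrX natrM exprMn; field; rewrite !gt_eqF.
  rewrite /B; apply: ler_wpM2r; first by rewrite exprn_ge0.
  apply: (@le_trans _ _ ((G0%:R ^+ dim) ^+ 3 / K.+1%:R / N ^+ 3)).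
    by rewrite le_eqVlt NE; apply/orP; left; apply/eqP; field; rewrite !gt_eqF.
  by rewrite ler_wpM2r ?card_ties_ge // invr_ge0 exprn_ge0.
have -> : n%:R * (n - 1)%:R * (n - 2)%:R / 2 * ((M%:R ^+ dim) * (4 * h)%:R ^+ dim) ^- 3 / K.+1%:R *
  (1 - M%:R ^- dim) ^+ (n - 3) = n%:R * (n - 1)%:R * (n - 2)%:R / 2 * B by rewrite /B !mulrA.
suff h2 : n%:R * (n - 1)%:R * (n - 2)%:R * B <= 2 * Ew (@unif R n dim g) (fun v => (good z v)%:R) by lra.
rewrite -EwZ.
apply: (@le_trans _ _ (Ew (@unif R n dim g) (fun v => \sum_c \sum_a \sum_b (good_at z c a b v)%:R))); last first.
  by apply: ler_Ew => [r x|v]; [exact: unif_ge0|exact: sum_good_at_le].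
rewrite Ew_sum; have -> : n%:R * (n - 1)%:R * (n - 2)%:R * B = \sum_(c < n) \sum_(a < n | c != a) \sum_(b < n | (c != b) && (a != b)) B.
  rewrite (eq_bigr (fun=> (n - 1)%:R * ((n - 2)%:R * B))) => [|c _].
    by rewrite sumr_const card_ord -[RHS]mulr_natl !mulrA.
  rewrite (eq_bigr (fun=> (n - 2)%:R * B)) => [|a ca].
    rewrite sumr_const -[LHS]mulr_natl; congr (_%:R * _).
    have -> : #|[pred a | c != a]| = #|[set~ c]|.
      by apply: eq_card => a; rewrite !inE eq_sym.
    by rewrite cardsC1 card_ord subn1.
  rewrite sumr_const -[LHS]mulr_natl; congr (_%:R * _).
  have -> : #|[pred b | (c != b) && (a != b)]| = #|~: [set c; a]|.
    by apply: eq_card => b; rewrite !inE negb_or ![b == _]eq_sym.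
  by rewrite cardsCs finset.setCK card_ord cards2 ca.
apply: ler_sum => c _; rewrite Ew_sum [leLHS]big_mkcond; apply: ler_sum => a _.
have E0 b : 0 <= Ew (@unif R n dim g) (fun v => (good_at z c a b v)%:R).
  by apply: Ew_ge0 => //; [move=> r x; exact: unif_ge0|exact: sum_unif].
rewrite Ew_sum; case: (boolP (c != a)) => [ca|_]; last by apply: sumr_ge0.
rewrite big_mkcond; apply: ler_sum => b _.
by case: (boolP ((c != b) && (a != b))) => [/andP[cb ab]|_]; [exact: per|exact: E0].
Qed.

End GoodCellProbability.

Lemma side_sqr_le {R : realType} n dim : (0 < n)%N -> (2 <= dim)%N -> side n dim ^+ 2 <= n%:R :> R.
Proof.
move=> n0 d2; rewrite -[leRHS](@side_exp R n dim) ?(ltn_trans _ d2) //.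
by apply: ler_weXn2l => //; apply: side_ge1 => //; exact: ltn_trans d2.
Qed.

Section GoodCellCount.
Context {R : realType}.
Variables (n dim M G0 K : nat) (k0 : 'I_dim) (s : R).
Local Notation h := (dim + 2)%N.
Local Notation g := (M * (4 * h * G0)).-1.
Hypothesis G00 : (0 < G0)%N.
Hypothesis K0 : (0 < K)%N.
Hypothesis M0 : (0 < M)%N.
Hypothesis Mn : (M ^ dim <= n)%N.
Hypothesis nM : (n <= 2 ^ dim * M ^ dim)%N.
Hypothesis n4 : (4 <= n)%N.
Hypothesis M2 : (2 <= M ^ dim)%N.

(** [8^-1] from [n (n - 1) (n - 2) / 2 >= n ^ 3 / 8], a cube for three points in prescribed boxes,
    and the last power for the absence of further points in the cell. *)
Definition good_density : R := 8^-1 * ((4 * h)%:R ^- dim) ^+ 3 * 4^-1 ^+ (2 * 2 ^ dim).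

Lemma good_density_gt0 : 0 < good_density.
Proof.
by rewrite !mulr_gt0 ?exprn_gt0 ?invr_gt0 // exprn_gt0 // ltr0n muln_gt0 addn_gt0 orbT.
Qed.

Lemma good_density_le1 : good_density <= 1.
Proof.
rewrite /good_density; apply: mulr_ile1; rewrite ?mulr_ge0 ?exprn_ge0 ?invr_ge0 ?exprn_ge0 //.
  apply: mulr_ile1; rewrite ?exprn_ge0 ?invr_ge0 ?exprn_ge0 //; first by rewrite invf_le1 // ler1n.
  apply: exprn_ile1; first by rewrite invr_ge0 exprn_ge0.
  by rewrite invf_le1 ?exprn_gt0 ?ltr0n ?muln_gt0 ?addn_gt0 ?orbT // exprn_ege1 // ler1n muln_gt0 addn_gt0 orbT.
by apply: exprn_ile1 => //; rewrite invf_le1 // ler1n.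
Qed.

Lemma Ew_num_good_cells_ge : n%:R * (good_density / K.+1%:R) <=
  Ew (@unif R n dim g) (fun v => (@num_good_cells R n dim g M h G0 K k0 s v)%:R).
Proof.
have hG : g.+1 = (M * (4 * h * G0))%N by rewrite prednK // !muln_gt0 M0 G00 addn_gt0 orbT.
have h0 : (0 < h)%N by rewrite addn_gt0 orbT.
have -> : Ew (@unif R n dim g) (fun v => (@num_good_cells R n dim g M h G0 K k0 s v)%:R) =
   \sum_z Ew (@unif R n dim g) (fun v => (@good R n dim g M h G0 K k0 s z v)%:R).
  rewrite -Ew_sum; apply: eq_Ew => v; rewrite /num_good_cells -sum1dep_card natr_sum.
  by rewrite big_mkcond /=; apply: eq_bigr => z _; case: (good _ _ _ _ _ _).
set m : R := M%:R ^+ dim; set H : R := (4 * h)%:R ^+ dim.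
have mE : m = (M ^ dim)%:R by rewrite natrX.
have m0 : 0 < m by rewrite exprn_gt0 // ltr0n.
have H0 : 0 < H by rewrite exprn_gt0 // ltr0n muln_gt0.
have K1 : 0 < K.+1%:R :> R by rewrite ltr0n.
have n0 : 0 < n%:R :> R by rewrite ltr0n (leq_trans _ n4).
have mn : m <= n%:R by rewrite mE ler_nat.
apply: (@le_trans _ _ (\sum_(z : {ffun 'I_dim -> 'I_M}) n%:R / m * (good_density / K.+1%:R))).
  rewrite sumr_const card_ffun !card_ord -[leRHS]mulr_natl -mE !mulrA.
  by rewrite le_eqVlt; apply/orP; left; apply/eqP; field; rewrite !gt_eqF.
apply: ler_sum => z _.
have := Ew_good_ge k0 s h0 G00 K0 hG z (ltnW n4); apply: le_trans.
rewrite -/m -/H.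
have p1 : 4^-1 ^+ (2 * 2 ^ dim) <= (1 - m^-1) ^+ (n - 3) :> R.
  by rewrite mE; apply: one_sub_inv_exp_ge => //; apply: leq_trans nM; exact: leq_subr.
have p2 : n%:R / m * (8^-1 * (H^-1) ^+ 3) <= n%:R * (n - 1)%:R * (n - 2)%:R / 2 * (m * H) ^- 3.
  have e1 : n%:R / 2 <= (n - 1)%:R :> R by rewrite ler_pdivrMr // -natrM ler_nat; lia.
  have e2 : n%:R / 2 <= (n - 2)%:R :> R by rewrite ler_pdivrMr // -natrM ler_nat; lia.
  have e3 : m ^+ 2 / 4 <= (n - 1)%:R * (n - 2)%:R.
    apply: (@le_trans _ _ (n%:R / 2 * (n%:R / 2))); last by apply: ler_pM; rewrite ?divr_ge0.
    have : m * m <= n%:R * n%:R by apply: ler_pM => //; exact: ltW.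
    by rewrite expr2; lra.
  have -> : n%:R / m * (8^-1 * H^-1 ^+ 3) = n%:R * (m ^+ 2 / 4) / 2 * (m * H) ^- 3.
    by field; rewrite !gt_eqF.
  apply: ler_wpM2r; first by rewrite invr_ge0 exprn_ge0 // mulr_ge0 // ltW.
  by rewrite ler_wpM2r // -mulrA ler_wpM2l.
have -> : n%:R / m * (good_density / K.+1%:R) =
   n%:R / m * (8^-1 * (H^-1) ^+ 3) / K.+1%:R * 4^-1 ^+ (2 * 2 ^ dim).
  by rewrite /good_density -/H !mulrA; ring.
apply: (ler_pM _ _ _ p1).
- by apply: divr_ge0 => //; apply: mulr_ge0; [apply: divr_ge0 => //; exact: ltW|
     apply: mulr_ge0 => //; rewrite exprn_ge0 // invr_ge0 ltW].
- by rewrite exprn_ge0.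
by rewrite ler_wpM2r // invr_ge0 ltW.
Qed.

End GoodCellCount.

Lemma integral_le_two_levels {d : measure_display} {Omega : measurableType d} {R : realType}
  (P : probability Omega R) (f : Omega -> \bar R) (S N : set Omega) (A B : R) :
  measurable S -> measurable N -> P N = 0%E -> 0 <= A -> 0 <= B -> (forall w, (0 <= f w)%E) ->
  (forall w, ~ N w -> S w -> (f w <= B%:E)%E) -> (forall w, ~ N w -> ~ S w -> (f w <= A%:E)%E) ->
  (\int[P]_w f w <= A%:E + B%:E * P S)%E.
Proof.
move=> mS mN PN A0 B0 f0 fB fA.
have m1 : measurable_fun setT (fun w : Omega => (\1_S w : R)%:E).
  by apply/measurable_EFinP; exact: measurable_indic.
have i0 (w : Omega) : (0 <= (\1_S w : R)%:E)%E by rewrite lee_fin.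
have b0 (w : Omega) : (0 <= B%:E * (\1_S w : R)%:E)%E by rewrite mule_ge0.
have m2 : measurable_fun setT (fun w : Omega => (B%:E * (\1_S w : R)%:E)%E).
  by apply/measurable_EFinP; apply: measurable_funM => //; exact: measurable_indic.
apply: (@le_trans _ _ (\int[P]_w (A%:E + B%:E * (\1_S w : R)%:E))%E); last first.
  rewrite (ge0_integralD P measurableT _ _ (fun w _ => b0 w) m2) //.
  rewrite (integral_cst P measurableT) [X in (_ * X + _)%E]probability_setT mule1; apply: leeD2l.
  by rewrite (ge0_integralZl_EFin P measurableT (fun w _ => i0 w) m1 B0) integral_indic // setIT.
apply: (ge0_integral_ae_mono mN PN f0).
- by move=> w; rewrite adde_ge0.
- exact: emeasurable_funD.
move=> w Nw; have [Sw|nS] := pselect (S w).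
  by rewrite indicE mem_set // mule1; apply: le_trans (fB w Nw Sw) _; rewrite leeDr.
by rewrite indicE memNset // mule0 adde0; exact: fA.
Qed.

(** * Assembling the Euclidean upper bound *)

Section EuclideanUpperBound.
Context {d : measure_display} {Omega : measurableType d} {R : realType}.
Variables (P : nat -> probability Omega R) (dim : nat).
Variable X : forall n, 'I_n -> 'I_dim -> Omega -> R.
Hypothesis dim2 : (2 <= dim)%N.
Hypothesis mX : forall n i k, measurable_fun setT (@X n i k).
Hypothesis law : forall n, (0 < n)%N -> forall i k (B : set R), measurable B ->
  (P n (@X n i k @^-1` B) = (@lebesgue_measure R (B `&` `[0%R, side n dim]) * ((side n dim)^-1)%:E)%E)%classic.
Hypothesis indep : forall n, mutually_independent (P n) [set: 'I_n * 'I_dim] (fun ik => @X n ik.1 ik.2).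

Let Eeps (delta : R) (n : nat) : \bar R :=
  (\int[P n]_w eps (complete_edges n) (eucl_len (fun i k => @X n i k w)) delta)%E.

Lemma model2_upper : exists C d0 : R, 0 < d0 /\ forall delta, 0 < delta < d0 ->
  \forall n \near \oo%classic, (Eeps delta n <= (C * delta ^+ 2)%:E)%E.
Proof.
have dim0 : (0 < dim)%N by exact: ltnW.
have [gam gamE [gam0 gam1]] : exists2 gam : R, good_density dim = gam & 0 < gam /\ gam <= 1.
  by exists (good_density dim) => //; rewrite good_density_gt0 good_density_le1.
exists (128 / gam + 1), (gam / 8); split; first by rewrite divr_gt0.
move=> delta /andP[delta0 deltad].
pose K1 := Num.truncn (gam / (4 * delta)).
have gd2 : 2 <= gam / (4 * delta) by rewrite ler_pdivlMr ?mulr_gt0 //; lra.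
have K1_2 : (2 <= K1)%N by rewrite Num.Theory.truncn_ge_nat // (le_trans ler01) // (le_trans _ gd2) // ler1n.
(* [K] bins and the clipped label make [K1] labels; [delta < gam / 8] ensures that [K] is
   positive. *)
pose K := K1.-1; have KK1 : K.+1 = K1 by rewrite prednK // ltnW.
have K0 : (0 < K)%N by rewrite -ltnS KK1.
have KR : 0 < K%:R :> R by rewrite ltr0n.
have Kle : K.+1%:R <= gam / (4 * delta) by rewrite KK1 Num.Theory.truncn_le (le_trans _ gd2).
have Kge : K%:R^-1 <= 16 * delta / gam.
  have h : gam / (4 * delta) < K.+2%:R by rewrite KK1; exact: Num.Theory.truncnS_gt.
  have h3 : gam / (4 * delta) <= 4 * K%:R.
    apply: (le_trans (ltW h)); rewrite -natrM ler_nat; move: K0; clear; lia.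
  rewrite ler_pdivrMr ?mulr_gt0 // in h3.
  rewrite -[leLHS]mul1r ler_pdivrMr // mulrAC ler_pdivlMr // mul1r; lra.
have hK : 4 * delta <= gam / K.+1%:R.
  by rewrite ler_pdivlMr ?ltr0n // mulrC -ler_pdivlMr ?mulr_gt0.
pose k0 : 'I_dim := Ordinal dim0.
pose h := (dim + 2)%N; have h0 : (0 < h)%N by rewrite addn_gt0 orbT.
(* Since [G0 eta <= 1], this choice makes the rounding error [4 dim eta] at most one bin width
   [2 / K]. *)
have [G0 G0E G00] : exists2 G0, G0 = (2 * dim * K)%N & (0 < G0)%N.
  by exists (2 * dim * K)%N; rewrite // !muln_gt0 dim0.
near=> n.
have n2 : (2 ^ dim.+1 <= n)%N by near: n; exact: nbhs_infty_ge.
have n6 : (6 <= n)%N by near: n; exact: nbhs_infty_ge.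
have n0 : (0 < n)%N by exact: leq_trans n6.
have nR : 0 < n%:R :> R by rewrite ltr0n.
have dn : 1 <= delta * n%:R.
  rewrite mulrC -ler_pdivrMr // mul1r ltW //; near: n; exact: nbhs_infty_gtr.
set s : R := side n dim.
have s1 : 1 <= s by exact: side_ge1.
have s0 : 0 < s by exact: lt_le_trans ltr01 s1.
have sE : s ^+ dim = n%:R by exact: side_exp.
(* For [n] large, this absorbs the constants in the crude cost [dim s] on the bad event. *)
have sbig : dim%:R / delta ^+ 4 <= s.
  have t0 : 0 <= dim%:R / delta ^+ 4 by rewrite divr_ge0 // exprn_ge0 // ltW.
  rewrite leNgt; apply/negP => lt.
  have : s ^+ dim < (dim%:R / delta ^+ 4) ^+ dim by rewrite ltrXn2r // -?lt0n // ltW.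
  rewrite sE ltNge => /negP; apply; apply: ltW; near: n; exact: nbhs_infty_gtr.
(* Cells of side between 1 and 2, so that the mean number of points per cell lies between 1 and
   [2 ^ dim]. *)
pose M := Num.truncn s; have M0 : (0 < M)%N by rewrite Num.Theory.truncn_gt0.
have Ms : M%:R <= s by rewrite Num.Theory.truncn_le (le_trans ler01).
have sM : s <= 2 * M%:R.
  have := Num.Theory.truncnS_gt s; rewrite -/M -natr1 => h1.
  by have : 1 <= M%:R :> R by [rewrite ler1n]; lra.
have Mn : (M ^ dim <= n)%N.
  by rewrite -(ler_nat R) natrX -sE; apply: lerXn2r; rewrite ?nnegrE // ltW.
have nM : (n <= 2 ^ dim * M ^ dim)%N.
  by rewrite -(ler_nat R) natrM !natrX -exprMn -sE; apply: lerXn2r; rewrite ?nnegrE ?mulr_ge0 // ltW.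
have M2 : (2 <= M ^ dim)%N.
  rewrite -(@leq_pmul2l (2 ^ dim)) ?expn_gt0 //; apply: leq_trans nM.
  by rewrite mulnC -expnS.
pose g := (M * (4 * h * G0)).-1.
have hG : g.+1 = (M * (4 * h * G0))%N by rewrite prednK // muln_gt0 M0 muln_gt0 G00 muln_gt0 h0.
pose eta := s / g.+1%:R.
have GE : G0%:R * eta = s / (M * (4 * h))%:R.
  rewrite /eta hG mulnA natrM invfM mulrCA; congr (_ * _).
  by rewrite mulrCA mulfV ?mulr1 // pnatr_eq0 -lt0n.
have hM : s / (M * (4 * h))%:R <= (2 * h%:R)^-1.
  rewrite ler_pdivrMr ?ltr0n ?muln_gt0 ?M0 ?h0 // !natrM mulrC ler_pdivlMr ?mulr_gt0 ?ltr0n //.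
  by have := ler_wpM2r (ler0n R h) sM; lra.
have u1 : (h + dim)%:R * (G0%:R * eta) <= 1.
  rewrite GE; apply: le_trans (ler_wpM2l (ler0n R _) hM) _.
  by rewrite ler_pdivrMr ?mulr_gt0 ?ltr0n // mul1r -natrM ler_nat /h; clear; lia.
have eta1 : 4 * dim%:R * eta <= 2 / K%:R.
  have e1 : G0%:R * eta <= 1.
    rewrite GE; apply: (le_trans hM); rewrite invf_le1 ?mulr_gt0 ?ltr0n //.
    by rewrite -natrM ler1n muln_gt0.
  rewrite ler_pdivlMr //; move: e1; rewrite G0E !natrM; lra.
pose x := 2 / K%:R + 4 * dim%:R * eta.
have x0 : 0 <= x by rewrite addr_ge0 ?divr_ge0 ?mulr_ge0 // ltW // divr_gt0 // ltr0n.
have xle : x <= 4 / K%:R by rewrite /x; lra.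
pose F v : R := (@num_good_cells R n dim g M h G0 K k0 s v)%:R.
pose Fbad := [pred v : {ffun 'I_n -> grid dim g} | F v <= Ew (@unif R n dim g) F - 2 * delta * n%:R].
have EF : 4 * delta * n%:R <= Ew (@unif R n dim g) F.
  apply: le_trans (Ew_num_good_cells_ge k0 s G00 K0 M0 Mn nM (leq_trans _ n6) M2) => //.
  by rewrite gamE [leRHS]mulrC; apply: ler_wpM2r.
have p0 := @unif_ge0 R n dim g; have p1 := @sum_unif R n dim g.
have pbad : Ew (@unif R n dim g) (fun v => (Fbad v)%:R) <= (delta ^+ 2 * n%:R)^-1.
  have dn0 : 0 < 2 * delta * n%:R by rewrite !mulr_gt0.
  apply: le_trans (Ew_chebyshev p0 p1 (c := fun=> 2) _ dn0) _.
    move=> i v a b; have h1 := num_good_cells_upd M G0 K k0 s h0 v i a b.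
    have h2 := num_good_cells_upd M G0 K k0 s h0 v i b a.
    have {}h1 : F (upd v i a) <= F (upd v i b) + 2 by rewrite /F -natrD ler_nat; exact: h1.
    have {}h2 : F (upd v i b) <= F (upd v i a) + 2 by rewrite /F -natrD ler_nat; exact: h2.
    move: h1 h2; move: (F _) (F _) => F1 F2 h1 h2.
    by rewrite ler_norml; apply/andP; split; lra.
  rewrite sumr_const card_ord -[_ *+ n]mulr_natl.
  by rewrite le_eqVlt; apply/orP; left; apply/eqP; field; rewrite !gt_eqF.
have lawn := @law n n0.
have [mS PS] := conf_event s0 (@mX n) lawn (@indep n) Fbad.
have [mN PN] := cube_full (@mX n) lawn.
set N := [set w | exists _, _]%classic in mN PN.
set S := [set w | _]%classic in mS PS.
pose A := 128 / gam * delta ^+ 2; pose B := dim%:R * s.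
have A0 : 0 <= A by rewrite mulr_ge0 ?sqr_ge0 // divr_ge0 // ltW.
have B0 : 0 <= B by rewrite mulr_ge0 // ltW.
have bounds w i k : ~ N w -> 0 <= @X n i k w <= s.
  by move=> Nw; apply/negPn/negP => hn; apply: Nw; exists (i, k).
have bad w : ~ N w -> (eps (complete_edges n) (eucl_len (fun i k => @X n i k w)) delta <= B%:E)%E.
  move=> Nw; apply: eps_complete_le => //.
    apply: (@le_trans _ _ (n%:R / 6)); first by rewrite ler_pdivlMr //; move: deltad gam1 nR; nra.
    by rewrite ler_pdivrMr // -natrM ler_nat; move: n6; clear; lia.
  move=> e; rewrite finset.inE => /cards2P[i [j [ij ->]]]; rewrite eucl_lenE // edist_ge0 /=.
  apply: enorm_le => k; have /andP[a1 a2] := bounds w i k Nw; have /andP[b1 b2] := bounds w j k Nw.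
  by rewrite ler_norml; apply/andP; split; lra.
have good w : ~ N w -> ~~ Fbad (conf g (@X n) s w) ->
    (eps (complete_edges n) (eucl_len (fun i k => @X n i k w)) delta <= A%:E)%E.
  move=> Nw; rewrite /= -ltNge; set v := conf _ _ _ _ => Fv.
  have Fv2 : 2 * delta * n%:R < F v by apply: le_lt_trans Fv; move: EF; lra.
  pose k := (Num.truncn (delta * n%:R)).+1.
  have dk : delta * n%:R <= k%:R by rewrite ltW // Num.Theory.truncnS_gt.
  have kd : k%:R <= 2 * delta * n%:R.
    have : (Num.truncn (delta * n%:R))%:R <= delta * n%:R.
      by rewrite Num.Theory.truncn_le (le_trans ler01).
    by rewrite /k -natr1; move: dn; lra.
  have kF : (k <= #|[set z | @good R n dim g M h G0 K k0 s z v]|)%N.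
    by rewrite -(ler_nat R); apply: ltW; apply: le_lt_trans Fv2.
  have [D0 D0g D0k] := subset_of_card kF.
  have hx i k' : gpos eta (v i) k' <= @X n i k' w <= gpos eta (v i) k' + eta.
    by apply: conf_bounds => //; exact: bounds.
  have [T' [ST' CT' lT']] := good_cells_swap h0 G00 erefl K0 s0 u1 hx D0g.
  have dT' : delta * #|'I_n|%:R <= #|T' :\: mst (complete_edges n) (eucl_len (fun i k => @X n i k w))|%:R.
    by rewrite card_ord; apply: (le_trans dk); rewrite ler_nat -D0k.
  apply: (le_trans (eps_le ST' dT')).
  rewrite lee_fin card_ord ler_pdivrMr //.
  apply: (@le_trans _ _ (k%:R * x)); first by rewrite -D0k; move: lT'; rewrite -/eta -/x; lra.
  apply: (@le_trans _ _ (2 * delta * n%:R * (4 * (16 * delta / gam)))).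
    apply: ler_pM => //; apply: (le_trans xle); by rewrite ler_wpM2l.
  by rewrite le_eqVlt /A; apply/orP; left; apply/eqP; field; rewrite gt_eqF.
apply: le_trans (integral_le_two_levels mS mN PN A0 B0 (fun w => eps_ge0 _ _ _) _ _) _.
- by move=> w Nw _; exact: bad.
- by move=> w Nw /negP hg; exact: good.
rewrite PS -EFinM -EFinD lee_fin [leRHS]mulrDl mul1r lerD2l.
apply: le_trans (ler_wpM2l B0 pbad) _.
(* This is where [dim >= 2] enters: the bad event has probability at most [1 / (delta ^ 2 n)], the
   crude excess is [dim s], and their product is small because [s ^ 2 <= n]. *)
have sn : s ^+ 2 <= n%:R by exact: side_sqr_le.
rewrite ler_pdivrMr ?mulr_gt0 ?exprn_gt0 // /B.
apply: (@le_trans _ _ (delta ^+ 2 * (delta ^+ 2 * s ^+ 2))); last first.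
  by apply: ler_wpM2l; rewrite ?sqr_ge0 //; apply: ler_wpM2l; rewrite ?sqr_ge0.
have -> : delta ^+ 2 * (delta ^+ 2 * s ^+ 2) = (s * delta ^+ 4) * s by ring.
by rewrite ler_wpM2r ?(ltW s0) // -ler_pdivrMr ?exprn_gt0.
Unshelve. all: by end_near. Qed.

End EuclideanUpperBound.

Local Open Scope classical_set_scope.
Local Open Scope ring_scope.

Theorem theorem1 (R : realType) (d : nat) (hd : (2 <= d)%N) :
  (* Model 1: disordered lattice {1..m}^d, n = m^d, i.i.d. edge lengths with
     density f (bounded, continuous, finite mean, supported on (0,oo)). *)
  (forall (dO : measure_display) (Omega : measurableType dO)
          (P : nat -> probability Omega R)
          (L : forall m : nat, {set lattice_vertex d m} -> Omega -> R)
          (f : R -> R),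
     measurable_fun setT f ->
     (forall x, 0 <= f x) ->
     (forall x, x <= 0 -> f x = 0) ->
     (exists M : R, forall x, f x <= M) ->
     {within `]0, +oo[, continuous f} ->
     (\int[@lebesgue_measure R]_x (`|x| * f x)%:E < +oo)%E ->
     (forall m e, e \in lattice_edges d m -> measurable_fun setT (L m e)) ->
     (forall m e, e \in lattice_edges d m -> forall B : set R, measurable B ->
        P m (L m e @^-1` B) = (\int[@lebesgue_measure R]_(x in B) (f x)%:E)%E) ->
     (forall m, mutually_independent (P m) (lattice_edges d m) (L m)) ->
     let Eeps (delta : R) (m : nat) : \bar R :=
       (\int[P m]_w eps (lattice_edges d m) (fun e => L m e w) delta)%E in
     (limf_esup (fun delta : R => ((delta ^- 2)%:E * limn_esup (Eeps delta))%E)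
                (0 : R)^'+ < +oo)%E /\
     (0 < limf_einf (fun delta : R => ((delta ^- 2)%:E * limn_einf (Eeps delta))%E)
                (0 : R)^'+)%E)
  /\
  (* Model 2: n independent uniform points in [0, n^(1/d)]^d, complete graph
     with Euclidean edge lengths; the point coordinates X n i k are i.i.d. *)
  (forall (dO : measure_display) (Omega : measurableType dO)
          (P : nat -> probability Omega R)
          (X : forall n : nat, 'I_n -> 'I_d -> Omega -> R),
     (forall n i k, measurable_fun setT (X n i k)) ->
     (forall n, (0 < n)%N -> forall i k (B : set R), measurable B ->
        P n (X n i k @^-1` B) =
        let side : R := (n%:R `^ (d%:R)^-1)%R in
        (@lebesgue_measure R (B `&` `[0%R, side]) * (side^-1)%:E)%E) ->
     (forall n, mutually_independent (P n) [set: 'I_n * 'I_d]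
                  (fun ik => X n ik.1 ik.2)) ->
     let Eeps (delta : R) (n : nat) : \bar R :=
       (\int[P n]_w eps (complete_edges n)
                       (eucl_len (fun i k => X n i k w)) delta)%E in
     (limf_esup (fun delta : R => ((delta ^- 2)%:E * limn_esup (Eeps delta))%E)
                (0 : R)^'+ < +oo)%E /\
     (0 < limf_einf (fun delta : R => ((delta ^- 2)%:E * limn_einf (Eeps delta))%E)
                (0 : R)^'+)%E).
Proof.
split.
  move=> dO Omega P L f mf f0 fneg fM _ fmean mL law indep; split.
    have [C [d0 [d00 h]]] := model1_upper hd mf f0 fneg fM fmean mL law indep.
    exact: scaling_upper d00 h.
  have [c [c0 h]] := model1_lower mf f0 fneg fM fmean mL law indep.
  by apply: (scaling_lower ltr01 c0) => delta /andP[delta0 _]; exact: h.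
move=> dO Omega P X mX law indep; split.
  have [C [d0 [d00 h]]] := model2_upper hd mX law indep.
  exact: scaling_upper d00 h.
have [c [d0 [c0 d00 h]]] := model2_lower (ltnW hd) mX law indep.
exact: scaling_lower d00 c0 h.
Qed.
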